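(* Let $m\ge1$ and let $\omega$ be a continuous nondecreasing function on $[0,+\infty)$ with $\omega(0)=0$, such that $\omega(2\delta)<2\omega(\delta)$ for all sufficiently small $\delta>0$. Let $\chi(\delta)=\delta\omega(\delta)$, $\chi^{-1}$ its inverse function, and define $$\Theta_1(y)=\frac{y}{\log y}\chi^{-1}\Big(\frac{(\log y)^2}{y}\Big),\qquad \Theta_p(y)=\Big(\int_1^y\Big(\chi^{-1}\Big(\frac1\tau\Big)\Big)^pd\tau\Big)^{1/p}\ (1<p<2).$$ Then there exists a real function $\varphi\in C^{1,\omega}(\mathbb T^m)$ with nowhere degenerate gradient such that for all $p$, $1\leq p<2$, $$\|e^{i\lambda\varphi}\|_{A_p(\mathbb T^m)}=O\big((\Theta_p(|\lambda|))^m\big),\qquad |\lambda|\to\infty,\ \lambda\in\mathbb R.$$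
   Context: $\mathbb T^m=\mathbb R^m/2\pi\mathbb Z^m$; functions on $\mathbb T^m$ are identified with $2\pi$-periodic (in each variable) functions on $\mathbb R^m$. $\widehat f(k)=(2\pi)^{-m}\int_{\mathbb T^m}f(t)e^{-i(k,t)}dt$; $A_1(\mathbb T^m)$ is the space of continuous $f$ with $\widehat f\in l^1(\mathbb Z^m)$, for $1<p\le2$ $A_p(\mathbb T^m)$ is the space of integrable $f$ with $\widehat f\in l^p$; $\|f\|_{A_p(\mathbb T^m)}=\|\widehat f\|_{l^p(\mathbb Z^m)}$. $C^{1,\omega}(\mathbb T^m)$ is the class of $2\pi$-periodic functions on $\mathbb R^m$ whose first-order partial derivatives $g$ satisfy $\sup_{|t_1-t_2|\le\delta}|g(t_1)-g(t_2)|=O(\omega(\delta))$ as $\delta\to+0$. The gradient of $\varphi$ is nowhere degenerate if $|\nabla\varphi(V)|>0$ (Lebesgue measure) for every nonempty open set $V\subseteq\mathbb R^m$. *)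

(* Defs.v *)
From HB Require Import structures.
From mathcomp Require Import all_boot all_order all_algebra.
From mathcomp Require Import all_classical all_reals all_analysis.
Set Implicit Arguments. Unset Strict Implicit. Unset Printing Implicit Defensive.
Import Order.TTheory GRing.Theory Num.Theory.
Import numFieldNormedType.Exports.
Local Open Scope classical_set_scope.
Local Open Scope ring_scope.

Section Defs.
Variable R : realType.

Definition modulus_hyp (w : R -> R) : Prop :=
  {within `[0, +oo[, continuous w} /\
  (forall x y : R, 0 <= x -> x <= y -> w x <= w y) /\
  w 0 = 0 /\
  (exists d0 : R, 0 < d0 /\ forall d : R, 0 < d -> d < d0 -> w (2 * d) < 2 * w d).

Definition chi (w : R -> R) (d : R) : R := d * w d.

Definition chi_inv (w : R -> R) (x : R) : R :=
  xget 0 [set d : R | 0 <= d /\ chi w d = x].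

Definition Theta (w : R -> R) (p y : R) : R :=
  if p == 1 then y / ln y * chi_inv w ((ln y) ^+ 2 / y)
  else (Rintegral lebesgue_measure `[1, y] (fun tau => chi_inv w (tau^-1) `^ p)) `^ p^-1.

Variable m : nat.

Definition unitv (i : 'I_m) : 'rV[R]_m := delta_mx 0 i.

Definition periodic (f : 'rV[R]_m -> R) : Prop :=
  forall (t : 'rV[R]_m) (i : 'I_m), f (t + (2 * pi) *: unitv i) = f t.

Definition partial (i : 'I_m) (f : 'rV[R]_m -> R) (t : 'rV[R]_m) : R :=
  'D_(unitv i) f t.

Definition grad (f : 'rV[R]_m -> R) (t : 'rV[R]_m) : 'rV[R]_m :=
  \row_i partial i f t.

Definition edist (s t : 'rV[R]_m) : R :=
  Num.sqrt (\sum_i (s 0 i - t 0 i) ^+ 2).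

Definition C1omega (w : R -> R) (f : 'rV[R]_m -> R) : Prop :=
  periodic f /\
  (forall (i : 'I_m) (t : 'rV[R]_m), derivable f t (unitv i)) /\
  (forall i : 'I_m, exists C d0 : R, 0 < d0 /\
     forall (d : R) (t1 t2 : 'rV[R]_m), 0 < d -> d <= d0 -> edist t1 t2 <= d ->
       `|partial i f t1 - partial i f t2| <= C * w d).

Definition box (a b : 'rV[R]_m) : set 'rV[R]_m :=
  [set x | forall i, a 0 i <= x 0 i <= b 0 i].

Definition boxvol (a b : 'rV[R]_m) : R := \prod_i (b 0 i - a 0 i).

Definition leb_outer (A : set 'rV[R]_m) : \bar R :=
  ereal_inf [set x : \bar R | exists a b : nat -> 'rV[R]_m,
     (forall n i, a n 0 i <= b n 0 i) /\
     A `<=` \bigcup_n box (a n) (b n) /\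
     x = (\sum_(0 <= n <oo) (boxvol (a n) (b n))%:E)%E].

Definition grad_nowhere_degenerate (f : 'rV[R]_m -> R) : Prop :=
  forall V : set 'rV[R]_m, open V -> V !=set0 -> (0 < leb_outer (grad f @` V))%E.

Definition setcoord (x : 'rV[R]_m) (i : 'I_m) (u : R) : 'rV[R]_m :=
  \row_j (if j == i then u else x 0 j).

Fixpoint iter_int (s : seq 'I_m) (f : 'rV[R]_m -> R) (x : 'rV[R]_m) : R :=
  match s with
  | [::] => f x
  | i :: s' => Rintegral lebesgue_measure `[0, 2 * pi]
                 (fun u => iter_int s' f (setcoord x i u))
  end.

Definition torus_int (f : 'rV[R]_m -> R) : R := iter_int (enum 'I_m) f 0.

Definition kdot (k : 'rV[int]_m) (t : 'rV[R]_m) : R := \sum_j (k 0 j)%:~R * t 0 j.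

(* |\hat{e^{i lambda phi}}(k)| where
   \hat f(k) = (2pi)^{-m} int_{T^m} f(t) e^{-i(k,t)} dt; with
   theta(t) = lambda phi(t) - (k,t), e^{i lambda phi(t)} e^{-i(k,t)} = cos theta + i sin theta *)
Definition fourier_exp_abs (lam : R) (f : 'rV[R]_m -> R) (k : 'rV[int]_m) : R :=
  (2 * pi) ^- m *
  Num.sqrt ((torus_int (fun t => cos (lam * f t - kdot k t))) ^+ 2 +
            (torus_int (fun t => sin (lam * f t - kdot k t))) ^+ 2).

Definition Ap_sum (p lam : R) (f : 'rV[R]_m -> R) : \bar R :=
  \esum_(k in [set: 'rV[int]_m]) ((fourier_exp_abs lam f k) `^ p)%:E.

End Defs.

(* Main.v *)
(* One builds phi1 on the circle and takes phi(t) = sum_i phi1(t_i): the Fourier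
   coefficients of exp(i lam phi) then factor, and the gradient of phi maps a
   small cube onto a set containing a box as soon as phi1' is nowhere constant.

   The doubling hypothesis gives scales dl n with w(dl n) = ka 2^-n and
   2 dl(n+1) < dl n, hence Cantor functions K_n on [0, dl n] with modulus of
   continuity O(2^n w), whose gaps have relative size 1 - 2 dl(n+1) / dl n.
   phi1' is a series of bumps b_j made of four copies of K_(n_j), of height
   8^-(j+1) 2^-n_j; the j-th bump sits in the j-th rational interval and inside
   an interval on which b_0, ..., b_(j-1) are all constant.  Therefore adding the
   j-th bump changes exp(i lam phi1) only on the support of that bump, where the
   previous phase is affine, and the Fourier coefficients of phi1 are dominated by
   the sum over j of those of a single modulated bump.

   For one bump at scale n, van der Corput's lemma applies off the intervals where
   K_n is within 1/rho of the frequency; such an interval is shorter than rho unless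
   the frequency is near a multiple of 2^-d, where dl(n+d) <= rho.  So at most
   O(2^-n / chi rho) coefficients exceed a multiple of rho, and a layer-cake
   summation over rho gives
     sum c^p <= C (2^-n Theta_p^p + dl(n)^(p-1))          (p > 1),
     sum c   <= C (2^-n Theta_1 + min(1, lam 4^-n))       (p = 1).
   As n_j >= 2 j, the weights 2^((p-1)(j+1)) coming from convexity of x^p are
   absorbed when summing over j. *)

Require Import Defs.
From HB Require Import structures.
From mathcomp Require Import all_boot all_order all_algebra.
From mathcomp Require Import all_classical all_reals all_analysis.
From mathcomp Require Import measurable_realfun.
From mathcomp Require Import ring lra.
Set Implicit Arguments. Unset Strict Implicit. Unset Printing Implicit Defensive.
Import Order.TTheory GRing.Theory Num.Theory.
Import numFieldNormedType.Exports.
Local Open Scope classical_set_scope.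
Local Open Scope ring_scope.

(** The gaps that make a Cantor function easy to estimate are also where it is constant, so one
    Cantor function never gives a nondegenerate gradient and bumps are needed in every interval.
    Unrelated bumps would spoil the estimate, which rests on knowing the level sets of the slope.
    Flatness of the earlier bumps under a new one removes this obstacle: there the slope is a
    constant plus one ladder, the constant only translates the frequency, and the bounds for a bump
    are invariant under such translations. Flat spots always remain, because a finite sum of bumps
    is still constant on a dense family of intervals. The factor 8 in the heights cancels the 8 in
    the modulus of a bump (four ladders, each moving by at most twice the dyadic step), and makes
    all later bumps together too small to undo the oscillation of the current one. The case p = 1
    has no gain from dl(n)^(p-1): every bump with lam 4^-n above 1 may contribute a constant. There
    are O(log lam) of these, which is affordable because Theta_1(lam) is at least a multiple of log
    lam. *)

Lemma pow2_small (R : realType) (c e : R) : 0 < e -> exists N, c * (2 ^+ N)^-1 < e.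
Proof.
move=> e0; exists (Num.bound `|c / e|).
rewrite ltr_pdivrMr ?exprn_gt0// mulrC -ltr_pdivrMr//.
apply: (le_lt_trans (ler_norm _)); apply: (lt_le_trans (Num.Theory.archi_boundP _)) => //.
by rewrite -natrX ler_nat ltnW// ltn_expl.
Qed.

(** * Cantor functions with prescribed gap lengths *)

Section Ladder.
Variables (R : realType) (dl : nat -> R).
Hypothesis dl_gt0 : forall n, 0 < dl n.
Hypothesis dl2 : forall n, 2 * dl n.+1 < dl n.

(** Starting from the unit step at the right end [dl n], and not from a linear ramp, makes the
    approximations increase with [N], so the limit exists by monotonicity alone. *)
Fixpoint ladder_approx (N n : nat) (t : R) : R :=
  if N is N'.+1 then
    (ladder_approx N' n.+1 t + ladder_approx N' n.+1 (t - (dl n - dl n.+1))) / 2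
  else (dl n <= t)%R%:R.

(* The Cantor function of the set obtained from [[0, dl n]] by keeping, at the
   [k]-th step, the two extreme subintervals of length [dl (n + k)]. *)
Definition ladder (n : nat) (t : R) : R := limn (fun N => ladder_approx N n t).

Lemma ladder_approx_bound N n t : 0 <= ladder_approx N n t <= 1.
Proof.
elim: N n t => [|N IH] n t /=; first by case: (dl n <= t); rewrite ?lexx ?ler01.
have := IH n.+1 t; have := IH n.+1 (t - (dl n - dl n.+1)); lra.
Qed.

Lemma ladder_approx_mono N n s t : s <= t ->
  ladder_approx N n s <= ladder_approx N n t.
Proof.
elim: N n s t => [|N IH] n s t st /=.
  have [ds|ds] := leP (dl n) s; last by case: (dl n <= t); rewrite ?ler01.
  by rewrite (le_trans ds st).
have := IH n.+1 _ _ st.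
have : s - (dl n - dl n.+1) <= t - (dl n - dl n.+1) by lra.
move=> /(IH n.+1); lra.
Qed.

Lemma ladder_approx_nondecreasing n t :
  nondecreasing_seq (fun N => ladder_approx N n t).
Proof.
apply/nondecreasing_seqP => N; elim: N n t => [|N IH] n t.
  rewrite [leRHS]/=.
  have d1 := dl_gt0 n.+1; have d2 := dl2 n.
  rewrite /=; have [dt|dt] := leP (dl n) t; last first.
    by case: (dl n.+1 <= t); case: (dl n.+1 <= _); rewrite /=; lra.
  have -> : (dl n.+1 <= t) = true by apply/idP; lra.
  have -> : (dl n.+1 <= t - (dl n - dl n.+1)) = true by apply/idP; lra.
  rewrite /=; lra.
have h1 := IH n.+1 t; have h2 := IH n.+1 (t - (dl n - dl n.+1)).
change (ladder_approx N.+1 n t) with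
  ((ladder_approx N n.+1 t + ladder_approx N n.+1 (t - (dl n - dl n.+1))) / 2).
change (ladder_approx N.+2 n t) with
  ((ladder_approx N.+1 n.+1 t + ladder_approx N.+1 n.+1 (t - (dl n - dl n.+1))) / 2).
lra.
Qed.

Lemma ladder_approx_cvg n t : cvgn (fun N => ladder_approx N n t).
Proof.
apply: nondecreasing_is_cvgn; first exact: ladder_approx_nondecreasing.
by exists 1 => _ [N _ <-]; case/andP: (ladder_approx_bound N n t).
Qed.

Lemma ladderE n t :
  ladder n t = (ladder n.+1 t + ladder n.+1 (t - (dl n - dl n.+1))) / 2.
Proof.
apply/cvg_lim => //; rewrite -cvg_shiftS /=.
apply: cvgMr_tmp; apply: cvgD; exact: ladder_approx_cvg.
Qed.

Lemma ladder_ge0 n t : 0 <= ladder n t.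
Proof.
apply: limr_ge; first exact: ladder_approx_cvg.
by near=> N; case/andP: (ladder_approx_bound N n t).
Unshelve. all: by end_near. Qed.

Lemma ladder_le1 n t : ladder n t <= 1.
Proof.
apply: limr_le; first exact: ladder_approx_cvg.
by near=> N; case/andP: (ladder_approx_bound N n t).
Unshelve. all: by end_near. Qed.

Lemma ladder_mono n s t : s <= t -> ladder n s <= ladder n t.
Proof.
move=> st; apply: ler_lim; try exact: ladder_approx_cvg.
by near=> N; apply: ladder_approx_mono.
Unshelve. all: by end_near. Qed.

Lemma ladder_lt0 n t : t <= 0 -> ladder n t = 0.
Proof.
move=> t0; apply/cvg_lim => //.
suff H N k s : s <= 0 -> ladder_approx N k s = 0.
  by under eq_fun do rewrite H//; apply: cvg_cst.
elim: N k s => [|N IH] k s s0 /=.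
  have := dl_gt0 k; have [|//] := leP (dl k) s; lra.
have := dl_gt0 k.+1; have := dl2 k => h1 h2.
rewrite !IH//; lra.
Qed.

Lemma ladder_gt1 n t : dl n <= t -> ladder n t = 1.
Proof.
move=> t0; apply/cvg_lim => //.
suff H N k s : dl k <= s -> ladder_approx N k s = 1.
  by under eq_fun do rewrite H//; apply: cvg_cst.
elim: N k s => [|N IH] k s s0 /=; first by rewrite s0.
have := dl_gt0 k.+1; have := dl2 k => h1 h2.
rewrite !IH//; lra.
Qed.

Lemma ladder_left n t : t <= dl n - dl n.+1 -> ladder n t = ladder n.+1 t / 2.
Proof. by move=> tn; rewrite ladderE [X in _ + X]ladder_lt0 ?addr0//; lra. Qed.

Lemma ladder_right n t : dl n.+1 <= t ->
  ladder n t = (1 + ladder n.+1 (t - (dl n - dl n.+1))) / 2.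
Proof. by move=> tn; rewrite ladderE [X in X + _]ladder_gt1. Qed.

Lemma dl_decr n d : dl (n + d) <= dl n.
Proof.
elim: d => [|d IH]; first by rewrite addn0.
rewrite addnS; have := dl2 (n + d); have := dl_gt0 (n + d).+1; lra.
Qed.

(** The first construction interval of depth [d] has length [dl (n + d)] and carries mass [2 ^- d]:
    to the left of the middle gap only the first term of [ladderE] survives. *)
Lemma ladder_left_edge n d h : h <= dl (n + d) -> ladder n h <= (2 ^+ d)^-1.
Proof.
elim: d n => [|d IH] n hd; first by rewrite expr0 invr1 ladder_le1.
have hd' : h <= dl (n.+1 + d) by rewrite addSnnS.
have := dl_decr n.+1 d => h1; have h2 := dl2 n; have h3 := dl_gt0 n.+1.
rewrite ladder_left; last lra.
by rewrite exprS invfM mulrC ler_pM2l ?invr_gt0// IH.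
Qed.

Lemma ladder_right_edge n d h : h <= dl (n + d) ->
  1 - ladder n (dl n - h) <= (2 ^+ d)^-1.
Proof.
elim: d n => [|d IH] n hd.
  by rewrite expr0 invr1 lerBlDr lerDl ladder_ge0.
have hd' : h <= dl (n.+1 + d) by rewrite addSnnS.
have := dl_decr n.+1 d => h1; have h2 := dl2 n; have h3 := dl_gt0 n.+1.
rewrite ladder_right; last lra.
rewrite (_ : _ - _ - (_ - _) = dl n.+1 - h); last by ring.
rewrite exprS invfM; have := IH _ hd'; set a := ladder _ _; set b := (2 ^+ d)^-1; lra.
Qed.

(** If both points are served by the same half, induct. Otherwise the interval straddles the middle
    gap and the increment is the sum of one right-edge and one left-edge increment, which is where
    the factor 2 comes from. *)
Lemma ladder_modulus n d (s t : R) : s <= t -> t - s <= dl (n + d) ->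
  ladder n t - ladder n s <= 2 * (2 ^+ d)^-1.
Proof.
elim: d n s t => [|d IH] n s t st tsd.
  rewrite expr0 invr1; have := ladder_ge0 n s; have := ladder_le1 n t; lra.
have hd' : t - s <= dl (n.+1 + d) by rewrite addSnnS.
have h1 := dl_decr n.+1 d; have h2 := dl2 n; have h3 := dl_gt0 n.+1.
have e : (2 ^+ d.+1)^-1 = 2^-1 * (2 ^+ d)^-1 :> R by rewrite exprS invfM.
have pd : 0 < (2 ^+ d)^-1 :> R by rewrite invr_gt0 exprn_gt0.
set r := dl n - dl n.+1.
have [tr|rt] := leP t r.
  rewrite !(@ladder_left n); try by rewrite -/r; lra.
  have := IH n.+1 _ _ st hd'; rewrite e; set a := (2 ^+ d)^-1 in pd *; lra.
have [sr|rs] := leP (dl n.+1) s.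
  rewrite !(@ladder_right n); try by rewrite /r in rt *; lra.
  have st' : s - r <= t - r by lra.
  have tsd' : (t - r) - (s - r) <= dl (n.+1 + d) by lra.
  have := IH n.+1 _ _ st' tsd'; rewrite e /r; set a := (2 ^+ d)^-1 in pd *; lra.
rewrite (ladder_right (n := n) (t := t)); last by rewrite /r in rt; lra.
rewrite (ladder_left (n := n) (t := s)); last by rewrite /r in rt; lra.
have : t - r <= dl (n.+1 + d) by rewrite /r in rt *; lra.
move=> /(ladder_left_edge (n := n.+1)); rewrite /r => e1.
have : dl n.+1 - s <= dl (n.+1 + d) by rewrite /r in rt *; lra.
move=> /(ladder_right_edge (n := n.+1)); rewrite opprB addrCA subrr addr0 => e2.
move: e1 e2; rewrite e; set a := (2 ^+ d)^-1; lra.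
Qed.

Lemma ladder_dist n d (s t : R) : `|t - s| <= dl (n + d) ->
  `|ladder n t - ladder n s| <= 2 * (2 ^+ d)^-1.
Proof.
wlog st : s t / s <= t => [H|].
  have [st|/ltW ts] := leP s t; first exact: H.
  by rewrite distrC [X in _ -> X <= _]distrC; apply: H.
have st' := ladder_mono n st.
by rewrite !ger0_norm ?subr_ge0//; apply: ladder_modulus.
Qed.

Lemma ladder_continuous n : continuous (ladder n).
Proof.
move=> t; apply/cvgrPdist_lt => e e0.
have [d de] := pow2_small 2 e0.
near=> s; rewrite distrC; apply: le_lt_trans (ladder_dist _) de.
rewrite distrC ltW//; near: s.
Unshelve. all: by end_near. Qed.

(* On an interval whose ladder values avoid the multiples of [2 ^- d], the
   ladder stays inside one construction interval of depth [d]. *)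
Lemma ladder_level n d i (s t : R) :
  i%:R < 2 ^+ d * ladder n s -> 2 ^+ d * ladder n t < i.+1%:R ->
  t - s < dl (n + d).
Proof.
elim: d n i s t => [|d IH] n i s t; rewrite -[i.+1%:R]natr1.
  rewrite expr0 !mul1r addn0 => hs ht.
  have i0 : i%:R = 0 :> R.
    have : i%:R < 1%:R :> R by apply: lt_le_trans hs (ladder_le1 _ _).
    by rewrite ltr_nat ltnS leqn0 => /eqP ->.
  have s0 : 0 < s.
    rewrite ltNge; apply/negP => /(ladder_lt0 n) s0; move: hs; rewrite s0; lra.
  have t1 : t < dl n.
    rewrite ltNge; apply/negP => /(@ladder_gt1 n) t1; rewrite t1 in ht.
    lra.
  lra.
rewrite exprS -!mulrA => hs ht.
have h2 := dl2 n; have h3 := dl_gt0 n.+1.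
have p0 : 0 < 2 ^+ d :> R by rewrite exprn_gt0.
have pE : (2 ^ d)%N%:R = 2 ^+ d :> R by rewrite natrX.
rewrite addnS -addSn.
have [id|id] := ltnP i (2 ^ d).
  have i1 : i%:R + 1 <= 2 ^+ d :> R by rewrite natr1 -pE ler_nat.
  have K1 : ladder n t < 2^-1.
    rewrite -(ltr_pM2l p0) -(@ltr_pM2l _ 2)//; lra.
  have t1 : t < dl n - dl n.+1.
    rewrite ltNge; apply/negP => tr; move: K1; rewrite ladder_right; last lra.
    have := ladder_ge0 n.+1 (t - (dl n - dl n.+1)); lra.
  have [st|st] := leP s t; last by have := dl_gt0 (n.+1 + d); lra.
  move: hs ht; rewrite !(@ladder_left n); try lra.
  by move=> hs ht; apply: (IH n.+1 i); rewrite -?[i.+1%:R]natr1; lra.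
have i1 : 2 ^+ d <= i%:R :> R by rewrite -pE ler_nat.
have K1 : 2^-1 < ladder n s.
  rewrite -(ltr_pM2l p0) -(@ltr_pM2l _ 2)//; lra.
have t1 : dl n.+1 < s.
  rewrite ltNge; apply/negP => tr; move: K1; rewrite ladder_left; last lra.
  have := ladder_le1 n.+1 s; lra.
have [st|st] := leP s t; last by have := dl_gt0 (n.+1 + d); lra.
move: hs ht; rewrite !(@ladder_right n); try lra.
move=> hs ht.
rewrite (_ : t - s = (t - (dl n - dl n.+1)) - (s - (dl n - dl n.+1))); last by ring.
have iE : (i - 2 ^ d)%N%:R = i%:R - 2 ^+ d :> R by rewrite natrB// pE.
have iE1 : (i - 2 ^ d)%N.+1%:R = i%:R - 2 ^+ d + 1 :> R by rewrite -natr1 iE.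
by apply: (IH n.+1 (i - 2 ^ d)%N); rewrite ?iE ?iE1; lra.
Qed.

(** Local constancy on a dense open set. Producing the flat interval inside any given interval is
    what makes the notion pass to finite sums, by nesting. *)
Definition gappy (f : R -> R) := forall u v : R, u < v ->
  exists u' v' : R, [/\ u < u', u' < v', v' < v &
    forall x y : R, u' <= x <= v' -> u' <= y <= v' -> f x = f y].

(** An interval either meets the middle gap or lies in one half, where the induction applies. At
    depth 0 its length is at least [2 * dl n], so it sticks out of [[0, dl n]], and the ladder is
    constant out there. *)
Lemma ladder_gap n d (u v : R) : u < v -> 2 * dl (n + d) <= v - u ->
  exists u' v' : R, [/\ u < u', u' < v', v' < v &
    forall x y : R, u' <= x <= v' -> u' <= y <= v' -> ladder n x = ladder n y].
Proof.
elim: d n u v => [|d IH] n u v uv duv.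
  rewrite addn0 in duv; have := dl_gt0 n => d0.
  have [u0|u0] := ltP u 0.
    exists (u + Num.min (v - u) (- u) / 3), (u + Num.min (v - u) (- u) / 2).
    have m0 : 0 < Num.min (v - u) (- u) by rewrite lt_min; apply/andP; split; lra.
    have m1 : Num.min (v - u) (- u) <= v - u by rewrite ge_min lexx.
    have m2 : Num.min (v - u) (- u) <= - u by rewrite ge_min lexx orbT.
    set m := Num.min _ _ in m0 m1 m2 *.
    split; try lra.
    by move=> x y hx hy; rewrite !ladder_lt0//; lra.
  exists (v - (v - u) / 4), (v - (v - u) / 5); split; try lra.
  by move=> x y hx hy; rewrite !ladder_gt1//; lra.
have h2 := dl2 n; have h3 := dl_gt0 n.+1.
rewrite addnS -addSn in duv.
have [vd|dv] := leP v (dl n.+1).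
  have [u' [v' [h4 h5 h6 h7]]] := IH n.+1 u v uv duv.
  exists u', v'; split => // x y hx hy.
  by rewrite !(@ladder_left n); [rewrite (h7 x y)|lra|lra].
have [ud|du] := leP (dl n - dl n.+1) u.
  have uv' : u - (dl n - dl n.+1) < v - (dl n - dl n.+1) by lra.
  have [|u' [v' [h4 h5 h6 h7]]] := IH n.+1 _ _ uv'; first lra.
  exists (u' + (dl n - dl n.+1)), (v' + (dl n - dl n.+1)).
  split; try lra.
  move=> x y hx hy.
  rewrite !(@ladder_right n); try lra.
  by rewrite (h7 (x - (dl n - dl n.+1)) (y - (dl n - dl n.+1)))//; lra.
set a := Num.max u (dl n.+1); set b := Num.min v (dl n - dl n.+1).
have ab : a < b by rewrite /a /b gt_max !lt_min uv dv du /=; lra.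
have a1 : u <= a by rewrite le_max lexx.
have a2 : dl n.+1 <= a by rewrite le_max lexx orbT.
have b1 : b <= v by rewrite ge_min lexx.
have b2 : b <= dl n - dl n.+1 by rewrite ge_min lexx orbT.
exists (a + (b - a) / 3), (a + (b - a) / 2); split; try lra.
move=> x y hx hy; rewrite !(@ladder_left n); try lra.
by rewrite !ladder_gt1//; lra.
Qed.

Lemma dl_pow n d : dl (n + d) <= (2 ^+ d)^-1 * dl n.
Proof.
elim: d => [|d IH]; first by rewrite addn0 expr0 invr1 mul1r.
rewrite addnS exprS invfM; have := dl2 (n + d); lra.
Qed.

Lemma ladder_gappy n : gappy (ladder n).
Proof.
move=> u v uv; have vu : 0 < v - u by rewrite subr_gt0.
have [d hd] := pow2_small (2 * dl n) vu; apply: (@ladder_gap n d) => //.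
apply: le_trans (ltW hd); rewrite -mulrA ler_pM2l// [leRHS]mulrC; exact: dl_pow.
Qed.

End Ladder.

(** * Oscillatory integrals *)

Section Integral.
Variable R : realType.
Implicit Types (f g h F : R -> R) (u v x y z c e D a mu B M : R).

Lemma le_pow2_small (a b c : R) : (forall N, a <= b + c * (2 ^+ N)^-1) -> a <= b.
Proof.
move=> H; apply/ler_addgt0Pr => e e0; have [N cN] := pow2_small c e0.
by apply: (le_trans (H N)); rewrite lerD2l ltW.
Qed.

Definition intg u v f : R := (\int[lebesgue_measure]_(x in `[u, v]) f x)%R.

Lemma continuous_intble f u v : continuous f ->
  lebesgue_measure.-integrable `[u, v] (EFin \o f).
Proof.
move=> cf; apply: continuous_compact_integrable; first exact: segment_compact.
exact: continuous_subspaceT.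
Qed.

Lemma intg_split f u v w : continuous f -> u <= v -> v <= w ->
  intg u w f = intg u v f + intg v w f.
Proof.
move=> cf uv vw; rewrite /intg.
have := @Rintegral_itvB R f (BLeft u) (BRight w) v.
move=> /(_ (continuous_intble u w cf)); rewrite !bnd_simp => /(_ uv vw).
move=> /eqP; rewrite subr_eq => /eqP ->; rewrite addrC; congr (_ + _).
apply: Rintegral_itv_obnd_cbnd.
apply: (integrableS _ _ _ (continuous_intble v w cf)) => //.
exact: subset_itv_oc_cc.
Qed.

Lemma intg_point f u : intg u u f = 0.
Proof. by rewrite /intg set_itv1 Rintegral_set1. Qed.

Lemma eq_intg f g u v : (forall x, u <= x <= v -> f x = g x) ->
  intg u v f = intg u v g.
Proof. by move=> fg; apply: eq_Rintegral => x; rewrite inE/= in_itv/= => /fg. Qed.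

Lemma intgB f g u v : continuous f -> continuous g ->
  intg u v (fun x => f x - g x) = intg u v f - intg u v g.
Proof. by move=> cf cg; apply: RintegralB => //; apply: continuous_intble. Qed.

Lemma intgZ f u v c : continuous f ->
  intg u v (fun x => c * f x) = c * intg u v f.
Proof. by move=> cf; apply: RintegralZl => //; apply: continuous_intble. Qed.

Lemma intg_cst c u v : u <= v -> intg u v (fun=> c) = c * (v - u).
Proof.
rewrite /intg Rintegral_cst//= lebesgue_measure_itv/= lte_fin.
by rewrite le_eqVlt => /predU1P[->|->//]; rewrite ltxx subrr.
Qed.

Lemma intg_bound f u v M : continuous f -> u <= v ->
  (forall x, u <= x <= v -> `|f x| <= M) -> `|intg u v f| <= M * (v - u).
Proof.
move=> cf uv fM.
apply: (le_trans (le_normr_Rintegral _ (continuous_intble u v cf))) => //.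
rewrite -intg_cst//.
apply: le_Rintegral => //.
- by apply: continuous_intble => x; apply: cvg_comp (cf x) _; apply: norm_continuous.
- by apply: continuous_intble => x; apply: cvg_cst.
Qed.

Lemma is_derive_continuous F f : (forall x : R, is_derive x 1 F (f x)) -> continuous F.
Proof.
move=> dF x; apply/differentiable_continuous/derivable1_diffP.
by case: (dF x).
Qed.

Lemma intg_FTC F f u v : continuous f -> (forall x : R, is_derive x 1 F (f x)) ->
  u <= v -> intg u v f = F v - F u.
Proof.
move=> cf dF; rewrite le_eqVlt => /predU1P[->|uv]; first by rewrite intg_point subrr.
have cF := is_derive_continuous dF.
rewrite /intg /Rintegral (@continuous_FTC2 _ f F)//=.
- exact: continuous_subspaceT.
- split.
  + by move=> x _; case: (dF x).
  + exact/cvg_at_right_filter/cF.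
  + exact/cvg_at_left_filter/cF.
- by move=> x _; rewrite derive1E; case: (dF x).
Qed.

(* Second mean value theorem: both sides are additive in the interval, so it is
   enough to prove it up to an error that vanishes under bisection. *)
Lemma second_mean_value F f g h u v B : u <= v ->
  continuous f -> continuous h -> (forall x : R, is_derive x 1 F (f x)) ->
  (forall x, `|F x| <= 1) -> (forall x, u <= x <= v -> `|f x| <= B) ->
  (forall x, u <= x <= v -> h x = f x * g x) ->
  (forall x y z, u <= x -> x <= y -> y <= z -> z <= v ->
     `|g z - g x| = `|g y - g x| + `|g z - g y|) ->
  `|intg u v h - (F v * g v - F u * g u)| <= `|g v - g u|.
Proof.
move=> uv cf ch dF F1 fB hfg gm.
have B0 : 0 <= B by apply: le_trans (fB u _); rewrite ?lexx.
suff H N x y : u <= x -> x <= y -> y <= v ->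
    `|intg x y h - (F y * g y - F x * g x)| <=
    (1 + B * (y - x) * (2 ^+ N)^-1) * `|g y - g x|.
  apply: (@le_pow2_small _ _ (B * (v - u) * `|g v - g u|)) => N.
  apply: le_trans (H N u v _ _ _) _ => //.
  by rewrite mulrDl mul1r lerD2l; rewrite -!mulrA [_^-1 * _]mulrC.
elim: N x y => [|N IH] x y ux xy yv.
  rewrite expr0 invr1 mulr1.
  (* Freeze [g] at its value at the right end: what remains is at most [B (y - x)] times the
     variation of [g], plus one boundary term. *)
  have -> : intg x y h - (F y * g y - F x * g x) =
      intg x y (fun t => h t - g y * f t) - F x * (g y - g x).
    rewrite intgB//; last by move=> t; apply: cvgM (cf t); apply: cvg_cst.
    rewrite intgZ// (intg_FTC cf dF xy); ring.
  apply: (le_trans (ler_normB _ _)).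
  rewrite [leRHS]mulrDl mul1r [leRHS]addrC; apply: lerD; last first.
    by rewrite normrM ler_piMl.
  rewrite mulrAC; apply: intg_bound => //.
    move=> t; apply: cvgB; first exact: ch.
    by apply: cvgM (cf t); apply: cvg_cst.
  move=> t /andP[xt ty]; rewrite hfg; last lra.
  rewrite [g y * _]mulrC -mulrBr normrM; apply: ler_pM => //.
    by apply: fB; lra.
  have := gm x t y ux xt ty yv; rewrite (distrC (g t) (g y)) => ->.
  by rewrite lerDr.
set z := (x + y) / 2.
have xz : x <= z by rewrite /z; lra.
have zy : z <= y by rewrite /z; lra.
rewrite (intg_split ch xz zy).
have -> : intg x z h + intg z y h - (F y * g y - F x * g x) =
   (intg x z h - (F z * g z - F x * g x)) + (intg z y h - (F y * g y - F z * g z)).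
  by ring.
apply: (le_trans (ler_normD _ _)).
rewrite (gm x z y ux xz zy yv) mulrDr; apply: lerD.
  apply: (le_trans (IH x z _ _ _)); try lra.
  rewrite exprS invfM.
  have -> : z - x = (y - x) / 2 by rewrite /z; field.
  by apply: ler_wpM2r => //; rewrite le_eqVlt; apply/orP; left; apply/eqP; ring.
apply: (le_trans (IH z y _ _ _)); try lra.
rewrite exprS invfM.
have -> : y - z = (y - x) / 2 by rewrite /z; field.
by apply: ler_wpM2r => //; rewrite le_eqVlt; apply/orP; left; apply/eqP; ring.
Qed.

(** When the level [y] is not attained, [c] is an end point; the guards [u < c] and [c < v] then
    make the corresponding clause vacuous. *)
Lemma crossing f u v y : continuous f -> u <= v ->
  (forall s t, u <= s -> s <= t -> t <= v -> f s <= f t) ->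
  exists c, [/\ u <= c <= v, u < c -> forall t, u <= t <= c -> f t <= y &
    c < v -> forall t, c <= t <= v -> y <= f t].
Proof.
move=> cf uv fm.
have [yu|uy] := leP y (f u).
  exists u; rewrite lexx ltxx; split=> // _ t /andP[ut tv].
  by apply: le_trans yu _; apply: fm.
have [vy|yv] := leP (f v) y.
  exists v; rewrite lexx ltxx uv; split=> // _ t /andP[ut tv].
  by apply: le_trans vy; apply: fm.
have [||c] := @IVT R f u v y uv; first exact: continuous_subspaceT.
  by rewrite ge_min le_max (ltW uy) (ltW yv) orbT.
rewrite in_itv/= => /andP[uc cv] fc; exists c; rewrite uc cv; split=> // _ t /andP[h1 h2].
  by rewrite -fc; apply: fm.
by rewrite -fc; apply: fm.
Qed.

Lemma inv_antimono x y : (0 < x) || (y < 0) -> x <= y -> y^-1 <= x^-1.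
Proof.
move=> /orP[x0|y0] xy; first by rewrite lef_pV2 ?posrE//; exact: lt_le_trans xy.
by rewrite lef_nV2 ?negrE//; exact: le_lt_trans xy y0.
Qed.

Lemma is_derive_sin_comp F f x : is_derive x 1 F (f x) ->
  is_derive x 1 (fun t => sin (F t)) (cos (F x) * f x).
Proof. by move=> dF; apply: (@is_derive1_comp _ sin F x). Qed.

Lemma cos_comp_continuous F : continuous F -> continuous (fun t => cos (F t)).
Proof. by move=> cF x; apply: cvg_comp (cF x) _; apply: continuous_cos. Qed.

Lemma sin_comp_norm F x : `|sin (F x)| <= 1.
Proof. by rewrite ler_norml sin_geN1 sin_le1. Qed.

(** Since cos(F) f is the derivative of sin(F), the second mean value theorem applies with the
    weight [g]: the two boundary terms cost [2 e] and the variation of [g] at most [2 e]. *)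
Lemma oscillation_mean F f g h u v M e : u <= v ->
  continuous f -> continuous h -> (forall x : R, is_derive x 1 F (f x)) ->
  (forall x, u <= x <= v -> h x = cos (F x) * f x * g x) ->
  (forall x, u <= x <= v -> `|f x| <= M) ->
  (forall s t, u <= s -> s <= t -> t <= v -> g t <= g s) ->
  (forall x, u <= x <= v -> `|g x| <= e) ->
  `|intg u v h| <= 4 * e.
Proof.
move=> uv cf ch dF hE fM gm ge.
have cF := is_derive_continuous dF.
have {hE fM}H : `|intg u v h - (sin (F v) * g v - sin (F u) * g u)| <= `|g v - g u|.
  apply: (@second_mean_value (fun t => sin (F t)) (fun t => cos (F t) * f t) g h u v M) => //.
  - by move=> x; apply: cvgM (cf x); apply: cos_comp_continuous.
  - exact: sin_comp_norm.
  - move=> x xuv; rewrite normrM -[M]mul1r; apply: ler_pM => //; last exact: fM.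
    by rewrite ler_norml cos_geN1 cos_le1.
  - move=> x y z ux xy yz zv.
    have h1 : g y <= g x by apply: gm => //; lra.
    have h2 : g z <= g y by apply: gm => //; lra.
    rewrite !ler0_norm ?subr_le0//; last exact: le_trans h1.
    ring.
have gu : `|g u| <= e by apply: ge; rewrite lexx.
have gv : `|g v| <= e by apply: ge; rewrite lexx uv.
have su : `|sin (F u) * g u| <= e.
  by rewrite normrM -[e]mul1r; apply: ler_pM => //; exact: sin_comp_norm.
have sv : `|sin (F v) * g v| <= e.
  by rewrite normrM -[e]mul1r; apply: ler_pM => //; exact: sin_comp_norm.
rewrite -[intg u v h](subrK (sin (F v) * g v - sin (F u) * g u)).
apply: le_trans (ler_normD _ _) _.
have := ler_normB (g v) (g u).
have := ler_normB (sin (F v) * g v) (sin (F u) * g u).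
move: H; lra.
Qed.

(** First derivative test with the weight 1/f, which is monotone because [f] is monotone of constant
    sign. No derivative of [f] enters, so Cantor functions are allowed. *)
Lemma van_der_corput F f u v mu : u <= v -> 0 < mu ->
  continuous f -> (forall x : R, is_derive x 1 F (f x)) ->
  (forall s t, u <= s -> s <= t -> t <= v -> f s <= f t) ->
  (forall t, u <= t <= v -> mu <= f t) \/ (forall t, u <= t <= v -> f t <= - mu) ->
  `|intg u v (fun x => cos (F x))| <= 4 * mu^-1.
Proof.
move=> uv mu0 cf dF fm fmu.
have cF := is_derive_continuous dF.
have fN x : u <= x <= v -> mu <= `|f x|.
  by move=> xuv; rewrite ler_normr; case: fmu => /(_ _ xuv) h; apply/orP; [left|right; lra].
have f0 x : u <= x <= v -> f x != 0.
  by move=> /fN h; rewrite -normr_gt0; apply: lt_le_trans h.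
apply: (@oscillation_mean F f (fun x => (f x)^-1) _ u v (`|f u| + `|f v|)) => //.
- exact: cos_comp_continuous.
- by move=> x /f0 h; rewrite mulfK.
- move=> x xuv; have h1 : f u <= f x by apply: fm; lra.
  have h2 : f x <= f v by apply: fm; lra.
  have := ler_norm (f v); have := ler_norm (- f u); rewrite normrN.
  have := normr_ge0 (f u); have := normr_ge0 (f v).
  rewrite ler_norml; move=> *; apply/andP; split; lra.
- move=> s t us st tv; apply: inv_antimono; last exact: fm.
  have h1 : u <= s <= v by lra.
  have h2 : u <= t <= v by lra.
  apply/orP; case: fmu => H; [left|right].
    by have := H _ h1; lra.
  by have := H _ h2; lra.
- move=> x xuv; rewrite normfV lef_pV2 ?posrE ?fN//.
  exact: lt_le_trans (fN _ xuv).
Qed.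

(** For a large frequency [D] the integral itself is only of order 1/D. Subtracting 1/D times the
    integral of cos(F) f, which is exactly the boundary term, leaves the weight 1/f - 1/D, of size
    at most 2a/D^2. The boundary terms of adjacent intervals will cancel. *)
Lemma van_der_corput_far F f u v D a : u <= v ->
  continuous f -> (forall x : R, is_derive x 1 F (f x)) ->
  (forall s t, u <= s -> s <= t -> t <= v -> f s <= f t) ->
  0 < `|D| -> 2 * a <= `|D| -> (forall t, u <= t <= v -> `|f t - D| <= a) ->
  `|intg u v (fun x => cos (F x)) - (sin (F v) - sin (F u)) / D| <= 8 * (a / D ^+ 2).
Proof.
move=> uv cf dF fm D0 aD fD.
have cF := is_derive_continuous dF.
have Dn0 : D != 0 by rewrite -normr_gt0.
have cc := cos_comp_continuous cF.
have cfc : continuous (fun t => cos (F t) * f t).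
  by move=> x; apply: cvgM (cf x); apply: cc.
have fN x : u <= x <= v -> `|D| / 2 <= `|f x|.
  move=> /fD h; have := ler_distD (f x) D 0; rewrite !subr0 distrC; lra.
have f0 x : u <= x <= v -> f x != 0.
  move=> /fN h; rewrite -normr_gt0; apply: lt_le_trans h; lra.
have -> : intg u v (fun x => cos (F x)) - (sin (F v) - sin (F u)) / D =
    intg u v (fun x => cos (F x) - D^-1 * (cos (F x) * f x)).
  rewrite intgB//; last by move=> x; apply: cvgM (cfc x); apply: cvg_cst.
  rewrite intgZ// (@intg_FTC (fun t => sin (F t)))//; first by rewrite mulrC.
rewrite (_ : 8 * _ = 4 * (2 * (a / D ^+ 2))); last by ring.
apply: (@oscillation_mean F f (fun x => (f x)^-1 - D^-1) _ u v (`|D| + a)) => //.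
- move=> x; apply: cvgB; first exact: cc.
  by apply: cvgM (cfc x); apply: cvg_cst.
- by move=> x /f0 h; field; rewrite h Dn0.
- move=> x /fD h; have := ler_distD D (f x) 0; rewrite !subr0; lra.
- move=> s t us st tv; rewrite lerD2r; apply: inv_antimono; last exact: fm.
  have h1 := fD _ (_ : u <= s <= v); have h2 := fD _ (_ : u <= t <= v).
  have {}h1 := h1 ltac:(lra); have {}h2 := h2 ltac:(lra).
  apply/orP; have [D1|D1] := ltP 0 D; [left|right].
    by move: h1 aD; rewrite (gtr0_norm D1) ler_norml; lra.
  by move: h2 aD D0; rewrite (ler0_norm D1) ler_norml; lra.
- move=> x xuv.
  have h0 := f0 _ xuv.
  rewrite (_ : _ - _ = (D - f x) / (f x * D)); last by field; rewrite h0 Dn0.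
  rewrite normrM normfV normrM distrC -[D ^+ 2]real_normK ?num_real//.
  rewrite ler_pdivrMr; last by rewrite mulr_gt0 ?normr_gt0.
  apply: le_trans (fD _ xuv) _.
  have a0 : 0 <= a by apply: le_trans (fD _ xuv).
  rewrite (_ : 2 * _ * _ = a * (2 * `|f x| / `|D|)); last first.
    by field; rewrite normr_eq0.
  rewrite ler_peMr// ler_pdivlMr// mul1r; have := fN _ xuv; lra.
Qed.

End Integral.

(** * Oscillatory integrals along a single ladder *)

Section Branch.
Variables (R : realType) (dl : nat -> R).
Hypothesis dl_gt0 : forall n, 0 < dl n.
Hypothesis dl2 : forall n, 2 * dl n.+1 < dl n.
Implicit Types (f F : R -> R) (u v s t x E mu D rho : R) (n d i : nat).

(** Cut where the slope crosses -1/rho and 1/rho: the outer pieces cost 4 rho each by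
    [van_der_corput], the middle one at most its length, which is at most rho. *)
Lemma oscillation_monotone F f u v rho : u <= v -> 0 < rho ->
  continuous f -> (forall x : R, is_derive x 1 F (f x)) ->
  (forall s t, u <= s -> s <= t -> t <= v -> f s <= f t) ->
  (forall s t, u <= s -> s <= t -> t <= v -> `|f s| <= rho^-1 -> `|f t| <= rho^-1 ->
     t - s <= rho) ->
  `|intg u v (fun x => cos (F x))| <= 9 * rho.
Proof.
move=> uv rho0 cf dF fm fl.
have cc := cos_comp_continuous (is_derive_continuous dF).
have r0 : 0 < rho^-1 by rewrite invr_gt0.
have [c1 [/andP[uc1 c1v] lo1 hi1]] := crossing (- rho^-1) cf uv fm.
have fm1 s t : c1 <= s -> s <= t -> t <= v -> f s <= f t by move=> *; apply: fm; lra.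
have [c2 [/andP[c12 c2v] lo2 hi2]] := crossing (rho^-1) cf c1v fm1.
rewrite (intg_split cc uc1 c1v) (intg_split cc c12 c2v).
have h1 : `|intg u c1 (fun x => cos (F x))| <= 4 * rho.
  have [uc|uc] := ltP u c1; last first.
    by rewrite (le_anti (_ : u <= c1 <= u)) ?uc1// intg_point normr0; lra.
  rewrite -[X in 4 * X]invrK; apply: van_der_corput cf dF _ _ => //.
    by move=> *; apply: fm; lra.
  by right=> t; apply: lo1.
have h3 : `|intg c2 v (fun x => cos (F x))| <= 4 * rho.
  have [uc|uc] := ltP c2 v; last first.
    by rewrite (le_anti (_ : c2 <= v <= c2)) ?c2v// intg_point normr0; lra.
  rewrite -[X in 4 * X]invrK; apply: van_der_corput cf dF _ _ => //.
    by move=> *; apply: fm; lra.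
  by left=> t; apply: hi2.
have h2 : `|intg c1 c2 (fun x => cos (F x))| <= rho.
  have [uc|uc] := ltP c1 c2; last first.
    by rewrite (le_anti (_ : c1 <= c2 <= c1)) ?c12// intg_point normr0 ltW.
  have hh t : c1 <= t <= c2 -> `|f t| <= rho^-1.
    move=> tc; rewrite ler_norml hi1 ?lo2//; lra.
  apply: (@le_trans _ _ (1 * (c2 - c1))).
    apply: intg_bound => // x _; by rewrite ler_norml cos_geN1 cos_le1.
  rewrite mul1r; apply: fl => //; apply: hh; lra.
apply: (le_trans (ler_normD _ _)).
have := ler_normD (intg c1 c2 (fun x => cos (F x))) (intg c2 v (fun x => cos (F x))).
lra.
Qed.

(** If a multiple of [2 ^- d] lay between the ladder values at [x] and [y], the slope at that level
    would be at most 1/rho in absolute value by monotonicity, against the hypothesis on levels. So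
    both values lie strictly between consecutive multiples, and [ladder_level] bounds the
    distance. *)
Lemma ladder_level_dist f E mu s n d rho u v : 0 < rho -> dl (n + d) <= rho ->
  0 <= mu ->
  (forall x, u <= x <= v -> f x = E + mu * ladder dl n (x - s)) ->
  (forall i, (i <= 2 ^ d)%N -> rho^-1 < `|E + mu * (i%:R / 2 ^+ d)|) ->
  forall x y, u <= x -> x <= y -> y <= v ->
  `|f x| <= rho^-1 -> `|f y| <= rho^-1 -> y - x <= rho.
Proof.
move=> rho0 dr mu0 fE lev x y ux xy yv fx fy.
rewrite fE in fx; last lra. rewrite fE in fy; last lra.
apply: le_trans dr; rewrite (_ : y - x = (y - s) - (x - s)); last by ring.
have p0 : 0 < 2 ^+ d :> R by rewrite exprn_gt0.
have pE : (2 ^ d)%N%:R = 2 ^+ d :> R by rewrite natrX.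
have /andP[K0 K1] : 0 <= ladder dl n (x - s) <= 1.
  by rewrite ladder_ge0// ladder_le1.
have L1 : ladder dl n (y - s) <= 1 by rewrite ladder_le1.
have KL : ladder dl n (x - s) <= ladder dl n (y - s) by apply: ladder_mono => //; lra.
have [i [hi hi1]] : exists i, i%:R <= 2 ^+ d * ladder dl n (x - s) /\
    2 ^+ d * ladder dl n (x - s) < i.+1%:R.
  exists (Num.truncn (2 ^+ d * ladder dl n (x - s))).
  by apply/andP; apply: truncn_itv; rewrite mulr_ge0// ltW.
have absurd j : (j <= 2 ^ d)%N -> ladder dl n (x - s) <= j%:R / 2 ^+ d ->
    j%:R / 2 ^+ d <= ladder dl n (y - s) -> False.
  move=> /lev; set q := _ / _ => h h1 h2.
  have m1 := ler_wpM2l mu0 h1; have m2 := ler_wpM2l mu0 h2.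
  move: fx fy h; rewrite !ler_norml ltNge => h3 h4 /negP; apply.
  rewrite ler_norml; lra.
have {}hi : i%:R < 2 ^+ d * ladder dl n (x - s).
  rewrite lt_neqAle hi andbT; apply/negP => /eqP e.
  have e' : i%:R / 2 ^+ d = ladder dl n (x - s) by rewrite e mulrC mulKf ?gt_eqF.
  apply: (absurd i); rewrite ?e'//.
  by rewrite -(ler_nat R) pE e ler_piMr// ltW.
have [hy|hy] := ltP (2 ^+ d * ladder dl n (y - s)) (i.+1%:R).
  by apply: ltW; apply: ladder_level hi hy.
exfalso; apply: (absurd i.+1).
- by rewrite -(ler_nat R) pE; apply: le_trans hy _; rewrite ler_piMr// ltW.
- by rewrite ler_pdivlMr// mulrC ltW.
- by rewrite ler_pdivrMr// mulrC.
Qed.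

Lemma ladder_branch F f E mu s n d rho u v : u <= v -> 0 < rho -> dl (n + d) <= rho ->
  continuous f -> (forall x : R, is_derive x 1 F (f x)) ->
  (forall x, u <= x <= v -> f x = E + mu * ladder dl n (x - s)) ->
  (forall i, (i <= 2 ^ d)%N -> rho^-1 < `|E + mu * (i%:R / 2 ^+ d)|) ->
  `|intg u v (fun x => cos (F x))| <= 9 * rho.
Proof.
move=> uv rho0 dr.
(* Replacing [F] by [- F] leaves the cosine unchanged, so the slope may be taken nondecreasing. *)
wlog mu0 : F f E mu / 0 <= mu => [H|cf dF fE lev].
  have [mu0|mu0] := leP 0 mu; first exact: H.
  move=> cf dF fE lev.
  have -> : (fun x => cos (F x)) = (fun x => cos (- F x)).
    by apply/funext => x; rewrite cosN.
  apply: (H (fun x => - F x) (fun x => - f x) (- E) (- mu)).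
  - by rewrite oppr_ge0 ltW.
  - by move=> x; apply: cvgN; exact: cf.
  - by move=> x /fE ->; ring.
  - move=> i /lev; rewrite -normrN; congr (_ < `|_|); ring.
apply: oscillation_monotone cf dF _ _ => //.
  move=> x y ux xy yv; rewrite !fE; [|lra|lra].
  by rewrite lerD2l ler_wpM2l// ladder_mono//; lra.
exact: ladder_level_dist fE lev.
Qed.

Lemma ladder_branch_far F f E mu s n u v D a : u <= v ->
  continuous f -> (forall x : R, is_derive x 1 F (f x)) ->
  (forall x, u <= x <= v -> f x = E + mu * ladder dl n (x - s)) ->
  0 < `|D| -> 2 * a <= `|D| -> (forall t, u <= t <= v -> `|f t - D| <= a) ->
  `|intg u v (fun x => cos (F x)) - (sin (F v) - sin (F u)) / D| <= 8 * (a / D ^+ 2).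
Proof.
move=> uv.
wlog mu0 : F f E mu D / 0 <= mu => [H|cf dF fE D0 aD fD].
  have [mu0|mu0] := leP 0 mu; first exact: H.
  move=> cf dF fE D0 aD fD.
  have -> : (fun x => cos (F x)) = (fun x => cos (- F x)).
    by apply/funext => x; rewrite cosN.
  have -> : (sin (F v) - sin (F u)) / D = (sin (- F v) - sin (- F u)) / (- D).
    by rewrite !sinN invrN; ring.
  rewrite -(sqrrN D).
  apply: (H (fun x => - F x) (fun x => - f x) (- E) (- mu)); rewrite ?normrN//.
  - by rewrite oppr_ge0 ltW.
  - by move=> x; apply: cvgN; exact: cf.
  - by move=> x /fE ->; ring.
  - by move=> t /fD; rewrite -opprD normrN.
apply: van_der_corput_far cf dF _ D0 aD fD => //.
move=> x y ux xy yv; rewrite !fE; [|lra|lra].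
by rewrite lerD2l ler_wpM2l// ladder_mono//; lra.
Qed.

Definition primitive f x : R := intg 0 x f.

(** The base point 0 of [primitive] can be moved to the left, where [f] vanishes; this makes every
    [x], also [x <= 0], interior to an interval on which the fundamental theorem of calculus
    applies. *)
Lemma intg_neg f u x : continuous f -> (forall x, x <= 0 -> f x = 0) -> u <= 0 ->
  intg u x f = primitive f x.
Proof.
move=> cf f0 u0.
have z a b : b <= 0 -> intg a b f = 0.
  move=> b0; rewrite (@eq_intg _ _ (fun=> 0)); last by move=> y yab; apply: f0; lra.
  by rewrite /intg Rintegral_cst// mul0r.
have [x0|x0] := leP x 0; first by rewrite /primitive !z.
by rewrite /primitive (intg_split cf u0 (ltW x0)) z// add0r.
Qed.

Lemma is_derive_primitive f x : continuous f -> (forall x, x <= 0 -> f x = 0) ->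
  is_derive x 1 (primitive f) (f x).
Proof.
move=> cf f0; pose a := Num.min 0 x - 1.
have a0 : a <= 0 by rewrite /a; have : Num.min 0 x <= 0; [rewrite ge_min lexx|lra].
have ax : a < x by rewrite /a; have : Num.min 0 x <= x; [rewrite ge_min lexx orbT|lra].
have -> : primitive f = (fun y => intg a y f).
  by apply/funext => y; rewrite intg_neg.
have x1 : x < x + 1 by rewrite ltrDl.
have [d1 d2] := continuous_FTC1_closed x1 (continuous_intble _ _ cf) ax (cf x).
by split; [exact: d1|rewrite -derive1E; exact: d2].
Qed.

Lemma primitive_le0 f x : continuous f -> (forall x, x <= 0 -> f x = 0) -> x <= 0 ->
  primitive f x = 0.
Proof. by move=> cf f0 x0; rewrite -(intg_neg _ cf f0 x0) intg_point. Qed.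

Lemma primitive_gt f (d : R) x : continuous f -> 0 <= d -> (forall x, d <= x -> f x = 1) ->
  d <= x -> primitive f x = primitive f d + (x - d).
Proof.
move=> cf d0 f1 dx; rewrite /primitive (intg_split cf d0 dx); congr (_ + _).
rewrite (@eq_intg _ _ (fun=> 1)); last by move=> y /andP[h _]; apply: f1.
by rewrite intg_cst// mul1r.
Qed.

End Branch.

(** * One bump and its oscillatory integrals *)

Section Bump.
Variables (R : realType) (dl : nat -> R).
Hypothesis dl_gt0 : forall n, 0 < dl n.
Hypothesis dl2 : forall n, 2 * dl n.+1 < dl n.
Variables (A s : R) (n : nat).
Hypothesis A0 : 0 <= A.
Local Notation K := (ladder dl n).
Local Notation d := (dl n).

(* [bump'] climbs a ladder to height [A], descends to [-A] through two reversed
   ladders and climbs back to [0]; hence its primitive [bump] also vanishes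
   outside [[s, s + 4 * dl n]]. *)
Definition bump' (x : R) : R :=
  A * (ladder dl n (x - s) - ladder dl n (x - s - dl n)
       - ladder dl n (x - s - 2 * dl n) + ladder dl n (x - s - 3 * dl n)).

Definition bump (x : R) : R :=
  A * (primitive (ladder dl n) (x - s) - primitive (ladder dl n) (x - s - dl n)
       - primitive (ladder dl n) (x - s - 2 * dl n)
       + primitive (ladder dl n) (x - s - 3 * dl n)).

Let cK : continuous K. Proof. exact: ladder_continuous. Qed.
Let K0 x : x <= 0 -> K x = 0. Proof. exact: ladder_lt0. Qed.
Let K1 x : d <= x -> K x = 1. Proof. exact: ladder_gt1. Qed.
Let d0 : 0 < d. Proof. exact: dl_gt0. Qed.

Lemma is_derive_shift (f f' : R -> R) (a x : R) :
  (forall y : R, is_derive y 1 f (f' y)) -> is_derive x 1 (fun y => f (y - a)) (f' (x - a)).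
Proof.
move=> df; rewrite -[f' _]mulr1.
have h : is_derive x 1 (fun y : R => y - a) 1.
  by rewrite -[X in is_derive _ _ _ X]subr0; exact: is_deriveB.
exact: (@is_derive1_comp _ f (fun y => y - a) x).
Qed.

Lemma is_derive_bump (x : R) : is_derive x 1 bump (bump' x).
Proof.
have dP (y : R) : is_derive y 1 (primitive K) (K y) by exact: is_derive_primitive.
have dPa a : is_derive x 1 (fun y => primitive K (y - s - a)) (K (x - s - a)).
  have e y : y - s - a = y - (s + a) by ring.
  have -> : (fun y => primitive K (y - s - a)) = (fun y => primitive K (y - (s + a))).
    by apply/funext => y; rewrite e.
  by rewrite e; apply: is_derive_shift.
have := is_derive_shift s x dP => dP0.
have h := is_deriveZ A (is_deriveD (is_deriveB (is_deriveB dP0 (dPa d)) (dPa (2 * d))) (dPa (3 * d))).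
exact: h.
Qed.

Lemma bump'_continuous : continuous bump'.
Proof.
have c a : continuous (fun x => K (x - s - a)).
  move=> x; apply: (@continuous_comp _ _ _ (fun x => x - s - a) K); last exact: cK.
  by apply: cvgB; [apply: cvgB|]; [exact: cvg_id|exact: cvg_cst|exact: cvg_cst].
have c0 : continuous (fun x => K (x - s)).
  move=> x; apply: (@continuous_comp _ _ _ (fun x => x - s) K); last exact: cK.
  by apply: cvgB; [exact: cvg_id|exact: cvg_cst].
move=> x; apply: cvgM; first exact: cvg_cst.
by apply: cvgD; [apply: cvgB; [apply: cvgB|]|]; [exact: c0|exact: c|exact: c|exact: c].
Qed.

(** To the right of the support each primitive is affine with slope 1, and the signs +, -, -, + at
    the shifts 0, 1, 2, 3 annihilate affine functions. *)
Lemma bump_out x : x <= s \/ s + 4 * d <= x -> bump x = 0.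
Proof.
move=> [xs|sx]; rewrite /bump.
  have h := dl_gt0 n.
  by rewrite !(@primitive_le0 _ K)//; lra.
have h := dl_gt0 n.
have e y : d <= y -> primitive K y = primitive K d + (y - d).
  by apply: primitive_gt => //; exact: ltW.
rewrite (e (x - s)) ?(e (x - s - dl n)) ?(e (x - s - 2 * dl n)) ?(e (x - s - 3 * dl n)); lra.
Qed.

Lemma bump'_bound x : `|bump' x| <= A.
Proof.
rewrite /bump' normrM ger0_norm// ler_piMr//.
have h := dl_gt0 n.
have m1 : K (x - s - dl n) <= K (x - s) by apply: ladder_mono => //; lra.
have m2 : K (x - s - 3 * dl n) <= K (x - s - 2 * dl n) by apply: ladder_mono => //; lra.
have b1 : 0 <= K (x - s - dl n) by exact: ladder_ge0.
have b2 : 0 <= K (x - s - 3 * dl n) by exact: ladder_ge0.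
have b3 : K (x - s) <= 1 by exact: ladder_le1.
have b4 : K (x - s - 2 * dl n) <= 1 by exact: ladder_le1.
by rewrite ler_norml; lra.
Qed.

Lemma bump'_out x : x <= s \/ s + 4 * d <= x -> bump' x = 0.
Proof.
have h := dl_gt0 n; rewrite /bump' => -[xs|sx].
  by rewrite !K0; try lra; rewrite subrr sub0r oppr0 addr0 mulr0.
by rewrite !K1; try lra; ring.
Qed.

Lemma bump'_top : bump' (s + d) = A.
Proof.
have h := dl_gt0 n; rewrite /bump' (@K1 (s + d - s)); last lra.
rewrite !K0; try lra; ring.
Qed.

Lemma bump'_branch1 x : s <= x <= s + d -> bump' x = A * K (x - s).
Proof.
have h := dl_gt0 n; rewrite /bump' => xs.
rewrite (@K0 (x - s - dl n)) ?(@K0 (x - s - 2 * dl n)) ?(@K0 (x - s - 3 * dl n)); try lra.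
Qed.

Lemma bump'_branch2 x : s + d <= x <= s + 2 * d -> bump' x = A - A * K (x - (s + d)).
Proof.
have h := dl_gt0 n; rewrite /bump' opprD addrA => xs.
rewrite (@K1 (x - s)) ?(@K0 (x - s - 2 * dl n)) ?(@K0 (x - s - 3 * dl n)); try lra.
Qed.

Lemma bump'_branch3 x : s + 2 * d <= x <= s + 3 * d -> bump' x = - A * K (x - (s + 2 * d)).
Proof.
have h := dl_gt0 n; rewrite /bump' opprD addrA => xs.
rewrite (@K1 (x - s)) ?(@K1 (x - s - dl n)) ?(@K0 (x - s - 3 * dl n)); try lra.
Qed.

Lemma bump'_branch4 x : s + 3 * d <= x <= s + 4 * d ->
  bump' x = - A + A * K (x - (s + 3 * d)).
Proof.
have h := dl_gt0 n; rewrite /bump' opprD addrA => xs.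
rewrite (@K1 (x - s)) ?(@K1 (x - s - dl n)) ?(@K1 (x - s - 2 * dl n)); try lra.
Qed.

Lemma bump_bound x : `|bump x| <= 4 * A * d.
Proof.
have h := dl_gt0 n.
have [xs|sx] := leP x s.
  by rewrite bump_out; [rewrite normr0 !mulr_ge0// ltW|left].
have [sx'|xs'] := leP (s + 4 * d) x.
  by rewrite bump_out; [rewrite normr0 !mulr_ge0// ltW|right].
have [|y _] := @MVT R bump bump' s x sx (fun y _ => is_derive_bump y).
  by apply: continuous_subspaceT; exact: is_derive_continuous is_derive_bump.
rewrite (bump_out (x := s)); last by left.
rewrite subr0 => ->; rewrite normrM.
apply: (@le_trans _ _ (A * (4 * d))); last by rewrite mulrCA mulrA.
by apply: ler_pM => //; [exact: bump'_bound|rewrite ger0_norm; lra].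
Qed.

Section Oscillation.
Variables (lam D c : R).

Definition bump_phase (x : R) : R := D * x + c + lam * bump x.
Definition flat_phase (x : R) : R := D * x + c.
(** Only the difference is tracked, because the integrals for successive partial sums telescope. The
    sine integral is recovered by shifting [c] by [- pi / 2]. *)
Definition bump_osc : R :=
  intg s (s + 4 * d) (fun x => cos (bump_phase x) - cos (flat_phase x)).

Lemma is_derive_affine (x : R) : is_derive x 1 flat_phase D.
Proof.
have -> : D = D * 1 + 0 by ring.
by apply: is_deriveD; apply: is_deriveZ.
Qed.

Lemma is_derive_bump_phase (x : R) : is_derive x 1 bump_phase (D + lam * bump' x).
Proof.
have h := is_derive_bump x; have h' := is_derive_affine x.
by have := is_deriveD h' (is_deriveZ lam h).
Qed.

Let ss : s <= s + 4 * d. Proof. by have := dl_gt0 n; lra. Qed.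
Let c1 : continuous (fun x => cos (bump_phase x)).
Proof. exact: cos_comp_continuous (is_derive_continuous is_derive_bump_phase). Qed.
Let c2 : continuous (fun x => cos (flat_phase x)).
Proof. exact: cos_comp_continuous (is_derive_continuous is_derive_affine). Qed.
Let c3 : continuous (fun x => cos (bump_phase x) - cos (flat_phase x)).
Proof. by move=> x; apply: cvgB; [exact: c1|exact: c2]. Qed.

Lemma cos_lip (x y : R) : `|cos x - cos y| <= `|x - y|.
Proof.
wlog xy : x y / y <= x => [H|].
  have [xy|/ltW xy] := leP y x; first exact: H.
  by rewrite distrC [leRHS]distrC; apply: H.
have [|z _ ->] := @MVT_segment R cos (fun z => - sin z) y x xy (fun z _ => is_derive_cos z).
  by apply: continuous_subspaceT; exact: continuous_cos.
by rewrite normrM normrN ler_piMl// ler_norml sin_geN1 sin_le1.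
Qed.

Lemma bump_osc_trivial : `|bump_osc| <= 8 * d.
Proof.
apply: (@le_trans _ _ (2 * (s + 4 * d - s))); last by rewrite addrC addKr; lra.
apply: intg_bound => // x _.
apply: (le_trans (ler_normB _ _)); rewrite (_ : 2 = 1 + 1)//.
by apply: lerD; rewrite ler_norml cos_geN1 cos_le1.
Qed.

Lemma bump_osc_small : `|bump_osc| <= 16 * (`|lam| * A * d ^+ 2).
Proof.
apply: (@le_trans _ _ (`|lam| * (4 * A * d) * (s + 4 * d - s))); last first.
  by rewrite addrC addKr le_eqVlt; apply/orP; left; apply/eqP; ring.
apply: intg_bound => // x _; apply: (le_trans (cos_lip _ _)).
rewrite /bump_phase /flat_phase addrC addKr normrM.
by apply: ler_wpM2l => //; apply: bump_bound.
Qed.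

Let c4 : continuous (fun x => D + lam * bump' x).
Proof.
move=> x; apply: cvgD; first exact: cvg_cst.
by apply: cvgM; [exact: cvg_cst|exact: bump'_continuous].
Qed.

Lemma bump_osc_split : bump_osc =
  intg s (s + d) (fun x => cos (bump_phase x)) +
  intg (s + d) (s + 2 * d) (fun x => cos (bump_phase x)) +
  intg (s + 2 * d) (s + 3 * d) (fun x => cos (bump_phase x)) +
  intg (s + 3 * d) (s + 4 * d) (fun x => cos (bump_phase x)) -
  intg s (s + 4 * d) (fun x => cos (flat_phase x)).
Proof.
rewrite /bump_osc intgB//; have h0 := dl_gt0 n.
rewrite (@intg_split _ _ s (s + 3 * d))//; try lra.
rewrite (@intg_split _ _ s (s + 2 * d))//; try lra.
by rewrite (@intg_split _ _ s (s + d))//; lra.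
Qed.

(** Each of the four branches and the flat phase cost 9 rho. The second and fourth branch run
    through their levels in the order [2 ^ k - i], and the flat phase is a ladder of height 0, for
    which the level [i = 0] suffices. *)
Lemma bump_osc_level (k : nat) (rho : R) : 0 < rho -> dl (n + k) <= rho ->
  (forall i, (i <= 2 ^ k)%N ->
     rho^-1 < `|D + lam * A * (i%:R / 2 ^+ k)| /\
     rho^-1 < `|D - lam * A * (i%:R / 2 ^+ k)|) ->
  `|bump_osc| <= 45 * rho.
Proof.
move=> rho0 kr lev; rewrite bump_osc_split; have h0 := dl_gt0 n.
have p0 : 2 ^+ k != 0 :> R by rewrite expf_neq0.
have cc i : (i <= 2 ^ k)%N -> (2 ^ k - i)%N%:R / 2 ^+ k = 1 - i%:R / 2 ^+ k :> R.
  by move=> ik; rewrite natrB// natrX mulrBl divff.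
have lev' i : (i <= 2 ^ k)%N -> rho^-1 < `|D + lam * A + - (lam * A) * (i%:R / 2 ^+ k)|.
  move=> ik; have [h _] := lev _ (leq_subr i (2 ^ k)).
  by rewrite cc// in h; rewrite (_ : _ + _ = D + lam * A * (1 - i%:R / 2 ^+ k))//; ring.
have lev'' i : (i <= 2 ^ k)%N -> rho^-1 < `|D - lam * A + lam * A * (i%:R / 2 ^+ k)|.
  move=> ik; have [_ h] := lev _ (leq_subr i (2 ^ k)).
  by rewrite cc// in h; rewrite (_ : _ + _ = D - lam * A * (1 - i%:R / 2 ^+ k))//; ring.
have B1 := @ladder_branch _ dl dl_gt0 dl2 bump_phase (fun x => D + lam * bump' x)
  D (lam * A) s n k rho s (s + d) ltac:(lra) rho0 kr c4 is_derive_bump_phase.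
have {}B1 := B1 ltac:(move=> x /bump'_branch1 ->; rewrite mulrA//)
  (fun i ik => proj1 (lev i ik)).
have B2 := @ladder_branch _ dl dl_gt0 dl2 bump_phase (fun x => D + lam * bump' x)
  (D + lam * A) (- (lam * A)) (s + d) n k rho (s + d) (s + 2 * d)
  ltac:(lra) rho0 kr c4 is_derive_bump_phase.
have {}B2 := B2 ltac:(move=> x /bump'_branch2 ->; ring) lev'.
have B3 := @ladder_branch _ dl dl_gt0 dl2 bump_phase (fun x => D + lam * bump' x)
  D (- (lam * A)) (s + 2 * d) n k rho (s + 2 * d) (s + 3 * d)
  ltac:(lra) rho0 kr c4 is_derive_bump_phase.
have {}B3 := B3 ltac:(move=> x /bump'_branch3 ->; ring)
  ltac:(move=> i /lev[_]; rewrite mulNr//).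
have B4 := @ladder_branch _ dl dl_gt0 dl2 bump_phase (fun x => D + lam * bump' x)
  (D - lam * A) (lam * A) (s + 3 * d) n k rho (s + 3 * d) (s + 4 * d)
  ltac:(lra) rho0 kr c4 is_derive_bump_phase.
have {}B4 := B4 ltac:(move=> x /bump'_branch4 ->; ring) lev''.
have cD : continuous (fun _ : R => D) by move=> x; exact: cvg_cst.
have B5 := @ladder_branch _ dl dl_gt0 dl2 flat_phase (fun=> D)
  D 0 s n k rho s (s + 4 * d) ltac:(lra) rho0 kr cD is_derive_affine.
have {}B5 := B5 ltac:(move=> x _; rewrite mul0r addr0//)
  ltac:(move=> i _; have [+ _] := lev 0%N (leq0n _); rewrite !mul0r mulr0//).
move: B1 B2 B3 B4 B5.
set I1 := intg _ _ _; set I2 := intg _ _ _; set I3 := intg _ _ _.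
set I4 := intg _ _ _; set I5 := intg _ _ _.
by rewrite !ler_norml; lra.
Qed.

(** The boundary terms of the four branches telescope to the values of the sine at the two ends,
    where the bump vanishes; they cancel the integral of the flat phase exactly, and the four
    remainders give 4 times 8. *)
Lemma bump_osc_far : 0 < `|D| -> 2 * (`|lam| * A) <= `|D| ->
  `|bump_osc| <= 32 * (`|lam| * A / D ^+ 2).
Proof.
move=> D0 lamD; rewrite bump_osc_split; have h0 := dl_gt0 n.
have fD (u v t : R) : u <= t <= v -> `|D + lam * bump' t - D| <= `|lam| * A.
  by move=> _; rewrite addrC addKr normrM ler_wpM2l// bump'_bound.
have B1 := @ladder_branch_far _ dl dl_gt0 dl2 bump_phase (fun x => D + lam * bump' x)
  D (lam * A) s n s (s + d) D (`|lam| * A) ltac:(lra) c4 is_derive_bump_phase.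
have {}B1 := B1 ltac:(move=> x /bump'_branch1 ->; rewrite mulrA//) D0 lamD (@fD _ _).
have B2 := @ladder_branch_far _ dl dl_gt0 dl2 bump_phase (fun x => D + lam * bump' x)
  (D + lam * A) (- (lam * A)) (s + d) n (s + d) (s + 2 * d) D (`|lam| * A)
  ltac:(lra) c4 is_derive_bump_phase.
have {}B2 := B2 ltac:(move=> x /bump'_branch2 ->; ring) D0 lamD (@fD _ _).
have B3 := @ladder_branch_far _ dl dl_gt0 dl2 bump_phase (fun x => D + lam * bump' x)
  D (- (lam * A)) (s + 2 * d) n (s + 2 * d) (s + 3 * d) D (`|lam| * A)
  ltac:(lra) c4 is_derive_bump_phase.
have {}B3 := B3 ltac:(move=> x /bump'_branch3 ->; ring) D0 lamD (@fD _ _).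
have B4 := @ladder_branch_far _ dl dl_gt0 dl2 bump_phase (fun x => D + lam * bump' x)
  (D - lam * A) (lam * A) (s + 3 * d) n (s + 3 * d) (s + 4 * d) D (`|lam| * A)
  ltac:(lra) c4 is_derive_bump_phase.
have {}B4 := B4 ltac:(move=> x /bump'_branch4 ->; ring) D0 lamD (@fD _ _).
have Dn0 : D != 0 by rewrite -normr_gt0.
have B5 : intg s (s + 4 * d) (fun x => cos (flat_phase x)) =
    (sin (bump_phase (s + 4 * d)) - sin (bump_phase s)) / D.
  have dS (x : R) : is_derive x 1 (fun x => D^-1 * sin (flat_phase x)) (cos (flat_phase x)).
    have h := is_deriveZ D^-1 (is_derive_sin_comp (is_derive_affine x)).
    suff -> : cos (flat_phase x) = D^-1 *: (cos (flat_phase x) * D) by exact: h.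
    by rewrite /GRing.scale/= mulrCA mulVf ?mulr1.
  rewrite (intg_FTC c2 dS ss) /bump_phase !bump_out; [|by left|by right].
  by rewrite mulr0 !addr0 -mulrBr mulrC.
rewrite B5; move: B1 B2 B3 B4.
set I1 := intg _ _ _; set I2 := intg _ _ _; set I3 := intg _ _ _.
set I4 := intg _ _ _; set q := _ / D ^+ 2.
set s0 := sin (bump_phase s); set s1 := sin (bump_phase (s + d)).
set s2 := sin (bump_phase (s + 2 * d)); set s3 := sin (bump_phase (s + 3 * d)).
set s4 := sin (bump_phase (s + 4 * d)).
by rewrite !ler_norml; lra.
Qed.

End Oscillation.

End Bump.

(** * The modulus and the inverse of chi *)

Section Modulus.
Variables (R : realType) (w : R -> R).
Hypothesis hw : modulus_hyp w.

Lemma modulus_mono x y : 0 <= x -> x <= y -> w x <= w y.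
Proof. by case: hw => _ [h _]; exact: h. Qed.

Lemma modulus0 : w 0 = 0.
Proof. by case: hw => _ [_ []]. Qed.

Lemma modulus_ge0 x : 0 <= x -> 0 <= w x.
Proof. by move=> x0; rewrite -modulus0; apply: modulus_mono. Qed.

(** If [w] vanished at some [x > 0] it would vanish on [[0, x]], contradicting the strict inequality
    [w (2 * d) < 2 * w d] at a small [d]. *)
Lemma modulus_gt0 x : 0 < x -> 0 < w x.
Proof.
move=> x0; rewrite lt_neqAle modulus_ge0 ?ltW// andbT eq_sym; apply/eqP => wx.
case: hw => _ [_ [_ [d0 [d00 dbl]]]].
pose d := Num.min x d0 / 2.
have m0 : 0 < Num.min x d0 by rewrite lt_min x0 d00.
have m1 : Num.min x d0 <= x by rewrite ge_min lexx.
have m2 : Num.min x d0 <= d0 by rewrite ge_min lexx orbT.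
have dlt : d < d0 by rewrite /d; lra.
have dgt : 0 < d by rewrite /d; lra.
have := dbl d dgt dlt.
have h1 : 0 <= w (2 * d) by apply: modulus_ge0; lra.
have h2 : w d <= w x by apply: modulus_mono; rewrite /d; lra.
lra.
Qed.

Lemma modulus_within a b : 0 <= a -> {within `[a, b], continuous w}.
Proof.
case: hw => cw _ a0; apply: continuous_subspaceW cw => x /=.
by rewrite !in_itv/= andbT => /andP[ax _]; apply: le_trans ax.
Qed.

Lemma modulus_ivt b v : 0 <= b -> 0 <= v -> v <= w b -> exists2 x, 0 <= x <= b & w x = v.
Proof.
move=> b0 v0 vb.
have [||x] := @IVT R w 0 b v b0; first exact: modulus_within.
  by rewrite modulus0 ge_min le_max v0 vb orbT.
by rewrite in_itv/= => xb wx; exists x.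
Qed.

(** The intermediate value theorem gives [dl n]. If [dl n <= 2 * dl n.+1], then
    [w (dl n) < 2 * w (dl n.+1)] by monotonicity and doubling, whereas the choice of the values
    makes both sides equal. *)
Lemma modulus_scales : exists (dl : nat -> R) (ka d0 : R),
  [/\ 0 < ka <= 1, 0 < d0 /\ (forall d, 0 < d -> d < d0 -> w (2 * d) < 2 * w d),
      forall n, 0 < dl n, forall n, 2 * dl n.+1 < dl n &
      forall n, w (dl n) = ka * (2 ^+ n)^-1] /\ dl 0%N <= 1 /\ dl 0%N < d0.
Proof.
case: (hw) => _ [_ [_ [d0 [d00 dbl]]]].
pose d1 := Num.min 1 (d0 / 2).
have d1gt : 0 < d1 by rewrite lt_min ltr01 divr_gt0.
have d1le1 : d1 <= 1 by rewrite ge_min lexx.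
have d1le : d1 <= d0 / 2 by rewrite ge_min lexx orbT.
pose ka := Num.min 1 (w d1).
have ka0 : 0 < ka by rewrite lt_min ltr01 modulus_gt0.
have ka1 : ka <= 1 by rewrite ge_min lexx.
have kaw : ka <= w d1 by rewrite ge_min lexx orbT.
have p2 n : 0 < (2 ^+ n)^-1 :> R by rewrite invr_gt0 exprn_gt0.
have p2' n : (2 ^+ n)^-1 <= 1 :> R by rewrite invf_le1 ?exprn_gt0// exprn_ege1// ler1n.
have ex n : exists x, 0 <= x <= d1 /\ w x = ka * (2 ^+ n)^-1.
  have [||x h1 h2] := @modulus_ivt d1 (ka * (2 ^+ n)^-1) (ltW d1gt).
  - by rewrite mulr_ge0// ltW.
  - by apply: le_trans kaw; rewrite ler_piMr// ltW.
  by exists x.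
have [dl hdl] := choice ex.
have dlgt n : 0 < dl n.
  have [/andP[h1 _] h2] := hdl n; rewrite lt_neqAle h1 andbT; apply/negP => /eqP e.
  by have := mulr_gt0 ka0 (p2 n); rewrite -h2 -e modulus0 ltxx.
have dlle n : dl n <= d1 by have [/andP[]] := hdl n.
exists dl, ka, d0; split; last first.
  by split; [exact: le_trans (dlle _) d1le1|have := dlle 0%N; lra].
split => //; first by rewrite ka0 ka1.
- move=> n; rewrite ltNge; apply/negP => h.
  have := @modulus_mono _ _ (ltW (dlgt n)) h.
  have := dbl _ (dlgt n.+1) (le_lt_trans (dlle n.+1) (_ : d1 < d0)).
  move=> /(_ ltac:(lra)); have [_ ->] := hdl n; have [_ ->] := hdl n.+1.
  rewrite exprS invfM; lra.
- by move=> n; have [] := hdl n.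
Qed.

Lemma chi_lt a b : 0 <= a -> a < b -> chi w a < chi w b.
Proof.
move=> a0 ab; rewrite /chi; have b0 : 0 < b by apply: le_lt_trans ab.
apply: (@le_lt_trans _ _ (a * w b)).
  by rewrite ler_wpM2l// modulus_mono// ltW.
by rewrite ltr_pM2r// modulus_gt0.
Qed.

Lemma chi_gt0 a : 0 < a -> 0 < chi w a.
Proof. by move=> a0; rewrite mulr_gt0// modulus_gt0. Qed.

Lemma chi_invP x : 0 <= x -> 0 <= chi_inv w x /\ chi w (chi_inv w x) = x.
Proof.
move=> x0; rewrite /chi_inv; case: xgetP => [y -> []//|none].
(* For this [b], [chi w b >= b * w 1 >= x], so [chi w] attains [x] on [[0, b]]. *)
exfalso; pose b := Num.max 1 (x / w 1).
have w1 : 0 < w 1 by apply: modulus_gt0.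
have b1 : 1 <= b by rewrite le_max lexx.
have b2 : x / w 1 <= b by rewrite le_max lexx orbT.
have b0 : 0 <= b by lra.
have cc : {within `[0, b], continuous (chi w)}.
  move=> y; apply: cvgM; last exact: modulus_within.
  exact: (@continuous_subspaceT _ _ `[0, b] idfun (fun=> cvg_id)).
have [|y] := @IVT R (chi w) 0 b x b0 cc.
  have -> : chi w 0 = 0 by rewrite /chi mul0r.
  rewrite ge_min le_max x0 /=; apply/orP; right.
  apply: (@le_trans _ _ (b * w 1)); first by rewrite -ler_pdivrMr.
  by rewrite ler_wpM2l// modulus_mono.
rewrite in_itv/= => /andP[y0 _] yx; exact: (none y).
Qed.

Lemma chi_inv_ge0 x : 0 <= x -> 0 <= chi_inv w x.
Proof. by move=> /chi_invP[]. Qed.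

Lemma chi_invK x : 0 <= x -> chi w (chi_inv w x) = x.
Proof. by move=> /chi_invP[]. Qed.

Lemma chi_inv_gt0 x : 0 < x -> 0 < chi_inv w x.
Proof.
move=> x0; rewrite lt_neqAle chi_inv_ge0 ?ltW// andbT; apply/eqP => e.
by have := chi_invK (ltW x0); rewrite -e /chi mul0r => xe; move: x0; rewrite -xe ltxx.
Qed.

Lemma chi_inv_le x r : 0 <= x -> 0 <= r -> x <= chi w r -> chi_inv w x <= r.
Proof.
move=> x0 r0 xr; rewrite leNgt; apply/negP => /(chi_lt r0).
by rewrite chi_invK// ltNge xr.
Qed.

Lemma le_chi_inv x r : 0 <= x -> 0 <= r -> chi w r <= x -> r <= chi_inv w x.
Proof.
move=> x0 r0 xr; rewrite leNgt; apply/negP => /(chi_lt (chi_inv_ge0 x0)).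
by rewrite chi_invK// ltNge xr.
Qed.

Lemma chi_inv_mono x y : 0 <= x -> x <= y -> chi_inv w x <= chi_inv w y.
Proof.
move=> x0 xy; have y0 := le_trans x0 xy.
by apply: chi_inv_le => //; [exact: chi_inv_ge0|rewrite chi_invK].
Qed.

(** As [w] is nondecreasing, [chi] grows at least linearly, so its inverse grows at most
    linearly. *)
Lemma chi_inv_scale C x : 1 <= C -> 0 <= x -> chi_inv w (C * x) <= C * chi_inv w x.
Proof.
move=> C1 x0; have C0 : 0 <= C by lra.
have r0 := chi_inv_ge0 x0.
apply: chi_inv_le; try exact: mulr_ge0.
rewrite -[X in C * X](chi_invK x0) /chi -mulrA ler_wpM2l// ler_wpM2l//.
by apply: modulus_mono => //; rewrite ler_peMl.
Qed.

End Modulus.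

(** * Sums over level sets *)

Section Counting.
Variable R : realType.

Lemma size_int_interval (s : seq int) (a : int) (N : nat) : uniq s ->
  {in s, forall k, a <= k <= a + N%:Z} -> (size s <= N.+1)%N.
Proof.
move=> us h; rewrite -(size_iota 0 N.+1) -(size_map (fun i : nat => a + i%:Z)).
apply: uniq_leq_size => // k /h /andP[ak kN].
apply/mapP; exists `|k - a|%N; last by rewrite gez0_abs ?subr_ge0// subrKC.
rewrite mem_iota add0n /= ltnS.
have : `|k - a|%N%:Z <= N%:Z by rewrite gez0_abs ?subr_ge0// lerBlDl.
by [].
Qed.

Lemma count_ball (Y : seq int) (x r : R) : uniq Y -> 0 <= r ->
  (count (fun k => `|k%:~R - x| <= r) Y)%:R <= 2 * r + 1.
Proof.
move=> uY r0; rewrite -size_filter.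
have r2 : 0 <= 2 * r by rewrite mulr_ge0.
have /andP[t1 t2] := truncn_itv r2.
apply: (@le_trans _ _ (Num.truncn (2 * r)).+1%:R); last by rewrite -natr1 lerD2r.
rewrite ler_nat; apply: (@size_int_interval _ (Num.ceil (x - r))).
  exact: filter_uniq.
move=> k; rewrite mem_filter ler_distl => /andP[/andP[h1 h2] _].
apply/andP; split; first by rewrite ceil_le_int.
rewrite -lerBlDl.
have c1 : x - r <= (Num.ceil (x - r))%:~R by exact: ceil_ge.
have : (k - Num.ceil (x - r))%:~R < (Num.truncn (2 * r)).+1%:R :> R.
  by apply: le_lt_trans t2; rewrite rmorphB/=; lra.
rewrite -[X in _ < X]/((Num.truncn (2 * r)).+1%:~R) ltr_int.
by move=> h; rewrite -ltzD1 [X in _ < X]addrC -intS.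
Qed.

Lemma count_exists (T : eqType) (Y : seq T) (P : pred T) (Q : nat -> pred T) n :
  (forall k, P k -> exists2 i, (i < n)%N & Q i k) ->
  (count P Y <= \sum_(i < n) count (Q i) Y)%N.
Proof.
move=> h; elim: Y => [|k Y IH] /=; first by [].
rewrite big_split/= leq_add// ; case Pk : (P k) => //=.
have [i ilt Qi] := h _ Pk.
by rewrite (bigD1 (Ordinal ilt))//= Qi.
Qed.

Lemma sum_count (T : eqType) (Y : seq T) (P : pred T) (M : R) :
  \sum_(k <- Y | P k) M = (count P Y)%:R * M.
Proof. by rewrite big_const_seq iter_addr_0 mulr_natl. Qed.

(** An item with [th i.+1 < c k <= th i] contributes at most the [p]-th power of [th i], and there
    are at most [N i] of them. Items below the last threshold are left to the caller. *)
Lemma layer_cake (T : eqType) (Y : seq T) (c : T -> R) (th N : nat -> R) (p : R) (I : nat) :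
  0 <= p -> (forall k, 0 <= c k <= th 0%N) -> (forall i, th i.+1 <= th i) ->
  (forall i, 0 <= th i) ->
  (forall i, (i < I)%N -> (count (fun k => th i.+1 < c k) Y)%:R <= N i) ->
  \sum_(k <- Y | th I < c k) c k `^ p <= \sum_(i < I) N i * th i `^ p.
Proof.
move=> p0 c0 thd th0; elim: I => [|I IH] hN.
  by rewrite big_ord0 big1// => k; rewrite ltNge; have /andP[_ ->] := c0 k.
rewrite big_ord_recr/= (bigID (fun k => th I < c k))/=; apply: lerD.
  apply: le_trans (IH _) => [|i iI]; last by apply: hN; rewrite ltnS ltnW.
  rewrite le_eqVlt; apply/orP; left; apply/eqP; apply: eq_bigl => k.
  by apply/andP/idP => [[]//|h]; split => //; apply: le_lt_trans (thd I) h.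
apply: (@le_trans _ _ (\sum_(k <- Y | th I.+1 < c k) th I `^ p)).
  rewrite [leRHS](bigID (fun k => th I < c k))/= -[leLHS]add0r; apply: lerD.
    by apply: sumr_ge0 => k _; exact: powR_ge0.
  apply: ler_sum => k /andP[_]; rewrite -leNgt => h.
  by apply: ge0_ler_powR => //; rewrite nnegrE ?th0//; have /andP[] := c0 k.
by rewrite sum_count ler_wpM2r ?powR_ge0// hN.
Qed.

Lemma inverse_square_le (a z : R) : 0 < a -> a <= `|z| -> z ^- 2 <= a ^- 2.
Proof.
move=> a0 az; have z0 : 0 < `|z| by exact: lt_le_trans az.
rewrite -[z ^+ 2]real_normK ?num_real// lef_pV2 ?posrE ?exprn_gt0//.
by rewrite lerXn2r ?nnegrE// ltW.
Qed.

(** Layer cake with the thresholds (2^i T)^-2: at most 5 2^i T integers exceed the next threshold,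
    and the terms 5 / (2^i T) sum to at most 10 / T. *)
Lemma inverse_square_sum (Y : seq int) (x T : R) : uniq Y -> 1 <= T ->
  \sum_(k <- Y | T <= `|k%:~R - x|) (k%:~R - x) ^- 2 <= 10 / T.
Proof.
move=> uY T1; have T0 : 0 < T by lra.
pose c (k : int) : R := if T <= `|k%:~R - x| then (k%:~R - x) ^- 2 else 0.
pose th i : R := ((2 ^+ i) * T) ^- 2.
have pT i : 0 < 2 ^+ i * T by rewrite mulr_gt0// exprn_gt0.
have th0 i : 0 <= th i by rewrite invr_ge0 exprn_ge0// ltW.
have -> : \sum_(k <- Y | T <= `|k%:~R - x|) (k%:~R - x) ^- 2 = \sum_(k <- Y) c k.
  by rewrite big_mkcond/=; apply: eq_bigr => k _; rewrite /c; case: ifP.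
have c0 k : 0 <= c k <= th 0%N.
  rewrite /c; case: ifP => h; last by rewrite lexx th0.
  by rewrite invr_ge0 sqr_ge0 /th expr0 mul1r inverse_square_le.
have thd i : th i.+1 <= th i.
  rewrite lef_pV2 ?posrE ?exprn_gt0// lerXn2r ?nnegrE ?ltW//.
  by rewrite ltr_pM2r// exprS ltr_pMl ?exprn_gt0// ltr1n.
have cnt i : (count (fun k => th i.+1 < c k) Y)%:R <= 5 * (2 ^+ i * T).
  apply: (@le_trans _ _ (count (fun k => `|k%:~R - x| <= 2 ^+ i.+1 * T) Y)%:R).
    rewrite ler_nat; apply: sub_count => k /=; apply: contraTT.
    rewrite -ltNge -leNgt /c => h; case: ifP => _; last exact: th0.
    by apply: inverse_square_le => //; exact: ltW.
  apply: le_trans (count_ball _ uY (ltW (pT i.+1))) _.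
  have : 1 <= 2 ^+ i * T.
    by apply: (le_trans T1); rewrite ler_peMl ?exprn_ege1 ?ler1n// ltW.
  rewrite exprS; lra.
(* [Y] is finite, so the terms below the last threshold contribute at most [size Y] times that
   threshold, which tends to 0 with [I]. *)
apply: (@le_pow2_small _ _ _ ((size Y)%:R * T ^- 2)) => I.
rewrite (bigID (fun k => th I < c k))/=; apply: lerD.
  have h := @layer_cake _ Y c th (fun i => 5 * (2 ^+ i * T)) 1 I ler01 c0 thd th0
    (fun i _ => cnt i).
  rewrite (eq_bigr (fun k => c k `^ 1)); last first.
    by move=> k _; rewrite powRr1//; have /andP[] := c0 k.
  apply: (le_trans h) => {h}.
  under eq_bigr => i _.
    rewrite powRr1// (_ : _ * th i = 5 / T * (2 ^+ i)^-1); last first.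
      by rewrite /th; field; rewrite gt_eqF// gt_eqF// exprn_gt0.
    over.
  rewrite -mulr_sumr -[10](@divfK _ 2) ?pnatr_eq0// (_ : 10 / 2 = 5); last by field.
  rewrite [leRHS]mulrAC ler_wpM2l ?divr_ge0 ?ltW//.
  have E J : \sum_(i < J) (2 ^+ i)^-1 = 2 - 2 * (2 ^+ J)^-1 :> R.
    elim: J => [|J IHJ]; first by rewrite big_ord0 expr0 invr1 mulr1 subrr.
    rewrite big_ord_recr/= IHJ exprS invfM; field; rewrite expf_neq0//.
  by rewrite E ltrBlDr ltrDl divr_gt0// exprn_gt0.
apply: (@le_trans _ _ (\sum_(k <- Y | ~~ (th I < c k)) th I)).
  by apply: ler_sum => k; rewrite -leNgt.
rewrite sum_count -mulrA; apply: ler_pM => //.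
  by rewrite ler_nat count_size.
rewrite /th exprMn invfM mulrC ler_wpM2l ?invr_ge0 ?exprn_ge0 ?(ltW T0)//.
rewrite lef_pV2 ?posrE ?exprn_gt0// ?exprn_gt0//.
by rewrite -exprM ler_weXn2l ?ler1n// leq_pmulr.
Qed.

End Counting.

Section PowerSums.
Variable R : realType.
Implicit Types (x y p : R).

Lemma powR_split y p : 0 <= y -> 0 < p -> y `^ p = y `^ (p - 1) * y.
Proof. by move=> y0 p0; rewrite mulrC mulr_powRB1. Qed.

Lemma powR_le_sqr y p : 1 <= y -> p <= 2 -> y `^ p <= y ^+ 2.
Proof.
by move=> y1 p2; rewrite -powR_mulrn ?(le_trans ler01)//; apply: ler_powR.
Qed.

Lemma powR_le x y p : 0 <= p -> 0 <= x -> x <= y -> x `^ p <= y `^ p.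
Proof.
by move=> p0 x0 xy; apply: ge0_ler_powR => //; rewrite nnegrE// (le_trans x0).
Qed.

Lemma pow2_between x : 1 <= x -> exists I, 2 ^+ I <= x < 2 ^+ I.+1.
Proof.
move=> x1; have [N xN] := pow2_small x ltr01.
rewrite ltr_pdivrMr ?exprn_gt0// mul1r in xN.
have ex : exists N, x < 2 ^+ N by exists N.
case: (ex_minnP ex) => -[|I] hI minI; first by move: hI; rewrite expr0 ltNge x1.
exists I; rewrite hI andbT leNgt; apply/negP => /minI; by rewrite ltnn.
Qed.

End PowerSums.

(** * Dyadic sums compared with the integral defining Theta_p *)

Section Theta.
Variables (R : realType) (w : R -> R).
Hypothesis hw : modulus_hyp w.
Let g (y : R) : R := chi_inv w y^-1.

Lemma chi_inv_continuous (x : R) : 0 < x -> {for x, continuous (chi_inv w)}.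
Proof.
move=> x0; apply/cvgrPdist_le => e e0.
have a0 := chi_inv_gt0 hw x0; set a := chi_inv w x in a0 *.
pose d := Num.min e (a / 2).
have d0 : 0 < d by rewrite lt_min e0 divr_gt0.
have d1 : d <= e by rewrite ge_min lexx.
have d2 : d <= a / 2 by rewrite ge_min lexx orbT.
have aE : chi w a = x by exact: chi_invK (ltW x0).
clearbody a d.
have h1 : chi w (a - d) < x by rewrite -aE; apply: chi_lt => //; lra.
have h2 : x < chi w (a + d) by rewrite -aE; apply: chi_lt => //; lra.
have xI : x \in `](chi w (a - d)), (chi w (a + d))[ by rewrite in_itv/= h1 h2.
near=> y.
have /andP[/ltW y1 /ltW y2] : chi w (a - d) < y < chi w (a + d).
  by near: y; have := near_in_itvoo xI; apply: filterS => t; rewrite in_itv.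
have y0 : 0 <= y by apply: le_trans y1; apply: mulr_ge0; [lra|apply: modulus_ge0 => //; lra].
have := le_chi_inv hw y0 (_ : 0 <= a - d) y1.
have := chi_inv_le hw y0 (_ : 0 <= a + d) y2.
move=> /(_ ltac:(lra)) h3 /(_ ltac:(lra)) h4.
by rewrite ler_norml; lra.
Unshelve. all: by end_near. Qed.

Lemma theta_integrable p y : 0 < p ->
  lebesgue_measure.-integrable `[1, y] (EFin \o (fun t => g t `^ p)).
Proof.
move=> p0; apply: continuous_compact_integrable; first exact: segment_compact.
apply: continuous_in_subspaceT => x; rewrite inE/= in_itv/= => /andP[x1 _].
have x0 : 0 < x by lra.
apply: (@continuous_comp _ _ _ g (fun a => a `^ p)).
  apply: (@continuous_comp _ _ _ (fun t : R => t^-1) (chi_inv w)).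
    by apply: inv_continuous; rewrite gt_eqF.
  by apply: chi_inv_continuous; rewrite invr_gt0.
apply/differentiable_continuous/derivable1_diffP; apply: derivable_powR.
by rewrite in_itv/= andbT chi_inv_gt0// invr_gt0.
Qed.

Definition theta_int (p y : R) : R :=
  Rintegral lebesgue_measure `[1, y] (fun t => chi_inv w (t^-1) `^ p).

Lemma g_anti x y : 0 < x -> x <= y -> g y <= g x.
Proof.
move=> x0 xy; apply: chi_inv_mono => //; first by rewrite invr_ge0; lra.
by rewrite lef_pV2 ?posrE//; exact: lt_le_trans xy.
Qed.

Lemma g_ge0 x : 0 <= x -> 0 <= g x.
Proof. by move=> x0; apply: chi_inv_ge0; rewrite ?invr_ge0. Qed.

Lemma theta_int_split p x y : 0 < p -> 1 <= x -> x <= y ->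
  theta_int p x + (y - x) * g y `^ p <= theta_int p y.
Proof.
move=> p0 x1 xy; rewrite /theta_int.
have := @Rintegral_itvB R (fun t => chi_inv w (t^-1) `^ p) (BLeft 1) (BRight y) x.
move=> /(_ (theta_integrable y p0)); rewrite !bnd_simp => /(_ x1 xy) e.
rewrite -lerBrDl e.
have -> : (y - x) * g y `^ p = (\int[lebesgue_measure]_(t in `]x, y]) (g y `^ p))%R.
  rewrite Rintegral_cst//= mulrC lebesgue_measure_itv/= lte_fin.
  by move: xy; rewrite le_eqVlt => /predU1P[->|->//]; rewrite ltxx subrr.
have sub : `]x, y] `<=` `[1, y].
  by move=> t /=; rewrite !in_itv/= => /andP[h1 h2]; apply/andP; split; lra.
have aux (t : R) : x < t <= y -> g y `^ p <= g t `^ p.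
  move=> /andP[h1 h2]; apply: powR_le; first exact: ltW.
    by apply: g_ge0; lra.
  by apply: g_anti; lra.
apply: le_Rintegral => //.
- apply: (integrableS _ _ _ (_ : lebesgue_measure.-integrable `[x, y] _)) => //.
    exact: subset_itv_oc_cc.
  by apply: continuous_intble => t; exact: cvg_cst.
- by apply: (integrableS _ _ _ (theta_integrable y p0)).
Qed.

Lemma theta_int_ge0 p y : 0 <= theta_int p y.
Proof. by apply: Rintegral_ge0 => t _; exact: powR_ge0. Qed.

Lemma theta_int_dyadic p I y : 0 < p -> 2 ^+ I <= y ->
  \sum_(i < I) 2 ^+ i * g (2 ^+ i.+1) `^ p <= theta_int p y.
Proof.
move=> p0.
have h J : \sum_(i < J) 2 ^+ i * g (2 ^+ i.+1) `^ p <= theta_int p (2 ^+ J).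
  elim: J => [|J IH]; first by rewrite big_ord0 theta_int_ge0.
  have p1 : 1 <= 2 ^+ J :> R by rewrite exprn_ege1// ler1n.
  have p2 : 2 ^+ J <= 2 ^+ J.+1 :> R by rewrite exprS; lra.
  rewrite big_ord_recr/=; apply: le_trans (theta_int_split p0 p1 p2).
  by rewrite exprS (_ : 2 * 2 ^+ J - 2 ^+ J = 2 ^+ J) ?lerD2r//; ring.
move=> Iy; apply: le_trans (h I) _.
have p1 : 1 <= 2 ^+ I :> R by rewrite exprn_ege1// ler1n.
apply: le_trans (theta_int_split p0 p1 Iy).
by rewrite lerDl mulr_ge0 ?powR_ge0// subr_ge0.
Qed.

Lemma g_half x : 0 < x -> g x <= 2 * g (2 * x).
Proof.
move=> x0; rewrite /g (_ : x^-1 = 2 * (2 * x)^-1); last by field; rewrite gt_eqF.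
by apply: chi_inv_scale; rewrite ?ler1n// invr_ge0 mulr_ge0// ltW.
Qed.

(** Cauchy condensation for the nonincreasing [g]. Each dyadic block of the integral controls the
    term at its right end; the term at 1 has no block to its left and is compared with the term at 2
    through [g_half], at the cost of a factor 2^p <= 4. *)
Lemma theta_int_condense p I y : 0 < p -> p <= 2 -> 2 <= y -> 2 ^+ I <= y ->
  \sum_(i < I.+1) 2 ^+ i * g (2 ^+ i) `^ p <= 6 * theta_int p y.
Proof.
move=> p0 p2 y2 Iy; rewrite big_ord_recl/=.
under eq_bigr => i _ do rewrite /fintype.bump leq0n add1n [X in X * _]exprS -mulrA.
rewrite -mulr_sumr.
have h1 := theta_int_dyadic p0 Iy.
have h2 : g (2 ^+ 0) `^ p <= 4 * theta_int p y.
  apply: (@le_trans _ _ ((2 * g 2) `^ p)).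
    apply: powR_le; [exact: ltW|by rewrite expr0; apply: g_ge0|].
    by have := g_half (@ltr01 R); rewrite mulr1 expr0.
  rewrite powRM ?g_ge0//; apply: ler_pM; rewrite ?powR_ge0//.
    by apply: le_trans (powR_le_sqr _ p2) _; rewrite ?ler1n// -natrX.
  have := @theta_int_dyadic p 1 y p0; rewrite big_ord1 expr0 mul1r expr1; exact.
rewrite expr0 mul1r; move: h1 h2; set s := \sum_(_ < _) _; set a := _ `^ _; lra.
Qed.

End Theta.

(** * Power sums of the coefficients of one packet *)

Section Packet.
#[local] Hint Extern 0 (is_true (_ <= _)) => (apply: ltW; assumption) : core.
Variables (R : realType) (w : R -> R).
Hypothesis hw : modulus_hyp w.
Variables (dl : nat -> R) (ka d0 C0 : R).
Hypotheses (ka0 : 0 < ka <= 1)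
  (d00 : 0 < d0) (dbl : forall d, 0 < d -> d < d0 -> w (2 * d) < 2 * w d)
  (dl_gt0 : forall n, 0 < dl n) (dl2 : forall n, 2 * dl n.+1 < dl n)
  (wdl : forall n, w (dl n) = ka * (2 ^+ n)^-1)
  (dl01 : dl 0%N <= 1) (C01 : 1 <= C0).

(* What is used of the Fourier coefficients [c] of one bump: the phase has
   slope at most [mu] in absolute value around the frequency [x]; the third
   clause is van der Corput away from the dyadic levels of the ladder, the last
   one is the decay far from [x]. *)
Definition packet (c : int -> R) (x lam mu : R) (n : nat) : Prop :=
  [/\ forall k, 0 <= c k <= C0 * dl n,
      forall k, c k <= C0 * (lam * (2 ^+ n)^-1 * dl n ^+ 2),
      forall k j rho, 0 < rho -> dl (n + j) <= rho ->
        (forall i, (i <= 2 ^ j)%N ->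
           rho^-1 < `|k%:~R - x + mu * (i%:R / 2 ^+ j)| /\
           rho^-1 < `|k%:~R - x - mu * (i%:R / 2 ^+ j)|) -> c k <= C0 * rho &
      forall k, 0 < `|k%:~R - x| -> 2 * (lam * (2 ^+ n)^-1) <= `|k%:~R - x| ->
        c k <= C0 * (lam * (2 ^+ n)^-1 / (k%:~R - x) ^+ 2)].

Let dlle n : dl n <= (2 ^+ n)^-1.
Proof.
have := dl_pow dl2 0 n; rewrite add0n => h; apply: le_trans h _.
by rewrite ler_piMr// invr_ge0 exprn_ge0.
Qed.

Let dlle1 n : dl n <= 1.
Proof. by apply: le_trans (dlle n) _; rewrite invf_le1 ?exprn_gt0// exprn_ege1// ler1n. Qed.

Lemma dl_index n rho : 0 < rho -> rho < dl n ->
  exists j, dl (n + j.+1) <= rho < dl (n + j).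
Proof.
move=> rho0 rn; have [N hN] := pow2_small (dl n) rho0.
have ex : exists j, dl (n + j) <= rho.
  by exists N; apply: le_trans (dl_pow dl2 n N) _; rewrite mulrC ltW.
case: (ex_minnP ex) => -[|j] hj minj; first by move: hj; rewrite addn0 leNgt rn.
by exists j; rewrite hj ltNge; apply/negP => /minj; rewrite ltnn.
Qed.

(** A coefficient above [C0 * rho] forces [k] to be within 1/rho of one of 2 (2^(j+1) + 1) dyadic
    slopes, where [dl (n + j.+1) <= rho < dl (n + j)]. Each such ball holds at most 3/rho integers,
    and [w rho <= w (dl (n + j))] bounds 2^j by 2^-n / w(rho). *)
Lemma packet_count c x lam mu n (Y : seq int) rho : packet c x lam mu n ->
  uniq Y -> 0 < rho ->
  (count (fun k => (C0 * rho < c k)%R) Y)%:R <= 24 * (2 ^+ n)^-1 / chi w rho.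
Proof.
move=> [h1 _ h2 _] uY rho0; have C00 : 0 < C0 by have h := C01; lra.
have chi0 : 0 < chi w rho by exact: chi_gt0.
have [rn|nr] := ltP rho (dl n); last first.
  rewrite (@eq_in_count _ _ pred0) ?count_pred0; last first.
    move=> k _ /=; apply/negbTE; rewrite -leNgt.
    by have /andP[_ h] := h1 k; apply: le_trans h _; rewrite ler_pM2l.
  by apply: divr_ge0 => //; apply: mulr_ge0; rewrite ?invr_ge0 ?exprn_ge0.
have [j /andP[jr rj]] := dl_index rho0 rn.
pose M := (2 ^ j.+1)%N.
(* The centres: indices up to [M] list the levels of one sign, the following [M.+1] indices those of
   the other. *)
pose y (i : nat) : R := if (i <= M)%N then x - mu * (i%:R / 2 ^+ j.+1)
   else x + mu * ((i - M.+1)%N%:R / 2 ^+ j.+1).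
have cnt : (count (fun k => (C0 * rho < c k)%R) Y <=
    \sum_(i < (M.+1 + M.+1)%N) count (fun k : int => (`|k%:~R - y i| <= rho^-1)%R) Y)%N.
  apply: (@count_exists _ Y (fun k => (C0 * rho < c k)%R)
    (fun i (k : int) => (`|k%:~R - y i| <= rho^-1)%R)) => k ck; apply: contrapT => none.
  move: ck; rewrite ltNge => /negP; apply; apply: (h2 k j.+1) => // i iM.
  split; rewrite ltNge; apply/negP => hh; apply: none.
    exists i; first by rewrite ltn_addr// ltnS.
    have -> : k%:~R - y i = k%:~R - x + mu * (i%:R / 2 ^+ j.+1) by rewrite /y /M iM; ring.
    exact: hh.
  exists (M.+1 + i)%N; first by rewrite ltn_add2l ltnS.
  rewrite /y leqNgt ltn_addr ?ltnS//= addKn opprD addrA.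
  exact: hh.
have rho1 : 1 <= rho^-1 by rewrite invf_ge1//; have := dlle1 n; lra.
have {}cnt : (count (fun k => (C0 * rho < c k)%R) Y)%:R <= (M.+1 + M.+1)%N%:R * (3 * rho^-1).
  apply: (@le_trans _ _ (\sum_(i < (M.+1 + M.+1)%N)
      count (fun k : int => (`|k%:~R - y i| <= rho^-1)%R) Y)%N%:R).
    by rewrite ler_nat.
  rewrite natr_sum; apply: (@le_trans _ _ (\sum_(i < (M.+1 + M.+1)%N) (3 * rho^-1))).
    apply: ler_sum => i _; apply: le_trans (count_ball _ uY _) _; first by lra.
    lra.
  by rewrite sumr_const card_ord -[leLHS]mulr_natl.
apply: le_trans cnt _.
have M1 : 1 <= M%:R :> R by rewrite ler1n expn_gt0.
have ME : M%:R = 2 * 2 ^+ j :> R by rewrite natrX exprS.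
have wr : w rho <= ka * (2 ^+ (n + j))^-1.
  by rewrite -wdl; apply: modulus_mono => //; exact: ltW.
have w0 : 0 < w rho by exact: modulus_gt0.
rewrite /chi.
have hM : M%:R * w rho <= 2 * (2 ^+ n)^-1.
  rewrite ME; apply: (@le_trans _ _ (2 * 2 ^+ j * (ka * (2 ^+ (n + j))^-1))).
    by rewrite ler_wpM2l// mulr_ge0// exprn_ge0.
  rewrite exprD invfM (_ : _ * _ = ka * (2 * (2 ^+ n)^-1)); last first.
    by field; rewrite !expf_neq0.
  by rewrite ler_piMl ?mulr_ge0 ?invr_ge0 ?exprn_ge0//; case/andP: ka0.
have {}hM : M%:R <= 2 * (2 ^+ n)^-1 / w rho by rewrite ler_pdivlMr.
rewrite natrD -natr1.
apply: (@le_trans _ _ (12 * rho^-1 * M%:R)).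
  rewrite (_ : _ * (3 * _) = 3 * rho^-1 * (M%:R + 1 + (M%:R + 1))); last by ring.
  rewrite (_ : 12 * _ * _ = 3 * rho^-1 * (M%:R + M%:R + (M%:R + M%:R))); last by ring.
  by rewrite ler_wpM2l ?mulr_ge0 ?invr_ge0//; lra.
rewrite (_ : 24 * _ / _ = 12 * rho^-1 * (2 * (2 ^+ n)^-1 / w rho)); last first.
  by field; rewrite !gt_eqF// exprn_gt0.
by rewrite ler_wpM2l// mulr_ge0// invr_ge0 ltW.
Qed.

(** Split off one factor [c] from its [p]-th power: the remaining power [p - 1] is taken of a number
    at most C0 / T, because lam 2^-n <= T, and the single factor is summed by
    [inverse_square_sum]. *)
Lemma packet_far c x lam mu n (Y : seq int) p T : packet c x lam mu n ->
  uniq Y -> 0 <= lam -> 1 <= p -> p <= 2 -> 1 <= T -> 2 * (lam * (2 ^+ n)^-1) <= T ->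
  \sum_(k <- Y | T <= `|k%:~R - x|) c k `^ p <=
  10 * C0 ^+ 2 * (lam * (2 ^+ n)^-1 / T) * T^-1 `^ (p - 1).
Proof.
move=> [h1 _ _ h3] uY l0 p1 p2 T1 lT; set La := lam * _ in lT *.
have La0 : 0 <= La by rewrite mulr_ge0// invr_ge0 exprn_ge0.
have T0 : 0 < T by lra.
have C00 : 0 <= C0 by have h := C01; lra.
apply: (@le_trans _ _ (\sum_(k <- Y | T <= `|k%:~R - x|)
   (C0 * T^-1) `^ (p - 1) * (C0 * La) * (k%:~R - x) ^- 2)).
  apply: ler_sum => k kT.
  have /andP[c0 _] := h1 k.
  have k0 : 0 < `|k%:~R - x| by exact: lt_le_trans kT.
  have ck := h3 k k0 (le_trans lT kT); rewrite -/La in ck.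
  rewrite powR_split//; last lra.
  rewrite -mulrA; apply: ler_pM; rewrite ?powR_ge0//; last by rewrite -mulrA.
  apply: powR_le; rewrite ?subr_ge0//; apply: (le_trans ck).
  rewrite ler_wpM2l//; apply: (@le_trans _ _ (La * T ^- 2)).
    by rewrite ler_wpM2l// inverse_square_le.
  rewrite expr2 invfM mulrA ler_piMl ?invr_ge0// ler_pdivrMr// mul1r.
  lra.
rewrite -mulr_sumr.
apply: le_trans (ler_wpM2l _ (inverse_square_sum x uY T1)) _.
  by rewrite !mulr_ge0// powR_ge0.
rewrite powRM ?invr_ge0//.
rewrite (_ : _ * (10 / T) = C0 `^ (p - 1) * C0 * (10 * (La / T) * T^-1 `^ (p - 1))); last by ring.
rewrite -powR_split//; last lra.
rewrite (_ : 10 * C0 ^+ 2 * _ * _ = C0 ^+ 2 * (10 * (La / T) * T^-1 `^ (p - 1))); last by ring.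
rewrite ler_wpM2r ?powR_le_sqr//.
by rewrite !mulr_ge0 ?powR_ge0 ?invr_ge0// ltW.
Qed.

(* Packets below the uncertainty threshold [lam * 2 ^- n * dl n < 1]. *)
Lemma packet_small c x lam mu n (Y : seq int) p : packet c x lam mu n ->
  uniq Y -> 0 <= lam -> 1 <= p -> p <= 2 -> lam * (2 ^+ n)^-1 * dl n < 1 ->
  \sum_(k <- Y) c k `^ p <=
  20 * C0 ^+ 2 * (lam * (2 ^+ n)^-1 * dl n) * dl n `^ (p - 1).
Proof.
move=> pk uY l0 p1 p2 small; have [h1 h1' _ _] := pk.
have dn0 := dl_gt0 n; have dn1 := dlle1 n.
set La := lam * (2 ^+ n)^-1 in small h1' *.
have La0 : 0 <= La by rewrite mulr_ge0// invr_ge0 exprn_ge0.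
have C00 : 0 <= C0 by have h := C01; lra.
have T1 : 1 <= 2 / dl n by rewrite ler_pdivlMr//; lra.
have LT : 2 * La <= 2 / dl n by rewrite ler_pdivlMr//; lra.
(* Cut at distance 2 / dl(n) from [x]: farther away the decay clause applies, and the at most 6 /
   dl(n) nearer frequencies use the first two clauses of [packet]. *)
rewrite (bigID (fun k : int => 2 / dl n <= `|k%:~R - x|))/=.
have far := packet_far pk uY l0 p1 p2 T1 LT; rewrite -/La invf_div in far.
have {}far : \sum_(k <- Y | 2 / dl n <= `|k%:~R - x|) c k `^ p <=
    10 * C0 ^+ 2 * (La * dl n) * dl n `^ (p - 1).
  apply: (le_trans far).
  have hdd : (dl n / 2) `^ (p - 1) <= dl n `^ (p - 1).
    by apply: powR_le; [lra|lra|lra].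
  apply: ler_pM => //; rewrite ?powR_ge0//.
    by rewrite !mulr_ge0 ?exprn_ge0 ?invr_ge0 ?divr_ge0 //.
  rewrite ler_wpM2l ?mulr_ge0 ?exprn_ge0// ler_wpM2l//; lra.
have near : \sum_(k <- Y | ~~ (2 / dl n <= `|k%:~R - x|)) c k `^ p <=
    (6 / dl n) * ((C0 * dl n) `^ (p - 1) * (C0 * (La * dl n ^+ 2))).
  apply: (@le_trans _ _ (\sum_(k <- Y | ~~ (2 / dl n <= `|k%:~R - x|))
      ((C0 * dl n) `^ (p - 1) * (C0 * (La * dl n ^+ 2))))).
    apply: ler_sum => k _; have /andP[c0 c1] := h1 k.
    rewrite powR_split//; last lra.
    by apply: ler_pM; rewrite ?powR_ge0 ?powR_le ?subr_ge0.
  rewrite sum_count ler_wpM2r ?mulr_ge0 ?powR_ge0 ?exprn_ge0//.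
  apply: (@le_trans _ _ (count (fun k : int => `|k%:~R - x| <= 2 / dl n) Y)%:R).
    by rewrite ler_nat; apply: sub_count => k /=; rewrite -ltNge => /ltW.
  apply: le_trans (count_ball x uY _) _; first by lra.
  rewrite (_ : 6 / dl n = 3 * (2 / dl n)); last by ring.
  lra.
have {}near : \sum_(k <- Y | ~~ (2 / dl n <= `|k%:~R - x|)) c k `^ p <=
    6 * C0 ^+ 2 * (La * dl n) * dl n `^ (p - 1).
  apply: (le_trans near); rewrite powRM//.
  rewrite (_ : 6 / dl n * _ = C0 `^ (p - 1) * C0 * (6 * (La * dl n) * dl n `^ (p - 1))); last first.
    by field; rewrite gt_eqF.
  rewrite -powR_split//; last lra.
  rewrite (_ : 6 * C0 ^+ 2 * _ * _ = C0 ^+ 2 * (6 * (La * dl n) * dl n `^ (p - 1))); last by ring.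
  by rewrite ler_wpM2r ?powR_le_sqr// !mulr_ge0 ?powR_ge0// ltW.
have : 0 <= C0 ^+ 2 * (La * dl n) * dl n `^ (p - 1).
  by rewrite !mulr_ge0 ?powR_ge0 ?exprn_ge0 //.
move: far near; rewrite -!mulrA; lra.
Qed.

Let T_ge lam n : 1 <= lam * (2 ^+ n)^-1 * dl n ->
  1 <= 2 * (lam * (2 ^+ n)^-1) /\ (2 * (lam * (2 ^+ n)^-1))^-1 <= dl n.
Proof.
set La := lam * _ => h; have dn0 := dl_gt0 n; have dn1 := dlle1 n.
have La0 : 0 < La by rewrite -(pmulr_lgt0 _ dn0); lra.
have La1 : 1 <= La by apply: le_trans h _; rewrite ler_piMr// ltW.
split; first lra.
rewrite -div1r ler_pdivrMr; last by rewrite mulr_gt0.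
rewrite (_ : dl n * _ = 2 * (La * dl n)); [lra|ring].
Qed.

Lemma packet_large_far c x lam mu n (Y : seq int) p : packet c x lam mu n ->
  uniq Y -> 0 < lam -> 1 <= p -> p <= 2 -> 1 <= lam * (2 ^+ n)^-1 * dl n ->
  \sum_(k <- Y | 2 * (lam * (2 ^+ n)^-1) <= `|k%:~R - x|) c k `^ p <=
  5 * C0 ^+ 2 * dl n `^ (p - 1).
Proof.
move=> pk uY l0 p1 p2 large; have [T1 T2] := T_ge large.
have dn0 := dl_gt0 n; have C00 : 0 <= C0 by have h := C01; lra.
apply: le_trans (packet_far pk uY (ltW l0) p1 p2 T1 (lexx _)) _.
have -> : lam * (2 ^+ n)^-1 / (2 * (lam * (2 ^+ n)^-1)) = 2^-1.
  by field; rewrite expf_neq0// gt_eqF.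
apply: ler_pM; rewrite ?powR_ge0 ?mulr_ge0 ?exprn_ge0//; try lra.
apply: powR_le => //; rewrite ?invr_ge0; lra.
Qed.

(** Beyond distance T = 2 lam 2^-n the decay clause gives the last term; within it there are at most
    3 T frequencies, and those with [c k <= t] give the middle term. *)
Lemma packet_large c x lam mu n (Y : seq int) p t : packet c x lam mu n ->
  uniq Y -> 0 < lam -> 1 <= p -> p <= 2 -> 1 <= lam * (2 ^+ n)^-1 * dl n -> 0 <= t ->
  \sum_(k <- Y) c k `^ p <= \sum_(k <- Y | t < c k) c k `^ p +
    6 * (2 ^+ n)^-1 * lam * t `^ p + 5 * C0 ^+ 2 * dl n `^ (p - 1).
Proof.
move=> pk uY l0 p1 p2 large t0; have [h1 _ _ _] := pk.
have [T1 _] := T_ge large.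
have far := packet_large_far pk uY l0 p1 p2 large.
set T := 2 * (lam * _) in far T1.
have near : \sum_(k <- Y | ~~ (T <= `|k%:~R - x|)) c k `^ p <=
   \sum_(k <- Y | t < c k) c k `^ p + 3 * T * t `^ p.
  rewrite big_mkcond [X in X + _]big_mkcond/=.
  apply: (@le_trans _ _ (\sum_(k <- Y) ((if t < c k then c k `^ p else 0) +
     (if `|k%:~R - x| <= T then t `^ p else 0)))).
    apply: ler_sum => k _; case: ifPn => [|_]; last first.
      by rewrite addr_ge0//; case: ifP => _; rewrite ?powR_ge0.
    rewrite -ltNge => /ltW ->; case: ltP => h; first by rewrite lerDl powR_ge0.
    rewrite add0r; apply: powR_le => //; first lra.
    by case/andP: (h1 k).
  rewrite big_split/= lerD2l -big_mkcond/= sum_count ler_wpM2r ?powR_ge0//.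
  apply: le_trans (count_ball x uY _) _; lra.
rewrite (bigID (fun k : int => T <= `|k%:~R - x|))/= addrC; apply: lerD far.
by rewrite (_ : 6 * _ * _ * _ = 3 * T * t `^ p)// /T; ring.
Qed.

(** The thresholds chi^-1(2^-i) make the counts of [packet_count] proportional to powers of 2, so
    that the layer cake is the condensed form of the integral in Theta_p. It stops at 2^I comparable
    to lam, where the remaining O(lam 2^-n) frequencies cost no more than the last term of the
    condensed sum. *)
Lemma packet_sum_p c x lam mu n (Y : seq int) p : packet c x lam mu n ->
  uniq Y -> 2 <= lam -> 1 < p -> p <= 2 ->
  \sum_(k <- Y) c k `^ p <=
  300 * C0 ^+ 2 * ((2 ^+ n)^-1 * theta_int w p lam + dl n `^ (p - 1)).
Proof.
move=> pk uY l2 p1 p2; have p0 : 0 < p by lra.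
have l0 : 0 < lam by lra.
have dn0 := dl_gt0 n; have dn1 := dlle1 n.
have C00 : 0 <= C0 by have h := C01; lra.
have e0 : 0 < (2 ^+ n)^-1 :> R by rewrite invr_gt0 exprn_gt0.
have Th0 : 0 <= theta_int w p lam by exact: theta_int_ge0.
have P0 : 0 <= dl n `^ (p - 1) by exact: powR_ge0.
have CC : 0 <= C0 ^+ 2 by exact: exprn_ge0.
have tot : 0 <= C0 ^+ 2 * ((2 ^+ n)^-1 * theta_int w p lam).
  by rewrite !mulr_ge0// ltW.
have tot' : 0 <= C0 ^+ 2 * dl n `^ (p - 1) by rewrite mulr_ge0.
have [small|large] := ltP (lam * (2 ^+ n)^-1 * dl n) 1.
  apply: le_trans (packet_small pk uY (ltW l0) (ltW p1) p2 small) _.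
  rewrite mulrDr -[20 * _ * _ * _]mulrA -mulrA.
  have : C0 ^+ 2 * (lam * (2 ^+ n)^-1 * dl n * dl n `^ (p - 1)) <= C0 ^+ 2 * dl n `^ (p - 1).
    by rewrite ler_wpM2l// ler_piMl// ltW.
  move: tot tot'; rewrite -!mulrA; lra.
pose th i := C0 * chi_inv w (2 ^+ i)^-1.
have g0 i : 0 < chi_inv w (2 ^+ i)^-1 by apply: chi_inv_gt0; rewrite ?invr_gt0 ?exprn_gt0.
have th0 i : 0 <= th i by rewrite mulr_ge0// ltW.
have thd i : th i.+1 <= th i.
  rewrite /th ler_wpM2l//; apply: chi_inv_mono; rewrite ?invr_ge0 ?exprn_ge0//.
  by rewrite lef_pV2 ?posrE ?exprn_gt0// exprS ler_peMl ?exprn_ge0// ler1n.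
have [h1 _ _ _] := pk.
have c0 k : 0 <= c k <= th 0%N.
  have /andP[-> c1] := h1 k; apply: (le_trans c1); rewrite ler_wpM2l//.
  rewrite expr0 invr1; apply: le_chi_inv => //.
  have p1' : (2 ^+ n)^-1 <= 1 :> R by rewrite invf_le1 ?exprn_gt0// exprn_ege1// ler1n.
  have /andP[k0 k1] := ka0.
  apply: mulr_ile1 => //; first by apply: modulus_ge0.
  by rewrite wdl mulr_ile1// ltW.
have l1 : 1 <= lam by lra.
have [I /andP[Il lI]] := pow2_between l1.
have cnt i : (i < I)%N -> (count (fun k => th i.+1 < c k) Y)%:R <= (24 * (2 ^+ n)^-1 * 2 ^+ i.+1 : R).
  move=> _; have := packet_count pk uY (g0 i.+1).
  by rewrite chi_invK ?invr_ge0 ?exprn_ge0// invrK.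
have lc := layer_cake (ltW p0) c0 thd th0 cnt.
have near := packet_large pk uY l0 (ltW p1) p2 large (th0 I).
have cond := theta_int_condense hw p0 p2 l2 Il.
have thp i : th i `^ p <= C0 ^+ 2 * chi_inv w (2 ^+ i)^-1 `^ p.
  have gi := ltW (g0 i).
  by rewrite /th powRM// ler_wpM2r ?powR_ge0 ?powR_le_sqr//; exact: C01.
set S := \sum_(i < I.+1) _ in cond.
have lcS : \sum_(i < I) 24 * (2 ^+ n)^-1 * 2 ^+ i.+1 * th i `^ p +
    6 * (2 ^+ n)^-1 * lam * th I `^ p <= 48 * (2 ^+ n)^-1 * C0 ^+ 2 * S.
  rewrite /S big_ord_recr/= mulrDr mulr_sumr; apply: lerD.
    apply: ler_sum => i _.
    rewrite (_ : 48 * _ * _ * _ = 24 * (2 ^+ n)^-1 * 2 ^+ i.+1 * (C0 ^+ 2 * chi_inv w (2 ^+ i)^-1 `^ p)).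
      by rewrite ler_wpM2l// !mulr_ge0 ?exprn_ge0.
    by rewrite (exprS 2 i); ring.
  apply: (@le_trans _ _ (6 * (2 ^+ n)^-1 * lam * (C0 ^+ 2 * chi_inv w (2 ^+ I)^-1 `^ p))).
    by rewrite ler_wpM2l// !mulr_ge0.
  rewrite (_ : 48 * _ * _ * _ = 48 * (2 ^+ n)^-1 * 2 ^+ I * (C0 ^+ 2 * chi_inv w (2 ^+ I)^-1 `^ p)); last by ring.
  rewrite ler_wpM2r ?mulr_ge0 ?powR_ge0//.
  rewrite exprS in lI.
  rewrite (_ : 48 * _ * _ = 6 * (2 ^+ n)^-1 * (8 * 2 ^+ I)); last by ring.
  have P : 0 < 2 ^+ I :> R by rewrite exprn_gt0.
  by apply: ler_wpM2l; [rewrite mulr_ge0|lra].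
have hS : 48 * (2 ^+ n)^-1 * C0 ^+ 2 * S <= 288 * (C0 ^+ 2 * ((2 ^+ n)^-1 * theta_int w p lam)).
  rewrite (_ : 288 * _ = 48 * (2 ^+ n)^-1 * C0 ^+ 2 * (6 * theta_int w p lam)); last by ring.
  by rewrite ler_wpM2l// !mulr_ge0.
move: near lc lcS hS tot tot'.
rewrite -[5 * _ * _]mulrA [300 * _ * _]mulrDr -![300 * _ * _]mulrA.
set a1 := \sum_(_ <- _) _; set a3 := \sum_(_ <- _ | _) _.
set a4 := 6 * _ * _ * _; set a5 := \sum_(_ < _) _; set a6 := C0 ^+ 2 * _.
set a7 := C0 ^+ 2 * _; set a8 := 48 * _ * _ * _.
lra.
Qed.

(** With lam = q^4 the claim reduces to ln q <= q. *)
Lemma ln_sqr_small (e : R) : 0 < e -> exists L : R, forall lam : R, L <= lam ->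
  0 < lam /\ (ln lam) ^+ 2 / lam <= e.
Proof.
move=> e0; pose q0 := 1 + 16 / e.
have q01 : 1 <= q0 by rewrite lerDl divr_ge0.
exists (q0 ^+ 4) => lam hlam.
have l0 : 0 < lam by apply: lt_le_trans hlam; rewrite exprn_gt0//; lra.
split => //; pose q := lam `^ 4^-1.
have qE : q ^+ 4 = lam by rewrite -powR_mulrn ?powR_ge0// -powRrM mulVf ?powRr1// ltW.
have q0q : q0 <= q.
  by rewrite leNgt; apply/negP => h; move: hlam; rewrite -qE leNgt ltrXn2r// ?powR_ge0//; lra.
have q_gt : 0 < q by lra.
have lnE : ln lam = 4 * ln q by rewrite /q ln_powR mulrA divff ?mul1r.
have lnq : ln q <= q by apply: ltW; exact: ln_sublinear.
have lnq0 : 0 <= ln q by apply: ln_ge0; lra.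
rewrite ler_pdivrMr// lnE exprMn.
have h : (ln q) ^+ 2 <= q ^+ 2 by rewrite lerXn2r ?nnegrE.
have e1 : 16 <= e * q.
  have : 16 / e <= q by rewrite /q0 in q0q; lra.
  by rewrite ler_pdivrMr// mulrC.
apply: (@le_trans _ _ (16 * q ^+ 2)).
  rewrite (_ : 4 ^+ 2 = 16); last by ring.
  by rewrite ler_wpM2l.
rewrite -qE (_ : e * q ^+ 4 = (e * q) * q * q ^+ 2); last by ring.
rewrite ler_wpM2r ?exprn_ge0//; apply: (le_trans e1).
by rewrite ler_peMr//; lra.
Qed.

(** Put l = ln lam and chi(ds) = l^2 / lam, so that Theta_1(lam) = l / w(ds) = lam ds / l. Geometric
    thresholds run from above 1 down to about ds / l. Each of the O(l) layers above ds costs a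
    multiple of 2^-n / w(ds). Below ds the doubling hypothesis limits the growth of 1/w, and the
    costs form a geometric sum of order 2^-n l / w(ds). What is left are O(lam 2^-n) coefficients of
    size O(ds / l), hence again 2^-n Theta_1, and the far frequencies. *)
Lemma packet_sum_1 : exists C L : R, 0 <= C /\ forall lam, L <= lam ->
  forall c x mu n (Y : seq int), packet c x lam mu n -> uniq Y ->
  \sum_(k <- Y) c k <=
    C * ((2 ^+ n)^-1 * Theta w 1 lam + Num.min 1 (lam * ((2 ^+ n)^-1 * (2 ^+ n)^-1))).
Proof.
have C00 : 0 <= C0 by have h := C01; lra.
have [_ [_ [w_0 _]]] := hw.
pose b := Num.min 1 d0 / 2.
have m0 : 0 < Num.min 1 d0 by rewrite lt_min ltr01 d00.
have m1 : Num.min 1 d0 <= 1 by rewrite ge_min lexx.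
have m2 : Num.min 1 d0 <= d0 by rewrite ge_min lexx orbT.
have [b0 [b1 bd0]] : 0 < b /\ (b <= 1 /\ b < d0) by rewrite /b; split; [|split]; lra.
have w1 : 0 < w 1 by apply: modulus_gt0.
have [L0 hL0] := ln_sqr_small (chi_gt0 hw b0).
pose c2 : R := 2 / ln 2 + 1.
have ln2 : 0 < ln 2 :> R by apply: ln_gt0; lra.
have c20 : 0 <= c2 by rewrite addr_ge0// divr_ge0// ltW.
pose CC : R := 48 * C0 * (c2 + 6) + 6 * C0 + 25 * C0 ^+ 2.
have CC0 : 0 <= CC by rewrite !addr_ge0 ?mulr_ge0 ?exprn_ge0// addr_ge0.
exists CC, (Num.max (Num.max L0 (expR 1)) (w 1)); split => // lam.
rewrite !ge_max => /andP[/andP[/hL0[l0 lsmall] le] lw] c x mu n Y pk uY.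
have l1 : 1 <= ln lam by rewrite -[1]expRK ler_ln ?posrE ?expR_gt0.
have l1' : 1 <= lam by apply: le_trans le; rewrite -[1]expR0 ler_expR.
set l := ln lam in lsmall l1; set e := (2 ^+ n)^-1.
have e0 : 0 < e by rewrite invr_gt0 exprn_gt0.
have lpos : 0 < l by lra.
pose ds := chi_inv w (l ^+ 2 / lam).
have q0 : 0 < l ^+ 2 / lam by rewrite divr_gt0// exprn_gt0.
have ds0 : 0 < ds by exact: chi_inv_gt0.
have chids : chi w ds = l ^+ 2 / lam by apply: chi_invK => //; exact: ltW.
have dsb : ds <= b by apply: chi_inv_le => //; exact: ltW.
have wds : 0 < w ds by exact: modulus_gt0.
have ThE : Theta w 1 lam = lam * ds / l by rewrite /Theta eqxx -/l -/ds mulrAC.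
have ThW : l / w ds = Theta w 1 lam.
  have wE : w ds = l ^+ 2 / lam / ds by rewrite -chids /chi [ds * _]mulrC mulfK ?gt_eqF.
  by rewrite ThE wE; field; rewrite !gt_eqF.
have Th0 : 0 <= Theta w 1 lam by rewrite ThE !mulr_ge0 ?invr_ge0 ?ltW.
have dn0 := dl_gt0 n; have dn1 := dlle1 n; have dne := dlle n; rewrite -/e in dne.
set m := Num.min 1 _.
have m_ge0 : 0 <= m by rewrite le_min ler01 !mulr_ge0// ltW.
have eT : 0 <= e * Theta w 1 lam by rewrite mulr_ge0// ltW.
have c_ge0 k : 0 <= c k by have [h1 _ _ _] := pk; have /andP[] := h1 k.
have -> : \sum_(k <- Y) c k = \sum_(k <- Y) c k `^ 1.
  by apply: eq_bigr => k _; rewrite powRr1.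
have CCge : 25 * C0 ^+ 2 * m <= CC * m.
  by rewrite ler_wpM2r// lerDr addr_ge0 ?mulr_ge0// addr_ge0.
(* As [dl n <= e], the quantity compared with 1 is at most lam 4^-n: the small case is bounded by
   the minimum, and in the large case the minimum is 1. *)
have [small|large] := ltP (lam * e * dl n) 1.
  have := packet_small pk uY (ltW l0) (lexx 1) (_ : 1 <= 2) small.
  move=> /(_ ltac:(lra)); rewrite subrr powRr0 mulr1 -/e => h.
  have hm : lam * e * dl n <= m.
    rewrite le_min (ltW small) /= mulrA ler_wpM2l// mulr_ge0// ltW.
  apply: (le_trans h); rewrite mulrDr.
  have : 20 * C0 ^+ 2 * (lam * e * dl n) <= 25 * C0 ^+ 2 * m.
    have X1 : C0 ^+ 2 * (lam * e * dl n) <= C0 ^+ 2 * m by rewrite ler_wpM2l ?exprn_ge0.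
    have X2 : 0 <= C0 ^+ 2 * m by rewrite mulr_ge0 ?exprn_ge0.
    rewrite -!(mulrA _ (C0 ^+ 2)); lra.
  have : 0 <= CC * (e * Theta w 1 lam) by rewrite mulr_ge0.
  move: CCge; lra.
have m1e : m = 1.
  apply/eqP; rewrite eq_le ge_min lexx /= le_min lexx /=.
  by apply: le_trans large _; rewrite mulrA ler_wpM2l// mulr_ge0// ltW.
have dsinv : 1 <= ds^-1 by rewrite invf_ge1//; lra.
have [L1 /andP[hL1 hL2]] := pow2_between dsinv.
have [J0 /andP[hJ1 hJ2]] := pow2_between l1.
pose Ln := L1.+1; pose J := J0.+1; pose I := (Ln + J)%N.
(* ds is at least lam^-2, since l^2 / lam = chi(ds) <= ds w(1) and w(1) <= lam; hence only O(l)
   octaves lie between ds and 1. *)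
have LnB : Ln%:R <= c2 * l.
  have h : ds^-1 <= lam ^+ 2.
    have h2 : chi w ds <= ds * w 1.
      by rewrite /chi ler_wpM2l ?(ltW ds0)//; apply: modulus_mono => //; lra.
    rewrite chids in h2.
    have h3 : 1 <= lam * (ds * w 1).
      apply: (@le_trans _ _ (l ^+ 2)); first by rewrite exprn_ege1.
      by rewrite mulrC -ler_pdivrMr.
    rewrite -div1r ler_pdivrMr//; apply: (le_trans h3).
    by rewrite expr2 -mulrA ler_wpM2l ?(ltW l0)// [lam * ds]mulrC ler_wpM2l ?(ltW ds0).
  have h2 : L1%:R * ln 2 <= 2 * l.
    rewrite mulr_natl [leRHS]mulr_natl -!lnXn//.
    by rewrite ler_ln ?posrE ?exprn_gt0//; exact: le_trans hL1 h.
  rewrite /Ln -natr1 /c2 mulrDl mul1r; apply: lerD => //.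
  by rewrite mulrAC ler_pdivlMr.
pose rho i := ds * 2 ^+ Ln * (2 ^+ i)^-1.
have rho0 i : 0 < rho i by rewrite !mulr_gt0 ?invr_gt0 ?exprn_gt0.
pose th i := C0 * rho i.
have th0 i : 0 <= th i by rewrite mulr_ge0// ltW.
have rhoS i : rho i = 2 * rho i.+1.
  by rewrite /rho exprS; field; rewrite expf_neq0.
have thd i : th i.+1 <= th i.
  by rewrite /th ler_wpM2l// (rhoS i) ler_peMl ?(ltW (rho0 _))// ler1n.
have c0 k : 0 <= c k <= th 0%N.
  rewrite c_ge0 /=; have [h1 _ _ _] := pk; have /andP[_ c1] := h1 k.
  apply: (le_trans c1); rewrite ler_wpM2l// (le_trans dn1)// /rho expr0 invr1 mulr1.
  by rewrite mulrC -ler_pdivrMr// div1r ltW.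
have cnt i : (i < I)%N -> (count (fun k => th i.+1 < c k) Y)%:R <= (24 * e / chi w (rho i.+1) : R).
  by move=> _; exact: packet_count pk uY (rho0 i.+1).
have lc := layer_cake (@ler01 R) c0 thd th0 cnt.
have wr0 i : 0 < w (rho i) by exact: modulus_gt0.
have wrho i : (w (rho i))^-1 <= (1 + 2 ^+ i / 2 ^+ Ln) / w ds.
  have pos : 0 < 2 ^+ i / 2 ^+ Ln :> R by rewrite divr_gt0 ?exprn_gt0.
  have [iL|Li] := leqP i Ln.
    apply: (@le_trans _ _ (w ds)^-1); last by rewrite ler_peMl ?invr_ge0 ?(ltW wds)//; lra.
    rewrite lef_pV2 ?posrE//; apply: modulus_mono => //.
    by rewrite /rho -mulrA ler_peMr ?(ltW ds0)// ler_pdivlMr ?exprn_gt0// mul1r ler_weXn2l// ler1n.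
  have dbl' q : w ds <= 2 ^+ q * w (ds * (2 ^+ q)^-1).
    elim: q => [|q IH]; first by rewrite expr0 mul1r invr1 mulr1.
    apply: (le_trans IH); rewrite exprSr -mulrA ler_wpM2l ?exprn_ge0//.
    rewrite (_ : ds * (2 ^+ q)^-1 = 2 * (ds * (2 ^+ q * 2)^-1)); last first.
      by field; rewrite expf_neq0.
    apply: ltW; apply: dbl; first by rewrite mulr_gt0// invr_gt0 mulr_gt0// exprn_gt0.
    apply: le_lt_trans (le_lt_trans dsb bd0); rewrite ler_piMr ?(ltW ds0)//.
    by rewrite -exprSr invf_le1 ?exprn_gt0// exprn_ege1// ler1n.
  have := dbl' (i - Ln)%N.
  have -> : ds * (2 ^+ (i - Ln))^-1 = rho i.
    by rewrite /rho -[in RHS](subnK (ltnW Li)) exprD; field; rewrite !expf_neq0.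
  have e2 : 2 ^+ (i - Ln) = 2 ^+ i / 2 ^+ Ln :> R.
    by rewrite -[in RHS](subnK (ltnW Li)) exprD mulfK// expf_neq0.
  rewrite e2 => h.
  apply: (@le_trans _ _ (2 ^+ i / 2 ^+ Ln / w ds)).
    by rewrite -div1r ler_pdivrMr// mulrAC ler_pdivlMr// mul1r.
  by rewrite ler_wpM2r ?invr_ge0 ?(ltW wds)//; lra.
have S1 : \sum_(i < I) 24 * e / chi w (rho i.+1) * th i `^ 1 <=
    48 * C0 * e * ((I%:R + 2 * 2 ^+ J) / w ds).
  apply: (@le_trans _ _ (\sum_(i < I) 48 * C0 * e * ((1 + 2 ^+ i.+1 / 2 ^+ Ln) / w ds))).
    apply: ler_sum => i _; rewrite powRr1// /th (rhoS i) /chi.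
    rewrite (_ : 24 * e / _ * _ = 48 * C0 * e * (w (rho i.+1))^-1); last first.
      by field; rewrite !gt_eqF.
    by rewrite ler_wpM2l// !mulr_ge0// ltW.
  rewrite -mulr_sumr ler_wpM2l ?mulr_ge0 ?(ltW e0)// -mulr_suml ler_wpM2r ?invr_ge0 ?(ltW wds)//.
  rewrite big_split/= sumr_const card_ord lerD2l -mulr_suml.
  have E K : \sum_(i < K) 2 ^+ i.+1 <= 2 * 2 ^+ K :> R.
    elim: K => [|K IH]; first by rewrite big_ord0 mulr_ge0// exprn_ge0.
    by rewrite big_ord_recr/= [in leRHS]exprS; move: IH; rewrite exprS; lra.
  rewrite ler_pdivrMr ?exprn_gt0//; apply: le_trans (E I) _.
  by rewrite /I addnC exprD mulrA.
have JB : 2 ^+ J <= 2 * l by rewrite exprS ler_wpM2l.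
have IB : I%:R + 2 * 2 ^+ J <= (c2 + 6) * l.
  rewrite /I natrD.
  have : J%:R <= 2 ^+ J :> R by rewrite -natrX ler_nat ltnW// ltn_expl.
  move=> JJ; rewrite (mulrDl c2 6 l); move: LnB JB JJ; set u := c2 * l; lra.
have S2 : 48 * C0 * e * ((I%:R + 2 * 2 ^+ J) / w ds) <= 48 * C0 * (c2 + 6) * (e * Theta w 1 lam).
  rewrite -ThW (_ : 48 * C0 * (c2 + 6) * _ = 48 * C0 * e * ((c2 + 6) * l / w ds)); last by ring.
  by rewrite ler_wpM2l ?mulr_ge0 ?(ltW e0)// ler_wpM2r// invr_ge0 ltW.
have near := packet_large pk uY l0 (lexx 1) (_ : 1 <= 2) large (th0 I).
have {}near := near ltac:(lra).
rewrite subrr powRr0 mulr1 powRr1// -/e in near.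
have S3 : 6 * e * lam * th I <= 6 * C0 * (e * Theta w 1 lam).
  have -> : th I = C0 * (ds / 2 ^+ J).
    by rewrite /th /rho /I exprD; field; rewrite !expf_neq0.
  rewrite ThE (_ : 6 * e * lam * _ = 6 * C0 * (e * (lam * ds / 2 ^+ J))); last by ring.
  rewrite ler_wpM2l ?mulr_ge0// ler_wpM2l ?(ltW e0)// ler_wpM2l ?mulr_ge0 ?(ltW l0) ?(ltW ds0)//.
  by rewrite lef_pV2 ?posrE ?exprn_gt0// ltW.
rewrite m1e /CC.
have CC2 : 0 <= C0 ^+ 2 by exact: exprn_ge0.
have X1 : 0 <= 25 * C0 ^+ 2 * (e * Theta w 1 lam) by rewrite !mulr_ge0.
have X2 : 0 <= 48 * C0 * (c2 + 6) + 6 * C0 by rewrite addr_ge0 ?mulr_ge0// addr_ge0.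
move: near lc S1 S2 S3 X1 X2 CC2.
set a1 := \sum_(_ <- _) _; set a3 := \sum_(_ <- _ | _) _; set a5 := \sum_(_ < _) _.
set a6 := e * Theta _ _ _; set a7 := 48 * C0 * e * _; set a8 := 48 * C0 * (c2 + 6).
set a9 := 6 * e * _ * _.
rewrite mulrDr mulr1 !mulrDl; lra.
Qed.

End Packet.

(** * Bumps and their placement *)

Section BumpPacket.
Variables (R : realType) (dl : nat -> R).
Hypotheses (dl_gt0 : forall n, 0 < dl n) (dl2 : forall n, 2 * dl n.+1 < dl n).

Definition bump_coef (A s : R) (n : nat) (lam a c : R) (k : int) : R :=
  `|bump_osc dl A s n lam (lam * a - k%:~R) c| +
  `|bump_osc dl A s n lam (lam * a - k%:~R) (c - pi / 2)|.

(** 90 is twice 45, a coefficient being the sum of a cosine and a sine integral; the other clauses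
    need less. The frequency enters [bump_osc] as [lam * a - k], the negative of [k - x], so the two
    families of levels are interchanged. *)
Lemma bump_packet A s n lam a c : 0 <= A -> A <= (2 ^+ n)^-1 ->
  packet dl 90 (bump_coef A s n lam a c) (lam * a) `|lam| (lam * A) n.
Proof.
move=> A0 An; have dn0 := dl_gt0 n.
have lA : `|lam| * A <= `|lam| * (2 ^+ n)^-1 by rewrite ler_wpM2l.
split.
- move=> k; rewrite addr_ge0//=.
  have h1 : `|bump_osc dl A s n lam (lam * a - k%:~R) c| <= 8 * dl n by exact: bump_osc_trivial.
  have h2 : `|bump_osc dl A s n lam (lam * a - k%:~R) (c - pi / 2)| <= 8 * dl n by exact: bump_osc_trivial.
  rewrite /bump_coef; lra.
- move=> k; rewrite /bump_coef.
  have h1 : `|bump_osc dl A s n lam (lam * a - k%:~R) c| <= 16 * (`|lam| * A * dl n ^+ 2) by exact: bump_osc_small.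
  have h2 : `|bump_osc dl A s n lam (lam * a - k%:~R) (c - pi / 2)| <= 16 * (`|lam| * A * dl n ^+ 2) by exact: bump_osc_small.
  have h3 : `|lam| * A * dl n ^+ 2 <= `|lam| * (2 ^+ n)^-1 * dl n ^+ 2.
    by rewrite ler_wpM2r ?exprn_ge0// ltW.
  have h4 : 0 <= `|lam| * A * dl n ^+ 2 by rewrite !mulr_ge0 ?exprn_ge0// ltW.
  move: h1 h2 h3 h4; set u := _ * dl n ^+ 2; set v := _ * dl n ^+ 2; lra.
- move=> k j rho rho0 jr lev.
  have lev' i : (i <= 2 ^ j)%N ->
      rho^-1 < `|lam * a - k%:~R + lam * A * (i%:R / 2 ^+ j)| /\
      rho^-1 < `|lam * a - k%:~R - lam * A * (i%:R / 2 ^+ j)|.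
    move=> /lev[h1 h2]; split.
      by rewrite -normrN; congr (_ < `|_|): h2; ring.
    by rewrite -normrN; congr (_ < `|_|): h1; ring.
  have h1 : `|bump_osc dl A s n lam (lam * a - k%:~R) c| <= 45 * rho.
    by exact: bump_osc_level jr lev'.
  have h2 : `|bump_osc dl A s n lam (lam * a - k%:~R) (c - pi / 2)| <= 45 * rho.
    by exact: bump_osc_level jr lev'.
  rewrite /bump_coef; lra.
- move=> k k0 kl; rewrite distrC in k0 kl.
  have kl' : 2 * (`|lam| * A) <= `|lam * a - k%:~R| by lra.
  have h1 : `|bump_osc dl A s n lam (lam * a - k%:~R) c| <=
      32 * (`|lam| * A / (lam * a - k%:~R) ^+ 2).
    by exact: bump_osc_far.
  have h2 : `|bump_osc dl A s n lam (lam * a - k%:~R) (c - pi / 2)| <=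
      32 * (`|lam| * A / (lam * a - k%:~R) ^+ 2).
    by exact: bump_osc_far.
  have h3 : `|lam| * A / (lam * a - k%:~R) ^+ 2 <= `|lam| * (2 ^+ n)^-1 / (lam * a - k%:~R) ^+ 2.
    by rewrite ler_wpM2r// invr_ge0 sqr_ge0.
  have h4 : 0 <= `|lam| * A / (lam * a - k%:~R) ^+ 2.
    by rewrite !mulr_ge0// invr_ge0 sqr_ge0.
  have -> : (k%:~R - lam * a) ^+ 2 = (lam * a - k%:~R) ^+ 2 by ring.
  rewrite /bump_coef; move: h1 h2 h3 h4; set u := _ / _; set v := _ / _; lra.
Qed.

Lemma gappyD (f g : R -> R) : gappy f -> gappy g -> gappy (fun x => f x + g x).
Proof.
move=> gf gg u v uv; have [u' [v' [h1 h2 h3 h4]]] := gf u v uv.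
have [u'' [v'' [h5 h6 h7 h8]]] := gg u' v' h2.
exists u'', v''; split; try lra.
by move=> x y hx hy; rewrite (h4 x y) ?(h8 x y)//; lra.
Qed.

Lemma gappyZ (f : R -> R) a : gappy f -> gappy (fun x => a * f x).
Proof.
move=> gf u v uv; have [u' [v' [h1 h2 h3 h4]]] := gf u v uv.
by exists u', v'; split => // x y hx hy; rewrite (h4 x y).
Qed.

Lemma gappy_shift (f : R -> R) a : gappy f -> gappy (fun x => f (x - a)).
Proof.
move=> gf u v uv; have uv' : u - a < v - a by lra.
have [u' [v' [h1 h2 h3 h4]]] := gf _ _ uv'.
exists (u' + a), (v' + a); split; try lra.
by move=> x y hx hy; apply: h4; lra.
Qed.

Lemma gappy_bump' A s n : gappy (bump' dl A s n).
Proof.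
have gK := ladder_gappy dl_gt0 dl2 n.
have gs a : gappy (fun x => ladder dl n (x - s - a)).
  have -> : (fun x => ladder dl n (x - s - a)) = (fun x => ladder dl n (x - (s + a))).
    by apply/funext => x; rewrite opprD addrA.
  exact: gappy_shift.
have h := gappyZ A (gappyD (gappyD (gappyD (gappy_shift s gK) (gappyZ (-1) (gs (dl n))))
  (gappyZ (-1) (gs (2 * dl n)))) (gs (3 * dl n))).
suff -> : bump' dl A s n = (fun x => A *
    (ladder dl n (x - s) + -1 * ladder dl n (x - s - dl n) +
     -1 * ladder dl n (x - s - 2 * dl n) + ladder dl n (x - s - 3 * dl n))) by exact: h.
by apply/funext => x; rewrite /bump' !mulN1r.
Qed.

Lemma gappy_sum (f : nat -> R -> R) J : (forall j, gappy (f j)) ->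
  gappy (fun x => \sum_(i < J) f i x).
Proof.
move=> gf; elim: J => [|J IH].
  move=> u v uv; exists (u + (v - u) / 3), (u + (v - u) / 2); split; try lra.
  by move=> x y _ _; rewrite !big_ord0.
have -> : (fun x => \sum_(i < J.+1) f i x) = (fun x => \sum_(i < J) f i x + f J x).
  by apply/funext => x; rewrite big_ord_recr.
exact: gappyD.
Qed.

(** The factor [2 ^- n] keeps the slope within the modulus at scale [n]; the factor [8 ^- j.+1]
    makes moduli and tails summable over [j]. *)
Definition amplitude (j n : nat) : R := (8 ^+ j.+1)^-1 * (2 ^+ n)^-1.

Lemma amplitude_gt0 j n : 0 < amplitude j n.
Proof. by rewrite mulr_gt0// invr_gt0 exprn_gt0. Qed.

Definition list_sum' (l : seq (R * nat)) (x : R) : R :=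
  \sum_(i < size l) bump' dl (amplitude i (nth (0, 0%N) l i).2)
     (nth (0, 0%N) l i).1 (nth (0, 0%N) l i).2 x.

(* The [j]-th target interval in an enumeration of the rational subintervals of [0, 2 pi]. *)
Definition target (j : nat) : R * R :=
  if unpickle j is Some (q1, q2) then
    let u := ratr q1 : R in let v := ratr q2 : R in
    if [&& 0 < u, u < v & v < 2 * pi] then (u, v) else (1, 2)
  else (1, 2).

Lemma target_bound j : [/\ 0 < (target j).1, (target j).1 < (target j).2 &
  (target j).2 < 2 * pi].
Proof.
have p2 : 2 <= pi :> R by exact: pi_ge2.
rewrite /target; case: unpickle => [[q1 q2]|/=]; last by split; lra.
by case: ifPn => [/and3P[]|_]//=; split; lra.
Qed.

Lemma target_dense u v : 0 <= u -> u < v -> v <= 2 * pi ->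
  exists j, u < (target j).1 /\ (target j).2 < v.
Proof.
move=> u0 uv v2; have [q1] := rat_in_itvoo uv; rewrite in_itv/= => /andP[h1 h2].
have [q2] := rat_in_itvoo h2; rewrite in_itv/= => /andP[h3 h4].
exists (pickle (q1, q2)); rewrite /target pickleK.
by have -> : [&& 0 < ratr q1 :> R, ratr q1 < ratr q2 :> R & ratr q2 < 2 * pi :> R];
  [apply/and3P; split; lra|].
Qed.

(** The greedy choice of the bump of index [size l]: it depends on all earlier bumps through the
    last clause, which makes the earlier phase affine on the new support. *)
Definition next_ok (l : seq (R * nat)) (sn : R * nat) : Prop :=
  let j := size l in let s := sn.1 in let n := sn.2 in
  [/\ (target j).1 < s, s + 4 * dl n < (target j).2, (j.*2 <= n)%N,
      all (fun p => p.2 <= n)%N l &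
      forall x y, s <= x <= s + 4 * dl n -> s <= y <= s + 4 * dl n ->
        list_sum' l x = list_sum' l y].

(** A finite sum of bumps is gappy, so the target contains a flat interval; the scale is then taken
    so fine that the support fits into it. *)
Lemma next_exists l : exists sn, next_ok l sn.
Proof.
have [_ uv _] := target_bound (size l).
have gl : gappy (list_sum' l).
  by apply: (@gappy_sum (fun i => bump' dl (amplitude i (nth (0, 0%N) l i).2)
     (nth (0, 0%N) l i).1 (nth (0, 0%N) l i).2)) => j; exact: gappy_bump'.
have [u' [v' [h1 h2 h3 h4]]] := gl _ _ uv.
pose n0 := maxn (size l).*2 (\max_(p <- l) p.2).
have v0 : 0 < v' - u' by lra.
have [N hN] := pow2_small (4 * dl n0) v0.
pose n := (n0 + N)%N.
have dn : 4 * dl n < v' - u'.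
  apply: le_lt_trans hN; rewrite -mulrA ler_pM2l// mulrC; exact: dl_pow.
have dn0 := dl_gt0 n.
exists (u', n); split => /=.
- exact: h1.
- by lra.
- by rewrite /n /n0 (leq_trans _ (leq_addr _ _))// leq_maxl.
- apply/allP => p pl; rewrite /n (leq_trans _ (leq_addr _ _))// /n0 leq_max.
  by apply/orP; right; exact: leq_bigmax_seq.
- by move=> x y hx hy; apply: h4; lra.
Qed.

Lemma placement : exists (s : nat -> R) (n : nat -> nat),
  [/\ forall j, 0 < s j /\ s j + 4 * dl (n j) < 2 * pi,
      forall j, (j.*2 <= n j)%N,
      forall i j, (i <= j)%N -> (n i <= n j)%N,
      forall j x y, s j <= x <= s j + 4 * dl (n j) -> s j <= y <= s j + 4 * dl (n j) ->
        \sum_(i < j) bump' dl (amplitude i (n i)) (s i) (n i) x =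
        \sum_(i < j) bump' dl (amplitude i (n i)) (s i) (n i) y &
      forall u v, 0 <= u -> u < v -> v <= 2 * pi ->
        exists j, u < s j /\ s j + 4 * dl (n j) < v].
Proof.
have [f hf] := choice next_exists.
(* The list of the first [j] choices, so that each choice sees the whole history. *)
pose L := fix L j := if j is j'.+1 then rcons (L j') (f (L j')) else [::].
have szL j : size (L j) = j by elim: j => [//|j IH] /=; rewrite size_rcons IH.
have nthL j i : (i < j)%N -> nth (0, 0%N) (L j) i = f (L i).
  elim: j => [//|j IH] /=; rewrite ltnS nth_rcons szL leq_eqVlt => /predU1P[->|ij].
    by rewrite ltnn eqxx.
  by rewrite ij IH.
have sumL j x : list_sum' (L j) x =
    \sum_(i < j) bump' dl (amplitude i (f (L i)).2) (f (L i)).1 (f (L i)).2 x.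
  by rewrite /list_sum' szL; apply: eq_bigr => i _; rewrite nthL.
exists (fun j => (f (L j)).1), (fun j => (f (L j)).2); split.
- move=> j; have [h1 h2 _ _ _] := hf (L j); have [h3 _ h4] := target_bound (size (L j)).
  by split; lra.
- by move=> j; have [_ _ + _ _] := hf (L j); rewrite szL.
- move=> i j; rewrite leq_eqVlt => /predU1P[->//|ij].
  have [_ _ _ /allP h _] := hf (L j); apply: h.
  by rewrite -(nthL j i ij) mem_nth// szL.
- by move=> j x y hx hy; have [_ _ _ _ h] := hf (L j); rewrite -!sumL; apply: h.
- move=> u v u0 uv v2; have [j [h1 h2]] := target_dense u0 uv v2.
  have [h3 h4 _ _ _] := hf (L j); rewrite szL in h3 h4.
  by exists j; split; lra.
Qed.

End BumpPacket.

(** * Series with geometric tails and derivatives of limits *)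

Section Limits.
Variable R : realType.
Implicit Types (u : nat -> R) (M : R).

(** The subtracted multiple of [2 ^- K] is the room that the induction consumes. *)
Lemma geometric_partial u M J K : (forall i, `|u (J + i)%N| <= M * (2 ^+ i)^-1) ->
  `|\sum_(i < J + K) u i - \sum_(i < J) u i| <= 2 * M - 2 * M * (2 ^+ K)^-1.
Proof.
move=> h; elim: K => [|K IH].
  by rewrite addn0 subrr normr0 expr0 invr1 mulr1 subrr.
rewrite addnS big_ord_recr/= addrAC.
apply: le_trans (ler_normD _ _) _; rewrite exprS invfM.
have := h K; move: IH; set a := (2 ^+ K)^-1; lra.
Qed.

Lemma geometric_limit u M : (forall i, `|u i| <= M * (2 ^+ i)^-1) ->
  exists l : R, (fun J => \sum_(i < J) u i) @ \oo --> l.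
Proof.
move=> h; apply/cvg_ex.
have -> : (fun J => \sum_(i < J) u i) = series u.
  by apply/funext => J; rewrite /series/= big_mkord.
apply: normed_cvg; apply: (@series_le_cvg _ _ (geometric M 2^-1)) => //.
- by move=> i; rewrite /=.
- by move=> i; rewrite /geometric/= exprVn; apply: le_trans (h i).
- by move=> i; rewrite /geometric/= exprVn; exact: h.
- by apply: is_cvg_geometric_series; rewrite ger0_norm// invf_lt1// ltr1n.
Qed.

Lemma geometric_tail u M J l : (fun J => \sum_(i < J) u i) @ \oo --> l ->
  0 <= M -> (forall i, `|u (J + i)%N| <= M * (2 ^+ i)^-1) ->
  `|l - \sum_(i < J) u i| <= 2 * M.
Proof.
move=> ul M0 h.
have c : (fun K => `|\sum_(i < K + J) u i - \sum_(i < J) u i|) @ \oo --> `|l - \sum_(i < J) u i|.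
  apply: cvg_norm; apply: cvgB; last exact: cvg_cst.
  by rewrite (cvg_shiftn J (fun K => \sum_(i < K) u i)).
rewrite -(cvg_lim _ c)//; apply: limr_le; first by apply/cvg_ex; exists (`|l - \sum_(i < J) u i|).
near=> K; rewrite addnC; apply: le_trans (geometric_partial K h) _.
by rewrite lerBlDr lerDl !mulr_ge0// invr_ge0 exprn_ge0.
Unshelve. all: by end_near. Qed.

Lemma mvt_bound (F f : R -> R) (x h e : R) : (forall y : R, is_derive y 1 F (f y)) ->
  (forall y, `|y - x| <= `|h| -> `|f y - f x| <= e) ->
  `|F (x + h) - F x - h * f x| <= `|h| * e.
Proof.
move=> dF fe.
have dG (y : R) : is_derive y 1 (fun y => F y - f x * y) (f y - f x).
  have h1 := dF y; have h2 := is_deriveB h1 (is_deriveZ (f x) (is_derive_id y 1)).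
  by rewrite [X in is_derive _ _ _ X](_ : _ = f y - f x *: 1) // /GRing.scale/= mulr1.
have cG := is_derive_continuous dG.
have -> : F (x + h) - F x - h * f x = (F (x + h) - f x * (x + h)) - (F x - f x * x) by ring.
have [h0|h0] := leP 0 h.
  have xh : x <= x + h by rewrite lerDl.
  have [|y] := @MVT_segment R (fun y => F y - f x * y) (fun y => f y - f x) x (x + h) xh (fun y _ => dG y).
    exact: continuous_subspaceT.
  rewrite in_itv/= => yI ->; rewrite normrM mulrC addrC addKr ler_wpM2l//.
  by apply: fe; rewrite !ger0_norm//; lra.
have xh : x + h <= x by lra.
have [|y] := @MVT_segment R (fun y => F y - f x * y) (fun y => f y - f x) (x + h) x xh (fun y _ => dG y).
  exact: continuous_subspaceT.
rewrite distrC in_itv/= => yI ->; rewrite normrM mulrC opprD addrA subrr sub0r normrN ler_wpM2l//.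
by apply: fe; rewrite (ltr0_norm h0) ler0_norm//; lra.
Qed.

(** Equicontinuity of the derivatives, uniform in [J], bounds the error of the linear approximation
    of every [FJ J] at once; the bound survives the pointwise limit. *)
Lemma is_derive_limit (FJ fJ : nat -> R -> R) (F f : R -> R) :
  (forall J (x : R), is_derive x 1 (FJ J) (fJ J x)) ->
  (forall x, FJ ^~ x @ \oo --> F x) -> (forall x, fJ ^~ x @ \oo --> f x) ->
  (forall e, 0 < e -> exists2 eta, 0 < eta & forall J x y, `|y - x| <= eta ->
     `|fJ J y - fJ J x| <= e) ->
  forall x : R, is_derive x 1 F (f x).
Proof.
move=> dF cF cf eq x.
have key e : 0 < e -> exists2 eta, 0 < eta & forall h, `|h| <= eta ->
    `|F (x + h) - F x - h * f x| <= `|h| * e.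
  move=> /eq[eta eta0 he]; exists eta => // h hh.
  have c : (fun J => `|FJ J (x + h) - FJ J x - h * fJ J x|) @ \oo -->
      `|F (x + h) - F x - h * f x|.
    apply: cvg_norm; apply: cvgB; first by apply: cvgB; exact: cF.
    by apply: cvgM; [exact: cvg_cst|exact: cf].
  rewrite -(cvg_lim _ c)//; apply: limr_le; first by apply/cvg_ex; exists (`|F (x + h) - F x - h * f x|).
  near=> J; apply: mvt_bound => // y yh; apply: he; exact: le_trans hh.
have cv : (fun h : R => h^-1 *: (F (h *: 1 + x) - F x)) @ 0^' --> f x.
  apply/cvgrPdist_le => e e0; have [eta eta0 he] := key e e0.
  near=> h.
  have h0 : h != 0 by near: h; exact: nbhs_dnbhs_neq.
  have hh : `|h| <= eta.
    near: h; apply/nbhs_dnbhs; exists eta => //= y /=; rewrite sub0r normrN; exact: ltW.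
  have := he h hh; rewrite /GRing.scale/= mulr1 [h + x]addrC.
  have hp : 0 < `|h| by rewrite normr_gt0.
  rewrite -(ler_pM2l hp (`|f x - _|)) -normrM.
  rewrite distrC (_ : h * (f x - h^-1 * (F (x + h) - F x)) = h * f x - (F (x + h) - F x))//.
  by rewrite mulrBr mulrA divff// mul1r.
split; first by apply/cvg_ex; exists (f x).
exact: cvg_lim cv.
Unshelve. all: by end_near. Qed.

End Limits.

(** * The one-dimensional function *)

Section Periods.
Variable R : realType.

Lemma sin_add2pi (x : R) : sin (x + 2 * pi) = sin x.
Proof. by rewrite mulr_natl mulr2n addrA !sinDpi opprK. Qed.

Lemma sin_add2piz (x : R) (z : int) : sin (x + 2 * pi * z%:~R) = sin x.
Proof.
have h (n : nat) y : sin (y + 2 * pi * n%:R) = sin y :> R.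
  elim: n y => [|n IH] y; first by rewrite mulr0 addr0.
  by rewrite -[n.+1%:R]natr1 mulrDr [_ * 1]mulr1 addrA sin_add2pi IH.
case: z => n; first exact: h.
rewrite -[LHS](h n.+1) -addrA NegzE mulrNz mulrN addNr addr0//.
Qed.

Lemma sin_cos_shift (x : R) : sin x = cos (x - pi / 2).
Proof. by rewrite cosB cos_pihalf sin_pihalf mulr0 add0r mulr1. Qed.

Lemma flat_coefficient (k : int) (c : R) :
  `|intg 0 (2 * pi) (fun t => cos (- (k%:~R * t) + c))| <= 8 * (k == 0)%:R.
Proof.
have p0 := pi_gt0 R; have p4 : pi < 4 :> R by have := pihalf_lt2 R; lra.
have d (x : R) : is_derive x 1 (fun t => - (k%:~R * t) + c) (- k%:~R).
  have h := is_deriveD (is_deriveN (is_deriveZ (k%:~R : R) (is_derive_id x 1))) (is_derive_cst c x 1).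
  by rewrite [X in is_derive _ _ _ X](_ : _ = - (k%:~R *: 1) + 0) // /GRing.scale/= mulr1 addr0.
have cc := cos_comp_continuous (is_derive_continuous d).
have pp : (0 : R) <= 2 * pi by lra.
have [k0|k0] := eqVneq k 0.
  apply: (@le_trans _ _ (1 * (2 * pi - 0))); last by rewrite mulr1; lra.
  by apply: intg_bound => // x _; rewrite ler_norml cos_geN1 cos_le1.
have kR : k%:~R != 0 :> R by rewrite intr_eq0.
have dS (x : R) : is_derive x 1 (fun t => (- k%:~R)^-1 * sin (- (k%:~R * t) + c))
    (cos (- (k%:~R * x) + c)).
  have h := is_deriveZ (- k%:~R : R)^-1 (is_derive_sin_comp (d x)).
  suff -> : cos (- (k%:~R * x) + c) = (- k%:~R)^-1 *: (cos (- (k%:~R * x) + c) * - k%:~R).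
    exact: h.
  by rewrite /GRing.scale/= mulrCA mulVf ?mulr1// oppr_eq0.
rewrite (intg_FTC cc dS pp) -mulrBr mulr0 oppr0 add0r.
have -> : - (k%:~R * (2 * pi)) + c = c + 2 * pi * (- k)%:~R.
  by rewrite mulrNz; ring.
by rewrite sin_add2piz subrr mulr0 normr0 mulr0.
Qed.

End Periods.

(** * The limit of the bump series on one period *)

Section Core.
Variables (R : realType) (w : R -> R).
Hypothesis hw : modulus_hyp w.
Variables (dl : nat -> R) (ka : R).
Hypotheses (ka0 : 0 < ka <= 1)
  (dl_gt0 : forall n, 0 < dl n) (dl2 : forall n, 2 * dl n.+1 < dl n)
  (wdl : forall n, w (dl n) = ka * (2 ^+ n)^-1) (dl01 : dl 0%N <= 1).
Variables (s : nat -> R) (n : nat -> nat).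
Hypotheses (s_in : forall j, 0 < s j /\ s j + 4 * dl (n j) < 2 * pi)
  (n_ge : forall j, (j.*2 <= n j)%N) (n_mono : forall i j, (i <= j)%N -> (n i <= n j)%N).

Let A j := amplitude R j (n j).
Let b j : R -> R := bump' dl (A j) (s j) (n j).
Let B j : R -> R := bump dl (A j) (s j) (n j).
Let Psi J (x : R) : R := \sum_(i < J) b i x.
Let Phi J (x : R) : R := \sum_(i < J) B i x.

Hypothesis psi_flat : forall j x y, s j <= x <= s j + 4 * dl (n j) ->
  s j <= y <= s j + 4 * dl (n j) -> Psi j x = Psi j y.
Hypothesis s_dense : forall u v, 0 <= u -> u < v -> v <= 2 * pi ->
  exists j, u < s j /\ s j + 4 * dl (n j) < v.

Let A0 j : 0 <= A j. Proof. exact/ltW/amplitude_gt0. Qed.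

Let p2 i : 0 < (2 ^+ i)^-1 :> R. Proof. by rewrite invr_gt0 exprn_gt0. Qed.
Let p8 i : 0 < (8 ^+ i)^-1 :> R. Proof. by rewrite invr_gt0 exprn_gt0. Qed.
Let p2' i : (2 ^+ i)^-1 <= 1 :> R.
Proof. by rewrite invf_le1 ?exprn_gt0// exprn_ege1// ler1n. Qed.
Let p82 i : (8 ^+ i)^-1 <= (2 ^+ i)^-1 :> R.
Proof. by rewrite lef_pV2 ?posrE ?exprn_gt0// lerXn2r ?nnegrE// ler_nat. Qed.

Let A_tail J i : A (J + i)%N <= A J * (8 ^+ i)^-1.
Proof.
have h : (2 ^+ n (J + i)%N)^-1 <= (2 ^+ n J)^-1 :> R.
  by rewrite lef_pV2 ?posrE ?exprn_gt0// ler_weXn2l ?ler1n// n_mono// leq_addr.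
rewrite /A /amplitude -addSn exprD invfM.
move: h (p8 J.+1) (p8 i); set u := (2 ^+ _)^-1; set v := (2 ^+ _)^-1.
set q := (8 ^+ _)^-1; set r := (8 ^+ _)^-1 => h q0 r0.
by rewrite [leRHS]mulrAC ler_wpM2l// mulr_ge0// ltW.
Qed.

Let A_le2 J i : A (J + i)%N <= A J * (2 ^+ i)^-1.
Proof. by apply: le_trans (A_tail J i) _; rewrite ler_wpM2l. Qed.

Let A_le8 J : A J <= (8 ^+ J.+1)^-1.
Proof. by rewrite /A /amplitude ler_piMr// ltW. Qed.

Let dl_le1 j : dl j <= 1.
Proof. by apply: le_trans dl01; have := dl_decr dl_gt0 dl2 0 j. Qed.

Let B_tail J i x : `|B (J + i)%N x| <= (2 ^+ J)^-1 * (2 ^+ i)^-1.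
Proof.
apply: le_trans (bump_bound dl_gt0 dl2 _ _ (A0 _) x) _.
apply: (@le_trans _ _ (4 * A (J + i)%N * 1)).
  by rewrite ler_wpM2l// mulr_ge0.
rewrite mulr1 -invfM -exprD; apply: le_trans (p82 _).
have := A_le8 (J + i); rewrite exprS invfM.
have := p8 (J + i); set u := (8 ^+ _)^-1; lra.
Qed.

Let b_bound j x : `|b j x| <= A j. Proof. exact: bump'_bound. Qed.

Lemma core_limits : exists phi psi : R -> R,
  (forall x, Phi ^~ x @ \oo --> phi x) /\ (forall x, Psi ^~ x @ \oo --> psi x).
Proof.
have h1 x : exists l : R, Phi ^~ x @ \oo --> l.
  by apply: (@geometric_limit R (fun i => B i x) 1) => i; have := B_tail 0 i x; rewrite add0n expr0 invr1.
have h2 x : exists l : R, Psi ^~ x @ \oo --> l.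
  apply: (@geometric_limit R (fun i => b i x) (A 0)) => i.
  by apply: le_trans (b_bound i x) _; have := A_le2 0 i; rewrite add0n.
by have [phi hphi] := choice h1; have [psi hpsi] := choice h2; exists phi, psi.
Qed.

Variables phi psi : R -> R.
Hypotheses (phiP : forall x, Phi ^~ x @ \oo --> phi x)
  (psiP : forall x, Psi ^~ x @ \oo --> psi x).

Lemma core_phi_tail J x : `|phi x - Phi J x| <= 2 * (2 ^+ J)^-1.
Proof.
have h := @geometric_tail R (fun i => B i x) ((2 ^+ J)^-1) J (phi x) (@phiP x) (ltW (p2 J))
  (fun i => B_tail J i x).
exact h.
Qed.

Lemma core_psi_tail J x : `|psi x - Psi J x| <= 2 * A J.
Proof.
suff h i : `|b (J + i)%N x| <= A J * (2 ^+ i)^-1.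
  have h' := @geometric_tail R (fun i => b i x) (A J) J (psi x) (@psiP x) (A0 J) h.
  exact h'.
by apply: le_trans (b_bound _ x) _; exact: A_le2.
Qed.

(** The bound does not depend on the scale [n j]. At distances coarser than that scale twice the
    height suffices; at finer ones each of the four ladders moves by at most 2 2^-(N - n j), and the
    resulting 8 is cancelled by the height. *)
Let b_modulus j N x y : `|y - x| <= dl N -> `|b j y - b j x| <= (8 ^+ j)^-1 * (2 ^+ N)^-1.
Proof.
move=> xy; have [Nj|jN] := ltnP N (n j).
  apply: le_trans (ler_normB _ _) _.
  apply: (@le_trans _ _ (2 * A j)); first by have := b_bound j x; have := b_bound j y; lra.
  have h : (2 ^+ n j)^-1 <= (2 ^+ N)^-1 :> R.
    by rewrite lef_pV2 ?posrE ?exprn_gt0// ler_weXn2l ?ler1n// ltnW.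
  apply: le_trans (_ : (8 ^+ j)^-1 * (2 ^+ n j)^-1 <= _); last by rewrite ler_wpM2l// ltW.
  rewrite /A /amplitude mulrA exprS invfM ler_wpM2r ?(ltW (p2 _))//.
  by have := p8 j; set u := (8 ^+ _)^-1; lra.
have dN : N = (n j + (N - n j))%N by rewrite subnKC.
rewrite dN in xy.
have e (a : R) : `|ladder dl (n j) (y - a) - ladder dl (n j) (x - a)| <= 2 * (2 ^+ (N - n j))^-1.
  apply: ladder_dist => //.
  by rewrite (_ : y - a - (x - a) = y - x)//; ring.
have e' a : `|ladder dl (n j) (y - s j - a) - ladder dl (n j) (x - s j - a)| <= 2 * (2 ^+ (N - n j))^-1.
  by rewrite -!addrA -!opprD; exact: e.
have h0 := e (s j); have h1 := e' (dl (n j)); have h2 := e' (2 * dl (n j)).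
have h3 := e' (3 * dl (n j)).
rewrite /b /bump' -mulrBr normrM (ger0_norm (A0 j)).
apply: (@le_trans _ _ (A j * (8 * (2 ^+ (N - n j))^-1))).
  rewrite ler_wpM2l//.
  move: h0 h1 h2 h3; set u := (2 ^+ _)^-1.
  by rewrite !ler_norml; lra.
rewrite {2}dN exprD invfM /A /amplitude exprS invfM le_eqVlt; apply/orP; left; apply/eqP.
by field; rewrite !expf_neq0.
Qed.

(** With dl(N+1) <= |y - x| <= dl(N), the moduli of the bumps sum to at most 2 2^-N, which is
    exactly (4 / ka) w(dl(N+1)). *)
Lemma core_modulus J x y : `|y - x| <= dl 0%N -> `|Psi J y - Psi J x| <= 4 / ka * w `|y - x|.
Proof.
move=> xy; have /andP[k0 k1] := ka0.
have [->|ne] := eqVneq y x.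
  rewrite !subrr normr0; apply: mulr_ge0; first exact: divr_ge0 (ltW k0).
  exact: modulus_ge0.
have h0 : 0 < `|y - x| by rewrite normr_gt0 subr_eq0.
have [N [hN hN']] : exists N, `|y - x| <= dl N /\ dl N.+1 <= `|y - x|.
  move: xy; rewrite le_eqVlt => /predU1P[->|xy].
    by exists 0%N; split => //; have := dl2 0; have := dl_gt0 1; lra.
  have [j] := dl_index dl2 h0 xy; rewrite add0n => /andP[h1 h2].
  by exists j; split => //; exact: ltW.
apply: (@le_trans _ _ (2 * (2 ^+ N)^-1)).
  rewrite /Psi -sumrB.
  apply: (@le_trans _ _ (\sum_(i < J) (8 ^+ i)^-1 * (2 ^+ N)^-1)).
    apply: le_trans (ler_norm_sum _ _ _) _; apply: ler_sum => i _; exact: b_modulus.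
  rewrite -mulr_suml ler_wpM2r ?(ltW (p2 _))//.
  apply: (@le_trans _ _ (\sum_(i < J) (2 ^+ i)^-1)); first by apply: ler_sum => i _.
  have E K : \sum_(i < K) (2 ^+ i)^-1 = 2 - 2 * (2 ^+ K)^-1 :> R.
    elim: K => [|K IHK]; first by rewrite big_ord0 expr0 invr1 mulr1 subrr.
    rewrite big_ord_recr/= IHK exprS invfM; set u := (2 ^+ K)^-1; lra.
  by rewrite E lerBlDr lerDl mulr_ge0// ltW.
have : w (dl N.+1) <= w `|y - x| by apply: modulus_mono => //; exact: ltW.
rewrite wdl exprS invfM => h.
apply: (@le_trans _ _ (4 / ka * (ka * (2^-1 * (2 ^+ N)^-1)))); last first.
  by rewrite ler_wpM2l// divr_ge0// ltW.
by rewrite le_eqVlt; apply/orP; left; apply/eqP; field; rewrite expf_neq0// gt_eqF.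
Qed.

Lemma core_psi_modulus x y : `|y - x| <= dl 0%N -> `|psi y - psi x| <= 4 / ka * w `|y - x|.
Proof.
move=> xy.
have c : (fun J => `|Psi J y - Psi J x|) @ \oo --> `|psi y - psi x|.
  by apply: cvg_norm; apply: cvgB; exact: psiP.
rewrite -(cvg_lim _ c)//; apply: limr_le; first by apply/cvg_ex; exists `|psi y - psi x|.
by near=> J; exact: core_modulus.
Unshelve. all: by end_near. Qed.

Let is_derive_Phi J (x : R) : is_derive x 1 (Phi J) (Psi J x).
Proof.
elim: J => [|J IH].
  rewrite /Psi big_ord0 (_ : Phi 0 = fun=> 0); first exact: is_derive_cst.
  by apply/funext => y; rewrite /Phi big_ord0.
rewrite /Psi big_ord_recr/= (_ : Phi J.+1 = fun y => Phi J y + B J y).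
  have h := is_derive_bump dl_gt0 dl2 (A J) (s J) (n J) x.
  exact: is_deriveD IH h.
by apply/funext => y; rewrite /Phi big_ord_recr.
Qed.

Lemma core_derive (x : R) : is_derive x 1 phi (psi x).
Proof.
apply: (is_derive_limit is_derive_Phi phiP psiP) => e e0.
have /andP[k0 k1] := ka0.
have [N hN] := pow2_small 4 e0.
exists (dl N) => // J y z yz.
have dN0 : dl N <= dl 0%N by have := dl_decr dl_gt0 dl2 0 N.
apply: le_trans (core_modulus J (le_trans yz dN0)) _; apply: le_trans (ltW hN).
have : w `|z - y| <= w (dl N) by apply: modulus_mono.
rewrite wdl => h; apply: (@le_trans _ _ (4 / ka * (ka * (2 ^+ N)^-1))).
  by rewrite ler_wpM2l// divr_ge0// ltW.
by rewrite le_eqVlt; apply/orP; left; apply/eqP; field; rewrite expf_neq0// gt_eqF.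
Qed.

Lemma core_out (x : R) : x <= 0 \/ 2 * pi <= x -> phi x = 0 /\ psi x = 0.
Proof.
move=> hx.
have hj j : x <= s j \/ s j + 4 * dl (n j) <= x.
  by have [h1 h2] := s_in j; case: hx => h; [left|right]; lra.
have e1 : Phi ^~ x = fun=> 0.
  by apply/funext => J; rewrite /Phi big1// => i _; exact: bump_out.
have e2 : Psi ^~ x = fun=> 0.
  by apply/funext => J; rewrite /Psi big1// => i _; exact: bump'_out.
have c1 := @phiP x; have c2 := @psiP x; rewrite e1 in c1; rewrite e2 in c2; split.
  by rewrite -(cvg_lim _ c1)//; apply: cvg_lim => //; exact: cvg_cst.
by rewrite -(cvg_lim _ c2)//; apply: cvg_lim => //; exact: cvg_cst.
Qed.

(** From the foot [s j] to the top of the first ladder, [Psi j] is constant and bump [j] rises by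
    [A j], while the later bumps change each of the two values by at most 2 A(j+1) <= A(j) / 4. *)
Lemma core_nonconstant u v : 0 <= u -> u < v -> v <= 2 * pi ->
  exists x y, [/\ u < x < v, u < y < v & psi x != psi y].
Proof.
move=> u0 uv v2; have [j [h1 h2]] := s_dense u0 uv v2.
have d0 := dl_gt0 (n j).
exists (s j), (s j + dl (n j)); split; try lra.
apply/negP => /eqP e.
have t1 := core_psi_tail j.+1 (s j); have t2 := core_psi_tail j.+1 (s j + dl (n j)).
have hA : A j.+1 <= A j * 8^-1 by have := A_tail j 1; rewrite addn1 expr1.
have Ap : 0 < A j by exact: amplitude_gt0.
have P1 : Psi j.+1 (s j) = Psi j (s j).
  by rewrite /Psi big_ord_recr/= [b j _]bump'_out ?addr0//; left.
have P2 : Psi j.+1 (s j + dl (n j)) = Psi j (s j) + A j.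
  rewrite /Psi big_ord_recr/= [b j _]bump'_top//; congr (_ + _).
  by apply: (@psi_flat j); lra.
move: t1 t2; rewrite e P1 P2 !ler_norml; lra.
Qed.

Lemma core_affine j : exists a c, forall x, s j <= x <= s j + 4 * dl (n j) -> Phi j x = a * x + c.
Proof.
have d0 := dl_gt0 (n j).
exists (Psi j (s j)), (Phi j (s j) - Psi j (s j) * s j) => x /andP[sx xs].
have [|y] := @MVT_segment R (Phi j) (Psi j) (s j) x sx (fun y _ => is_derive_Phi j y).
  by apply: continuous_subspaceT; exact: is_derive_continuous (is_derive_Phi j).
rewrite in_itv/= => /andP[h1 h2]; rewrite (@psi_flat j y (s j)); try lra.
Qed.

(** Telescoping: as [Phi j] is affine on the support of bump [j], passing to [Phi j.+1] changes the
    integral by a [bump_osc]. The sum starts from the zero phase, whose coefficient vanishes unless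
    [k = 0], and ends with the truncation error of [phi]. The sequences [a] and [c] serve all [k]
    and [J]. *)
Lemma core_fourier (lam : R) : exists a c : nat -> R, forall (k : int) J,
  `|intg 0 (2 * pi) (fun t => cos (lam * phi t - k%:~R * t))| +
  `|intg 0 (2 * pi) (fun t => sin (lam * phi t - k%:~R * t))| <=
  16 * (k == 0)%:R + \sum_(j < J) bump_coef dl (A j) (s j) (n j) lam (a j) (c j) k
  + 32 * `|lam| * (2 ^+ J)^-1.
Proof.
have p0 := pi_gt0 R; have p4 : pi < 4 :> R by have := pihalf_lt2 R; lra.
have pp : (0 : R) <= 2 * pi by lra.
have [a ha] := choice core_affine; have [c hc] := choice ha.
exists a, (fun j => lam * c j) => k J.
have dE (c0 : R) J' (x : R) : is_derive x 1 (fun t => lam * Phi J' t - k%:~R * t + c0) (lam * Psi J' x - k%:~R).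
  have h := is_deriveD (is_deriveB (is_deriveZ lam (is_derive_Phi J' x))
    (is_deriveZ (k%:~R : R) (is_derive_id x 1))) (is_derive_cst c0 x 1).
  rewrite [X in is_derive _ _ _ X](_ : _ = lam *: Psi J' x - k%:~R *: 1 + 0) //.
  by rewrite /GRing.scale/= mulr1 addr0.
have dF (c0 : R) (x : R) : is_derive x 1 (fun t => lam * phi t - k%:~R * t + c0) (lam * psi x - k%:~R).
  have h := is_deriveD (is_deriveB (is_deriveZ lam (core_derive x))
    (is_deriveZ (k%:~R : R) (is_derive_id x 1))) (is_derive_cst c0 x 1).
  rewrite [X in is_derive _ _ _ X](_ : _ = lam *: psi x - k%:~R *: 1 + 0) //.
  by rewrite /GRing.scale/= mulr1 addr0.
have cE c0 J' := cos_comp_continuous (is_derive_continuous (dE c0 J')).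
have cF c0 := cos_comp_continuous (is_derive_continuous (dF c0)).
pose E c0 J' := intg 0 (2 * pi) (fun t => cos (lam * Phi J' t - k%:~R * t + c0)).
have step c0 j : `|E c0 j.+1| <= `|E c0 j| +
    `|bump_osc dl (A j) (s j) (n j) lam (lam * a j - k%:~R) (lam * c j + c0)|.
  rewrite -[E c0 j.+1](subrK (E c0 j)) addrC.
  apply: le_trans (ler_normD _ _) _; rewrite lerD2l /E -intgB//.
  pose G t : R := cos (lam * Phi j.+1 t - k%:~R * t + c0) - cos (lam * Phi j t - k%:~R * t + c0).
  have cG : continuous G by move=> x; apply: cvgB; [exact: (cE c0 j.+1)|exact: (cE c0 j)].
  have [s0 s1] := s_in j; have d0 := dl_gt0 (n j).
  have G0 t : t <= s j \/ s j + 4 * dl (n j) <= t -> G t = 0.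
    move=> ht; have e : bump dl (A j) (s j) (n j) t = 0 by exact: bump_out.
    by rewrite /G /Phi big_ord_recr/= [B j t]e addr0 subrr.
  rewrite -/G (@intg_split _ G 0 (s j))//; try lra.
  rewrite (@intg_split _ G (s j) (s j + 4 * dl (n j)))//; try lra.
  rewrite (@eq_intg _ G (fun=> 0) 0 (s j)); last by move=> t ts; apply: G0; left; lra.
  rewrite (@eq_intg _ G (fun=> 0) (s j + 4 * dl (n j))); last by move=> t ts; apply: G0; right; lra.
  rewrite !intg_cst; try lra.
  rewrite !mul0r add0r addr0 le_eqVlt; apply/orP; left; apply/eqP; congr `|_|.
  apply: eq_intg => t ts; rewrite /G /bump_phase /flat_phase /Phi big_ord_recr/= -/(Phi j t) hc//.
  by congr (cos _ - cos _); rewrite /B; ring.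
have sumE c0 : `|E c0 J| <= 8 * (k == 0)%:R + \sum_(j < J)
    `|bump_osc dl (A j) (s j) (n j) lam (lam * a j - k%:~R) (lam * c j + c0)|.
  elim: J => [|J' IH].
    rewrite big_ord0 addr0 /E; apply: le_trans (flat_coefficient k c0).
    rewrite (@eq_intg _ _ (fun t => cos (- (k%:~R * t) + c0)))// => t _.
    by rewrite /Phi big_ord0 mulr0 sub0r.
  by apply: le_trans (step c0 J') _; rewrite big_ord_recr/= addrA lerD2r.
have limE c0 : `|intg 0 (2 * pi) (fun t => cos (lam * phi t - k%:~R * t + c0))| <=
    `|E c0 J| + 16 * `|lam| * (2 ^+ J)^-1.
  rewrite -[intg _ _ _](subrK (E c0 J)) addrC; apply: le_trans (ler_normD _ _) _.
  rewrite lerD2l /E -intgB//.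
  apply: (@le_trans _ _ (`|lam| * (2 * (2 ^+ J)^-1) * (2 * pi - 0))).
    apply: intg_bound => //.
      by move=> x; apply: cvgB; [exact: cF|exact: cE].
    move=> x _; apply: le_trans (cos_lip _ _) _.
    rewrite (_ : _ - _ = lam * (phi x - Phi J x)); last by ring.
    by rewrite normrM ler_wpM2l// core_phi_tail.
  have : `|lam| * (2 ^+ J)^-1 * (2 * pi) <= `|lam| * (2 ^+ J)^-1 * 8.
    by rewrite ler_wpM2l ?mulr_ge0// ?(ltW (p2 _))//; lra.
  lra.
have e1 : intg 0 (2 * pi) (fun t => cos (lam * phi t - k%:~R * t)) =
    intg 0 (2 * pi) (fun t => cos (lam * phi t - k%:~R * t + 0)).
  by apply: eq_intg => t _; rewrite addr0.
have e2 : intg 0 (2 * pi) (fun t => sin (lam * phi t - k%:~R * t)) =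
    intg 0 (2 * pi) (fun t => cos (lam * phi t - k%:~R * t + - (pi / 2))).
  by apply: eq_intg => t _; rewrite sin_cos_shift.
rewrite e1 e2.
have h1 := limE 0; have h2 := limE (- (pi / 2)).
have h3 := sumE 0; have h4 := sumE (- (pi / 2)).
rewrite /bump_coef big_split/=.
under eq_bigr do rewrite -[lam * c _]addr0.
move: h1 h2 h3 h4.
set S1 := \sum_(_ < _) _; set S2 := \sum_(_ < _) _; set q := (k == 0)%:R; lra.
Qed.

End Core.

(** * Periodic extension of a function vanishing outside one period *)

Section Periodization.
Variables (R : realType) (P : R).
Hypothesis P0 : 0 < P.

Definition periodize (f : R -> R) (x : R) : R := f (x - P * (Num.floor (x / P))%:~R).

Lemma period_cell (x : R) : exists z : int, P * z%:~R <= x < P * (z + 1)%:~R.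
Proof.
exists (Num.floor (x / P)); have /andP[h1 h2] := Num.Theory.floor_itv (x / P).
by rewrite ![P * _]mulrC -ler_pdivlMr// h1 -ltr_pdivrMr.
Qed.

Lemma periodize_cell f z (x : R) : P * z%:~R <= x < P * (z + 1)%:~R ->
  periodize f x = f (x - P * z%:~R).
Proof.
move=> h; rewrite /periodize (@Num.Theory.floor_def _ _ z)//.
by rewrite ler_pdivlMr// mulrC ltr_pdivrMr// [_ * P]mulrC.
Qed.

Lemma periodize_periodic f x : periodize f (x + P) = periodize f x.
Proof.
have [z /andP[h1 h2]] := period_cell x.
rewrite (@periodize_cell f z x) ?h1// (@periodize_cell f (z + 1)).
  by rewrite intrD mulrDr mulr1 opprD addrACA subrr addr0.
by move: h1 h2; rewrite !intrD !mulrDr mulr1; lra.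
Qed.

Lemma periodize_id f x : 0 <= x < P -> periodize f x = f x.
Proof.
by move=> h; rewrite (@periodize_cell f 0) ?mulr0 ?subr0// add0r mulr1.
Qed.

Section Window.
Variable f : R -> R.
Hypothesis fout : forall x, x <= 0 \/ P <= x -> f x = 0.

(** One formula covers two adjacent cells, so their common end point is interior and needs no
    separate treatment in the derivative and the modulus. *)
Lemma periodize_window z (x : R) : P * (z - 1)%:~R <= x <= P * (z + 1)%:~R ->
  periodize f x = f (x - P * z%:~R) + f (x - P * z%:~R + P).
Proof.
have p := P0.
rewrite intrB intrD mulrBr mulrDr mulr1; set Z := P * z%:~R => /andP[h1 h2].
have [hz|hz] := ltP x Z.
  rewrite (@periodize_cell f (z - 1)).
    rewrite intrB mulrBr mulr1 -/Z [f (x - Z)]fout ?add0r; first by congr f; ring.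
    by left; lra.
  by rewrite intrD intrB !mulrDr mulrN mulr1 -/Z; lra.
rewrite [f (_ + P)]fout ?addr0; last by right; lra.
have [hx|hx] := ltP x (Z + P).
  by rewrite (@periodize_cell f z)// intrD mulrDr mulr1 -/Z hz.
rewrite (@periodize_cell f (z + 1)); last by rewrite !intrD !mulrDr mulr1 -/Z; lra.
rewrite intrD mulrDr mulr1 -/Z !fout//; [right|left]; lra.
Qed.
End Window.

Variables f g : R -> R.
Hypotheses (fg0 : forall x, x <= 0 \/ P <= x -> f x = 0 /\ g x = 0)
  (fg : forall x : R, is_derive x 1 f (g x)).

Let f0 x : x <= 0 \/ P <= x -> f x = 0. Proof. by move=> /fg0[]. Qed.
Let g0 x : x <= 0 \/ P <= x -> g x = 0. Proof. by move=> /fg0[]. Qed.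

Lemma is_derive_periodize (x : R) : is_derive x 1 (periodize f) (periodize g x).
Proof.
have p := P0.
have [z /andP[h1 h2]] := period_cell x.
have h3 : P * (z - 1)%:~R < x.
  by apply: lt_le_trans h1; rewrite intrB mulrBr mulr1; lra.
have d (c : R) : is_derive x 1 (fun y => f (y + c)) (g (x + c)).
  have s : is_derive x 1 (fun y : R => y + c) 1.
    have := is_deriveD (is_derive_id x (1 : R)) (is_derive_cst c x 1).
    by rewrite addr0.
  have := @is_derive1_comp R f (fun y => y + c) x (g (x + c)) 1 (fg (x + c)) s.
  by rewrite /GRing.scale/= mulr1.
rewrite (@periodize_window g g0 z); last by rewrite !ltW.
have h := is_deriveD (d (- (P * z%:~R))) (d (- (P * z%:~R) + P)).
apply: (near_eq_is_derive _ _); last first.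
  rewrite -addrA; exact: h.
near=> y; rewrite (@periodize_window f f0 z); first by rewrite -[_ - _ + P]addrA.
by apply/andP; split; apply: ltW; near: y; [exact: lt_nbhsr|exact: lt_nbhsl].
Unshelve. all: by end_near. Qed.

Lemma periodize_modulus d (W : R -> R) :
  (forall x y, `|y - x| <= d -> `|g y - g x| <= W `|y - x|) ->
  forall x y, `|y - x| <= Num.min d P -> `|periodize g y - periodize g x| <= 2 * W `|y - x|.
Proof.
move=> hW; have p := P0.
have H x y : x <= y -> y - x <= Num.min d P ->
    `|periodize g y - periodize g x| <= 2 * W `|y - x|.
  move=> xy; rewrite le_min => /andP[h1 h2].
  have [z /andP[z1 z2]] := period_cell x.
  (* As [y - x <= P], both points lie in two adjacent cells, hence in one window. *)
  have [z' [/andP[a1 a2] /andP[b1 b2]]] : exists z' : int,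
      P * (z' - 1)%:~R <= x <= P * (z' + 1)%:~R /\ P * (z' - 1)%:~R <= y <= P * (z' + 1)%:~R.
    move: z1 z2; rewrite intrD mulrDr mulr1 => z1 z2.
    have [yz|yz] := leP y (P * z%:~R + P).
      by exists z; rewrite intrB intrD mulrBr mulrDr mulr1; lra.
    by exists (z + 1); rewrite intrB !intrD mulrBr !mulrDr mulr1; lra.
  rewrite !(@periodize_window g g0 z') ?a1 ?b1//.
  set u := P * z'%:~R.
  have hd : `|y - x| <= d by rewrite ger0_norm// subr_ge0.
  have e1 : y - u - (x - u) = y - x by ring.
  have e2 : y - u + P - (x - u + P) = y - x by ring.
  have k1 := @hW (x - u) (y - u); have k2 := @hW (x - u + P) (y - u + P).
  rewrite e1 in k1; rewrite e2 in k2.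
  rewrite opprD addrACA; apply: le_trans (ler_normD _ _) _.
  by rewrite mulr2n mulrDl mul1r; apply: lerD; [exact: k1|exact: k2].
move=> x y; have [xy|/ltW xy] := leP x y.
  by rewrite {1}ger0_norm ?subr_ge0//; exact: H.
by rewrite {1}distrC {1}ger0_norm ?subr_ge0// distrC [`|y - x|]distrC; exact: H.
Qed.

Lemma periodize_nonconstant :
  (forall u v, 0 <= u -> u < v -> v <= P ->
    exists x y, [/\ u < x < v, u < y < v & g x != g y]) ->
  forall u v, u < v -> exists x y, [/\ u < x < v, u < y < v & periodize g x != periodize g y].
Proof.
move=> hg u v uv; have p := P0.
have [z /andP[z1 z2]] := period_cell u.
set Z := P * z%:~R in z1.
have z3 : u < Z + P by move: z2; rewrite intrD mulrDr mulr1.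
pose v' := Num.min v (Z + P).
have uv' : u < v' by rewrite lt_min uv z3.
have v1 : v' <= v by rewrite ge_min lexx.
have v2 : v' <= Z + P by rewrite ge_min lexx orbT.
have [||| x [y [/andP[x1 x2] /andP[y1 y2] ne]]] := hg (u - Z) (v' - Z); try lra.
have cell t : u - Z < t -> t < v' - Z -> periodize g (t + Z) = g t.
  move=> t1 t2; rewrite (@periodize_cell g z) ?addrK//.
  by rewrite intrD mulrDr mulr1 -/Z; lra.
by exists (x + Z), (y + Z); rewrite !cell//; split => //; lra.
Qed.

End Periodization.

(** * Powers of sums and geometric series *)

Section PowerSums.
Variable R : realType.

Lemma powRD_le (p a b : R) : 1 <= p -> 0 <= a -> 0 <= b ->
  (a + b) `^ p <= 2 `^ (p - 1) * (a `^ p + b `^ p).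
Proof.
move=> p1 a0 b0.
have h0 : 0 <= 2^-1 :> R by rewrite invr_ge0.
have h1 : 2^-1 <= 1 :> R by rewrite invf_le1 ?ler1n.
have i1 : a \in (`[0, +oo[%classic : set R) by rewrite inE/= in_itv/= a0.
have i2 : b \in (`[0, +oo[%classic : set R) by rewrite inE/= in_itv/= b0.
have h : (2^-1 * (a + b)) `^ p <= 2^-1 * (a `^ p + b `^ p).
  have half : unstable.onem 2^-1 = 2^-1 :> R by rewrite /unstable.onem; lra.
  rewrite !mulrDr -{2 4}half; exact: (convex_powR p1 (Itv01 h0 h1) i1 i2).
rewrite powRM ?addr_ge0// in h.
have e : 2 `^ p * 2^-1 `^ p = 1 :> R by rewrite -powRM// divff// powR1.
have p20 : 0 < 2 `^ p :> R by rewrite powR_gt0.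
have : 2 `^ p * (2^-1 `^ p * (a + b) `^ p) <= 2 `^ p * (2^-1 * (a `^ p + b `^ p)).
  by rewrite ler_wpM2l// ltW.
have s : 2 `^ p * 2^-1 = 2 `^ (p - 1) :> R.
  by rewrite (powR_split (ler0n R 2) (lt_le_trans ltr01 p1)) mulfK.
by rewrite !mulrA e mul1r s.
Qed.

(** Splitting off one summand at a time by convexity costs a further factor [2 ^ (p - 1)], whence
    the weights. *)
Lemma powR_sum_le (p : R) (a : nat -> R) J : 1 <= p -> (forall j, 0 <= a j) ->
  (\sum_(j < J) a j) `^ p <= \sum_(j < J) (2 `^ (p - 1)) ^+ j.+1 * a j `^ p.
Proof.
move=> p1; elim: J a => [|J IH] a a0.
  by rewrite !big_ord0 powR0//; lra.
rewrite !big_ord_recl/=.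
apply: le_trans (powRD_le p1 (a0 0%N) _) _; first exact: sumr_ge0.
rewrite expr1 mulrDr lerD2l; have h := IH (fun j => a j.+1) (fun j => a0 j.+1).
apply: (@le_trans _ _ (2 `^ (p - 1) * \sum_(j < J) (2 `^ (p - 1)) ^+ j.+1 * a j.+1 `^ p)).
  by rewrite ler_wpM2l// powR_ge0.
by rewrite mulr_sumr; apply: ler_sum => j _; rewrite mulrA -exprS.
Qed.

Lemma powR_two_sub1 (p : R) : p <= 2 -> 2 `^ (p - 1) <= 2 :> R.
Proof. by move=> p2; rewrite -[leRHS]powRr1//; apply: ler_powR; [rewrite ler1n|lra]. Qed.

Lemma powR_le_self (p q : R) : 1 <= p -> 0 <= q -> q <= 1 -> q `^ p <= q.
Proof.
move=> p1 q0 q1; have [->|qn] := eqVneq q 0; first by rewrite powR0//; lra.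
by rewrite -[leRHS]powRr1//; apply: ger_powR => //; rewrite lt_neqAle eq_sym qn q0.
Qed.

(** [q] is a truncation error: being at most 1 it dominates its [p]-th power, and over [Y] it adds
    up to at most 1. The constant is 1028 = 4 . 256 + 4, where 256 = 16^2 bounds 16^p. *)
Lemma sum_pow_split (p q : R) (Y : seq int) (F : int -> R) (c : nat -> int -> R) J :
  1 <= p -> p <= 2 -> uniq Y -> 0 <= q -> (size Y)%:R * q <= 1 -> q <= 1 ->
  (forall k, 0 <= F k) -> (forall j k, 0 <= c j k) ->
  (forall k, F k <= 16 * (k == 0)%:R + \sum_(j < J) c j k + q) ->
  \sum_(k <- Y) F k `^ p <=
    1028 + 2 * \sum_(j < J) (2 `^ (p - 1)) ^+ j.+1 * \sum_(k <- Y) c j k `^ p.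
Proof.
move=> p1 p2 uY q0 Yq q1 F0 c0 hF; have p0 : 0 <= p by lra.
set K := 2 `^ (p - 1); have K2 : K <= 2 by exact: powR_two_sub1.
have step a b : 0 <= a -> 0 <= b -> (a + b) `^ p <= 2 * (a `^ p + b `^ p).
  move=> a0 b0; apply: le_trans (powRD_le p1 a0 b0) _.
  by rewrite ler_wpM2r// addr_ge0// powR_ge0.
have h16 (k : int) : (16 * (k == 0)%:R) `^ p <= 256 * (k == 0)%:R :> R.
  case: (k == 0); last by rewrite !mulr0 powR0//; lra.
  by rewrite !mulr1; apply: le_trans (powR_le_sqr _ p2) _; [lra|rewrite expr2; lra].
have termwise k : F k `^ p <= 1024 * (k == 0)%:R + 4 * q + 2 * \sum_(j < J) K ^+ j.+1 * c j k `^ p.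
  have S0 : 0 <= \sum_(j < J) c j k by exact: sumr_ge0.
  have d0 : 0 <= 16 * (k == 0)%:R :> R by rewrite mulr_ge0.
  apply: (@le_trans _ _ ((16 * (k == 0)%:R + q + \sum_(j < J) c j k) `^ p)).
    by apply: powR_le => //; rewrite addrAC; exact: hF.
  apply: le_trans (step _ _ (addr_ge0 d0 q0) S0) _.
  have h1 := step _ _ d0 q0; have h2 := h16 k; have h3 := powR_le_self p1 q0 q1.
  have h4 := powR_sum_le J p1 (fun j => c0 j k).
  move: h1 h2 h3 h4; rewrite -/K.
  set u1 := (_ + _) `^ p; set u2 := (_ * _) `^ p; set u3 := q `^ p; set u4 := (\sum_(j < J) _) `^ p.
  set u5 := \sum_(j < J) _; set d := (k == 0)%:R; lra.
apply: le_trans (ler_sum _ _) _; first by move=> k _; exact: termwise.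
rewrite !big_split/= -!mulr_sumr exchange_big/=.
under [X in _ + 2 * X <= _]eq_bigr do rewrite -mulr_sumr.
rewrite lerD2r.
have dY : \sum_(k <- Y) (k == 0)%:R <= 1 :> R.
  rewrite -natr_sum (_ : (\sum_(k <- Y) (k == 0))%N = count_mem 0 Y).
    by rewrite count_uniq_mem//; case: (_ \in _).
  by rewrite -sum1_count [RHS]big_mkcond/=; apply: eq_bigr => k _; case: (k == 0).
rewrite big_const_seq count_predT iter_addr_0 -mulr_natl; lra.
Qed.

Lemma geometric_sum_lt (r : R) J : 0 <= r -> r < 1 -> \sum_(j < J) r ^+ j <= (1 - r)^-1.
Proof.
move=> r0 r1; have h : 0 < 1 - r by lra.
suff : (1 - r) * \sum_(j < J) r ^+ j <= 1 by rewrite -ler_pdivlMl// mulr1.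
by rewrite -opprB mulNr -subrX1 opprB lerBlDr lerDl exprn_ge0.
Qed.

(** Let 2^I <= lam < 2^(I+1). For j < I the minimum is bounded by 1, and I <= log_2 lam; from j = I
    on, lam 4^-j <= 2 2^-j. *)
Lemma min_sum_log (lam : R) (n : nat -> nat) J : 1 <= lam -> (forall j, (j.*2 <= n j)%N) ->
  \sum_(j < J) Num.min 1 (lam * ((2 ^+ n j)^-1 * (2 ^+ n j)^-1)) <= ln lam / ln 2 + 4.
Proof.
move=> l1 nj; have [I /andP[hI1 hI2]] := pow2_between l1.
have ln2 : 0 < ln 2 :> R by apply: ln_gt0; lra.
have hI : I%:R <= ln lam / ln 2.
  rewrite ler_pdivlMr// mulr_natl -lnXn// ler_ln ?posrE ?exprn_gt0//; lra.
have termwise (j : nat) : Num.min 1 (lam * ((2 ^+ n j)^-1 * (2 ^+ n j)^-1)) <=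
    (j < I)%:R + 2 * (2^-1 ^+ j).
  have q0 : 0 < (2 ^+ j)^-1 :> R by rewrite invr_gt0 exprn_gt0.
  rewrite exprVn ge_min; have [jI|Ij] := ltnP j I; first by rewrite /= lerDl mulr_ge0// ltW.
  apply/orP; right; rewrite add0r.
  have hj : (2 ^+ n j)^-1 <= (2 ^+ j)^-1 :> R.
    rewrite lef_pV2 ?posrE ?exprn_gt0// ler_weXn2l ?ler1n//.
    by apply: leq_trans (nj j); rewrite -addnn leq_addr.
  have n0 : 0 <= (2 ^+ n j)^-1 :> R by rewrite invr_ge0 exprn_ge0.
  apply: (@le_trans _ _ (2 ^+ I.+1 * ((2 ^+ j)^-1 * (2 ^+ j)^-1))).
    by apply: ler_pM; rewrite ?mulr_ge0 ?(ltW hI2)//; [lra|exact: ler_pM].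
  rewrite exprS -mulrA ler_wpM2l// mulrA ler_piMl ?(ltW q0)//.
  by rewrite ler_pdivrMr ?exprn_gt0// mul1r ler_weXn2l// ler1n.
apply: le_trans (ler_sum _ _) _; first by move=> j _; exact: termwise.
rewrite big_split/= -mulr_sumr; apply: lerD; last first.
  have := @geometric_sum_lt 2^-1 J; rewrite (_ : (1 - 2^-1)^-1 = 2 :> R); last by field.
  by move=> h; have := h ltac:(lra) ltac:(lra); lra.
apply: le_trans hI; rewrite -natr_sum ler_nat -(big_mkord xpredT (fun j => nat_of_bool (j < I)%N)).
suff [] : (\sum_(0 <= j < J) (j < I) <= I)%N /\ (\sum_(0 <= j < J) (j < I) <= J)%N by [].
elim: J => [|J [IH1 IH2]]; first by rewrite big_geq.
rewrite big_nat_recr//=; have [h|h] := ltnP J I; last by rewrite addn0 IH1 leqW.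
by rewrite addn1 ltnS; split => //; exact: leq_ltn_trans IH2 h.
Qed.

End PowerSums.

(** The absolute values of real and imaginary part are added in place of taking the modulus, since
    each is bounded separately by telescoping. *)
Definition trig_coef (R : realType) (f : R -> R) (lam : R) (k : int) : R :=
  `|intg 0 (2 * pi) (fun t => cos (lam * f t - k%:~R * t))| +
  `|intg 0 (2 * pi) (fun t => sin (lam * f t - k%:~R * t))|.

(** * Summation over all bumps *)

Section OneDimensional.
Variables (R : realType) (w : R -> R).
Hypothesis hw : modulus_hyp w.

(** For chi(ds) = (ln lam)^2 / lam one has ln lam = w(ds) Theta_1(lam), and ds <= 1 for large lam.
    So Theta_1 absorbs constants and the logarithm coming from [min_sum_log]. *)
Lemma Theta1_lower : exists W L : R, 0 <= W /\ forall lam, L <= lam ->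
  [/\ 1 <= lam, 1 <= ln lam, 0 <= Theta w 1 lam & ln lam <= W * Theta w 1 lam].
Proof.
have [L0 hL0] := ln_sqr_small (chi_gt0 hw (@ltr01 R)).
have w1 : 0 < w 1 by apply: modulus_gt0.
exists (w 1), (Num.max L0 (expR 1)); split; first exact: ltW.
move=> lam; rewrite ge_max => /andP[/hL0[l0 small] le].
have l1 : 1 <= ln lam by rewrite -[1]expRK ler_ln ?posrE ?expR_gt0.
have l1' : 1 <= lam by apply: le_trans le; rewrite -[1]expR0 ler_expR.
move: small l1; rewrite /Theta eqxx; set l := ln lam => small l1.
have lpos : 0 < l by lra.
have q0 : 0 < l ^+ 2 / lam by rewrite divr_gt0// exprn_gt0.
set ds := chi_inv w (l ^+ 2 / lam).
have ds0 : 0 < ds by exact: chi_inv_gt0.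
have chids : ds * w ds = l ^+ 2 / lam by apply: chi_invK => //; exact: ltW.
have dsb : ds <= 1 by apply: chi_inv_le => //; exact: ltW.
have wds : w ds <= w 1 by apply: modulus_mono => //; exact: ltW.
have a0 : 0 <= lam / l * ds by rewrite !mulr_ge0 ?invr_ge0 ?ltW.
split => //; apply: (@le_trans _ _ (w ds * (lam / l * ds))); last by rewrite ler_wpM2r.
rewrite (_ : w ds * _ = lam / l * (ds * w ds)); last by ring.
by rewrite chids le_eqVlt; apply/orP; left; apply/eqP; field; rewrite !gt_eqF.
Qed.

Lemma theta_int_lower (p : R) : 0 < p -> exists t : R, 0 < t /\
  forall y, 2 <= y -> t <= theta_int w p y.
Proof.
move=> p0; exists (chi_inv w 2^-1 `^ p); split.
  by rewrite powR_gt0//; apply: chi_inv_gt0 => //; rewrite invr_gt0.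
move=> y y2; have := @theta_int_dyadic R w hw p 1 y p0.
by rewrite expr1 big_ord_recr big_ord0/= add0r expr0 mul1r expr1; apply.
Qed.

Variables (dl : nat -> R) (ka d0 : R).
Hypotheses (ka0 : 0 < ka <= 1) (d00 : 0 < d0)
  (dbl : forall d, 0 < d -> d < d0 -> w (2 * d) < 2 * w d)
  (dl_gt0 : forall n, 0 < dl n) (dl2 : forall n, 2 * dl n.+1 < dl n)
  (wdl : forall n, w (dl n) = ka * (2 ^+ n)^-1) (dl01 : dl 0%N <= 1).
Variable n : nat -> nat.
Hypothesis n_ge : forall j, (j.*2 <= n j)%N.

Let n_pow j : (2 ^+ n j)^-1 <= (2^-1 ^+ j) * (2^-1 ^+ j) :> R.
Proof.
rewrite !exprVn -invfM -exprD lef_pV2 ?posrE ?exprn_gt0// ler_weXn2l ?ler1n//.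
by rewrite addnn.
Qed.

(** Put K = 2^(p-1). Both dl(n_j) and 2^-n_j are at most 4^-j, so the weights K^(j+1) turn the two
    terms of [packet_sum_p] into multiples of K^-j and 2^-j. The ratio K^-1 is below 1 since p > 1.
    The constant 1028 is absorbed by a positive lower bound of the integral. *)
Lemma packets_p (p : R) : 1 < p -> p < 2 -> exists C : R, 0 <= C /\
  forall lam (c : nat -> int -> R) (x mu : nat -> R) (Y : seq int) J, 2 <= lam ->
  (forall j, packet dl 90 (c j) (x j) lam (mu j) (n j)) -> uniq Y ->
  1028 + 2 * \sum_(j < J) (2 `^ (p - 1)) ^+ j.+1 * \sum_(k <- Y) c j k `^ p <=
  C * theta_int w p lam.
Proof.
move=> p1 p2; have p0 : 0 < p by lra.
have [t [t0 ht]] := theta_int_lower p0.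
set K := 2 `^ (p - 1).
have K1 : 1 < K.
  rewrite -[1](powRr0 2) /K /powR pnatr_eq0/= ltr_expR mul0r mulr_gt0//; last by apply: ln_gt0; lra.
  lra.
have K0 : 0 < K by lra.
have Ki : K^-1 < 1 by rewrite invf_lt1.
pose G := K / (1 - K^-1).
have G0 : 0 <= G by rewrite divr_ge0//; lra.
have t0' : 0 <= t^-1 by rewrite invr_ge0 ltW.
have [E [E0 EE]] : exists E : R, 0 <= E /\ 300 * 90 ^+ 2 = E.
  by eexists; split; [|reflexivity]; exact: mulr_ge0 (ler0n _ _) (exprn_ge0 _ (ler0n _ _)).
have EG : 0 <= E * G by exact: mulr_ge0.
have C00 : 0 <= 1028 + 2 * (E * G) by lra.
exists ((1028 + 2 * (E * G)) * t^-1 + 8 * E); split.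
  by apply: addr_ge0; [exact: mulr_ge0|lra].
move=> lam c x mu Y J lam2 pk uY; set T := theta_int w p lam.
have tT : t <= T by exact: ht.
have T0 : 0 <= T by apply: le_trans tT; exact: ltW.
have kj j : K ^+ j.+1 * dl (n j) `^ (p - 1) <= K * K^-1 ^+ j.
  have h1 : dl (n j) <= 2^-1 ^+ (j + j).
    have := dl_pow dl2 0 (n j); rewrite add0n => h.
    apply: (le_trans h); apply: (@le_trans _ _ ((2 ^+ n j)^-1 * 1)).
      by rewrite ler_wpM2l// invr_ge0 exprn_ge0.
    by rewrite mulr1 exprD; exact: n_pow.
  have h2 : dl (n j) `^ (p - 1) <= (2^-1 ^+ (j + j)) `^ (p - 1).
    by apply: powR_le => //; [lra|exact: ltW].
  have h3 i : (2^-1 ^+ i) `^ (p - 1) = K^-1 ^+ i.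
    have e1 : 2^-1 `^ (p - 1) = K^-1 by rewrite /K -[in RHS]powRN -[2^-1]powR_inv1// -powRrM mulN1r.
    elim: i => [|i IH]; first by rewrite !expr0 powR1.
    by rewrite !exprS powRM ?exprn_ge0 ?invr_ge0// IH e1.
  rewrite h3 in h2; apply: le_trans (ler_wpM2l _ h2) _; first by rewrite exprn_ge0// ltW.
  rewrite le_eqVlt; apply/orP; left; apply/eqP; rewrite exprD !exprVn exprS.
  by field; rewrite expf_neq0// gt_eqF.
have kn j : K ^+ j.+1 * (2 ^+ n j)^-1 <= 2 * 2^-1 ^+ j.
  have h1 : K ^+ j.+1 <= 2 ^+ j.+1.
    by rewrite lerXn2r ?nnegrE ?(ltW K0)//; apply: powR_two_sub1; exact: ltW.
  apply: (@le_trans _ _ (2 ^+ j.+1 * (2^-1 ^+ j * 2^-1 ^+ j))).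
    by apply: ler_pM; rewrite ?exprn_ge0 ?invr_ge0 ?exprn_ge0 ?(ltW K0).
  rewrite le_eqVlt; apply/orP; left; apply/eqP; rewrite !exprVn exprS.
  by field; rewrite expf_neq0.
have termwise j : K ^+ j.+1 * \sum_(k <- Y) c j k `^ p <=
    E * (2 * T * 2^-1 ^+ j + K * K^-1 ^+ j).
  have h := packet_sum_p hw ka0 dl_gt0 dl2 wdl dl01 (_ : 1 <= 90) (pk j) uY lam2 p1 (ltW p2).
  have {}h := h ltac:(lra); rewrite EE in h.
  apply: (@le_trans _ _ (K ^+ j.+1 * (E * ((2 ^+ n j)^-1 * T + dl (n j) `^ (p - 1))))).
    by rewrite ler_wpM2l// exprn_ge0// ltW.
  rewrite mulrCA ler_wpM2l// mulrDr lerD ?kj//.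
  by rewrite [leRHS]mulrAC mulrA ler_wpM2r.
have S : \sum_(j < J) K ^+ j.+1 * \sum_(k <- Y) c j k `^ p <=
    E * (4 * T + G).
  apply: le_trans (ler_sum _ _) _; first by move=> j _; exact: termwise.
  rewrite -mulr_sumr ler_wpM2l// big_split/= -!mulr_sumr.
  have [i0 i1] : 0 <= 2^-1 :> R /\ 2^-1 < 1 :> R by split; lra.
  have s1 := @geometric_sum_lt R 2^-1 J i0 i1.
  have s2 := @geometric_sum_lt R K^-1 J (ltW _) Ki.
  have {}s2 := s2 ltac:(by rewrite invr_gt0).
  apply: lerD; last by rewrite /G ler_wpM2l// ltW.
  rewrite (_ : (1 - 2^-1)^-1 = 2 :> R) in s1; last by field.
  rewrite (_ : 4 * T = 2 * T * 2); last by ring.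
  by rewrite ler_wpM2l// mulr_ge0.
have h1 : 1 <= t^-1 * T by rewrite mulrC ler_pdivlMr// mul1r.
have h2 : 1028 + 2 * (E * G) <= (1028 + 2 * (E * G)) * (t^-1 * T) by rewrite ler_peMr.
rewrite [leRHS]mulrDl -mulrA; move: S h2.
rewrite mulrDr (_ : E * (4 * T) = 4 * (E * T)); last by ring.
rewrite -[8 * E * T]mulrA; set s := \sum_(_ < _) _; set v := (1028 + _) * _.
set u := E * T; set u' := E * G; lra.
Qed.

(** For p = 1 all convexity weights are 1. The factors 2^-n_j sum geometrically, the minima sum to a
    logarithm, and [Theta1_lower] absorbs the latter. *)
Lemma packets_1 : exists C L : R, 0 <= C /\
  forall lam (c : nat -> int -> R) (x mu : nat -> R) (Y : seq int) J, L <= lam ->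
  (forall j, packet dl 90 (c j) (x j) lam (mu j) (n j)) -> uniq Y ->
  0 <= Theta w 1 lam /\
  1028 + 2 * \sum_(j < J) \sum_(k <- Y) c j k <= C * Theta w 1 lam.
Proof.
have c90 : 1 <= 90 :> R by lra.
have [C1 [L1 [C10 h1]]] := packet_sum_1 hw ka0 d00 dbl dl_gt0 dl2 wdl dl01 c90.
have [W [L2 [W0 h2]]] := Theta1_lower.
have ln2 : 0 < ln 2 :> R by apply: ln_gt0; lra.
have l2i : 0 <= (ln 2)^-1 :> R by rewrite invr_ge0 ltW.
exists (1028 * W + 2 * C1 * (2 + W / ln 2 + 4 * W)), (Num.max L1 L2); split.
  have h3 : 0 <= W / ln 2 by exact: mulr_ge0.
  by apply: addr_ge0; [lra|apply: mulr_ge0; lra].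
move=> lam c x mu Y J; rewrite ge_max => /andP[l1 l2] pk uY.
have [lam1 ln1 T0 lnT] := h2 _ l2; split => //; set T := Theta w 1 lam in T0 lnT *.
have S : \sum_(j < J) \sum_(k <- Y) c j k <= C1 * (2 * T + (ln lam / ln 2 + 4)).
  apply: (@le_trans _ _ (\sum_(j < J) C1 * (T * 2^-1 ^+ j +
      Num.min 1 (lam * ((2 ^+ n j)^-1 * (2 ^+ n j)^-1))))).
    apply: ler_sum => j _; apply: le_trans (h1 _ l1 _ _ _ _ _ (pk j) uY) _.
    rewrite ler_wpM2l// lerD2r mulrC ler_wpM2l//; apply: le_trans (n_pow j) _.
    by rewrite ler_piMr ?exprn_ge0 ?exprn_ile1 ?invr_ge0 ?invf_le1 ?ler1n.
  rewrite -mulr_sumr ler_wpM2l// big_split/= -mulr_sumr; apply: lerD; last exact: min_sum_log.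
  have [i0 i1] : 0 <= 2^-1 :> R /\ 2^-1 < 1 :> R by split; lra.
  have s1 := @geometric_sum_lt R 2^-1 J i0 i1.
  rewrite (_ : (1 - 2^-1)^-1 = 2 :> R) in s1; last by field.
  by rewrite mulrC ler_wpM2r.
have S2 : C1 * (2 * T + (ln lam / ln 2 + 4)) <= C1 * ((2 + W / ln 2 + 4 * W) * T).
  rewrite ler_wpM2l// (_ : (_ + _ + _) * T = 2 * T + (W / ln 2 * T + 4 * W * T)); last by ring.
  rewrite lerD2l; apply: lerD.
    by rewrite mulrAC ler_wpM2r.
  by rewrite -mulrA; lra.
rewrite [leRHS]mulrDl -!mulrA; move: S S2; set a1 := \sum_(_ < _) _; set a2 := C1 * _.
set a3 := C1 * _; lra.
Qed.

End OneDimensional.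

(** Bounding all finite sums uniformly, in place of an infinite sum, allows the number of bumps
    taken into account to depend on the list [Y]. *)
Theorem one_dimensional_profile (R : realType) (w : R -> R) : modulus_hyp w ->
  exists phi psi : R -> R,
  [/\ forall x, phi (x + 2 * pi) = phi x,
      forall x : R, is_derive x 1 phi (psi x),
      exists C d : R, 0 < d /\
        forall x y, `|y - x| <= d -> `|psi y - psi x| <= C * w `|y - x|,
      forall u v : R, u < v -> exists x y, [/\ u < x < v, u < y < v & psi x != psi y] &
      forall p, 1 <= p -> p < 2 -> exists C L : R, 0 <= C /\ forall lam, L <= `|lam| ->
        0 <= Theta w p `|lam| /\ forall Y : seq int, uniq Y ->
        \sum_(k <- Y) trig_coef phi lam k `^ p <= C * Theta w p `|lam| `^ p].
Proof.
move=> hw; have p0 := pi_gt0 R.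
have [dl [ka [d0 [[ka0 [d00 dbl] dl_gt0 dl2 wdl] [dl01 _]]]]] := modulus_scales hw.
have [s [n [s_in n_ge n_mono flat dense]]] := placement dl_gt0 dl2.
have [phi [psi [phiP psiP]]] := core_limits dl_gt0 dl2 dl01 s n_mono.
have pp : 0 < 2 * pi :> R by lra.
have out := core_out dl_gt0 dl2 s_in phiP psiP.
have der := core_derive hw ka0 dl_gt0 dl2 wdl phiP psiP.
have f0 x : x <= 0 \/ 2 * pi <= x -> phi x = 0 by move=> /out[].
exists (periodize (2 * pi) phi), (periodize (2 * pi) psi); split.
- by move=> x; exact: periodize_periodic.
- by move=> x; exact: is_derive_periodize.
- exists (2 * (4 / ka)), (Num.min (dl 0%N) (2 * pi)); split.
    by rewrite lt_min dl_gt0.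
  move=> x y xy; rewrite -mulrA.
  apply: (@periodize_modulus R (2 * pi) pp phi psi out (dl 0%N) (fun t => 4 / ka * w t)) => //.
  exact: core_psi_modulus.
- apply: (periodize_nonconstant pp) => //.
  exact: (core_nonconstant dl_gt0 dl2 n_mono flat dense psiP).
move=> p p1 p2.
(* On the closed period the extension agrees with [phi], also at [2 * pi], since [phi] vanishes at
   both ends. *)
have coefE lam k : trig_coef (periodize (2 * pi) phi) lam k = trig_coef phi lam k.
  have e t : 0 <= t <= 2 * pi -> periodize (2 * pi) phi t = phi t.
    move=> /andP[t0]; rewrite le_eqVlt => /predU1P[->|t1]; last first.
      by apply: periodize_id => //; rewrite t0.
    rewrite -[X in periodize _ _ X]add0r periodize_periodic// periodize_id// ?lexx//.
    by rewrite !f0//; [right|left].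
  rewrite /trig_coef; congr +%R; congr Num.norm; apply: eq_intg => t ht; by rewrite e.
have main lam : exists c : nat -> int -> R, exists x mu : nat -> R,
    (forall j, packet dl 90 (c j) (x j) `|lam| (mu j) (n j)) /\
    forall Y, uniq Y -> exists J, \sum_(k <- Y) trig_coef (periodize (2 * pi) phi) lam k `^ p <=
    1028 + 2 * \sum_(j < J) (2 `^ (p - 1)) ^+ j.+1 * \sum_(k <- Y) c j k `^ p.
  have [a [c hac]] := core_fourier hw ka0 dl_gt0 dl2 wdl dl01 s_in flat phiP psiP lam.
  pose A j := amplitude R j (n j).
  exists (fun j => bump_coef dl (A j) (s j) (n j) lam (a j) (c j)), (fun j => lam * a j),
    (fun j => lam * A j); split.
    move=> j; apply: bump_packet => //; first exact/ltW/amplitude_gt0.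
    rewrite /A /amplitude ler_piMl ?invr_ge0 ?exprn_ge0//.
    by rewrite invf_le1 ?exprn_gt0// exprn_ege1// ler1n.
  (* [J] is such that the truncation error [q] satisfies q (1 + size Y) <= 1, as [sum_pow_split]
     asks. *)
  move=> Y uY; have [J hJ] := pow2_small (32 * `|lam| * (1 + (size Y)%:R)) (@ltr01 R).
  exists J; have q0 : 0 <= 32 * `|lam| * (2 ^+ J)^-1 :> R.
    by rewrite !mulr_ge0// invr_ge0 exprn_ge0.
  set q := 32 * `|lam| * (2 ^+ J)^-1 in q0.
  have qY : q + (size Y)%:R * q <= 1.
    by apply: le_trans (ltW hJ); rewrite le_eqVlt; apply/orP; left; apply/eqP; rewrite /q; ring.
  have sY : 0 <= (size Y)%:R * q by rewrite mulr_ge0.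
  apply: (@sum_pow_split R p q Y (trig_coef (periodize (2 * pi) phi) lam)
    (fun j => bump_coef dl (A j) (s j) (n j) lam (a j) (c j)) J) => //.
  - exact: ltW.
  - by move: qY; lra.
  - by move: qY; lra.
  - by move=> k; rewrite addr_ge0.
  - by move=> j k; rewrite addr_ge0.
  - by move=> k; rewrite coefE; exact: hac.
have [p1e|p1n] := eqVneq p 1.
  have [C [L [C0 hC]]] := packets_1 hw ka0 d00 dbl dl_gt0 dl2 wdl dl01 n_ge.
  exists C, L; split => // lam lamL; have [c [x [mu [pk hY]]]] := main lam.
  rewrite p1e; split; first by have [] := hC `|lam| c x mu [::] 0%N lamL pk isT.
  move=> Y uY; have [T0 _] := hC `|lam| c x mu [::] 0%N lamL pk isT.
  have [J hJ] := hY Y uY; rewrite [X in _ <= _ * X]powRr1//; rewrite p1e in hJ.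
  apply: (le_trans hJ); have [_ h] := hC _ c x mu Y J lamL pk uY.
  apply: le_trans h; rewrite lerD2l ler_wpM2l// ler_sum// => j _.
  rewrite subrr powRr0 expr1n mul1r ler_sum// => k _; rewrite powRr1//.
  by have [h _ _ _] := pk j; have /andP[] := h k.
have p1' : 1 < p by rewrite lt_neqAle eq_sym p1n.
have [C [C0 hC]] := packets_p hw ka0 dl_gt0 dl2 wdl dl01 n_ge p1' p2.
have TE lam : Theta w p lam = theta_int w p lam `^ p^-1 by rewrite /Theta (negPf p1n).
exists C, 2; split => // lam lamL; have [c [x [mu [pk hY]]]] := main lam.
rewrite TE; split; first exact: powR_ge0.
move=> Y uY; have [J hJ] := hY Y uY.
rewrite -powRrM mulVf ?powRr1 ?theta_int_ge0//; last by rewrite gt_eqF//; lra.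
by apply: (le_trans hJ); exact: (hC `|lam| c x mu Y J).
Qed.

(** * Sums of functions of one coordinate *)

Section BoxCovering.
Variable R : realType.
Local Notation mu := (@lebesgue_measure R).

(** The inductive step of [box_cover]: a pointwise lower bound for a weighted covering is integrated
    over one coordinate, monotone convergence exchanging integral and series. *)
Lemma interval_cover (a b v : R) (c al be : nat -> R) : a <= b -> 0 <= v ->
  (forall n, 0 <= c n) -> (forall n, al n <= be n) ->
  (forall u, a <= u <= b ->
    (v%:E <= \sum_(0 <= n <oo) (c n * (al n <= u <= be n)%R%:R)%:E)%E) ->
  ((v * (b - a))%:E <= \sum_(0 <= n <oo) (c n * (be n - al n))%:E)%E.
Proof.
move=> ab v0 c0 ale h.
pose D : set R := `[a, b]%classic; pose I n : set R := `[al n, be n]%classic.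
pose g n (u : R) : \bar R := (c n * \1_(I n) u)%:E.
have mD : measurable D by exact: measurable_itv.
have mI n : measurable (I n) by exact: measurable_itv.
have muI (x y : R) : x <= y -> mu `[x, y]%classic = (y - x)%:E.
  move=> xy; rewrite lebesgue_measure_itv/= lte_fin.
  by move: xy; rewrite le_eqVlt => /predU1P[->|->//]; rewrite ltxx subrr.
have mg n : measurable_fun D (g n).
  apply/measurable_EFinP; apply: measurable_funM; first exact: measurable_cst.
  by apply: measurable_indic.
have g0 n u : (0 <= g n u)%E by rewrite lee_fin mulr_ge0.
have -> : (v * (b - a))%:E = (\int[mu]_(u in D) v%:E)%E.
  by rewrite integral_cst//= [mu D]muI.
apply: (@le_trans _ _ (\int[mu]_(u in D) (\sum_(0 <= n <oo) g n u))%E).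
  apply: ge0_le_integral => //.
  - by apply: ge0_emeasurable_sum => // n _; exact: mg.
  - move=> u; rewrite /D/= in_itv/= => hu; apply: le_trans (h u hu) _.
    apply: lee_nneseries => [n _ _|n _]; first by rewrite lee_fin mulr_ge0.
    by rewrite /g lee_fin indicE mem_setE in_itv/=.
rewrite integral_nneseries//.
apply: lee_nneseries => [n _ _|n _]; first by apply: integral_ge0.
rewrite (@integralZl_indic _ _ _ mu D mD (fun=> I n) (c n)); first last.
- exact: mI.
- by move=> cn; have := c0 n; rewrite leNgt => /negP; case.
rewrite integral_indic//; last exact: mI.
have -> : (c n * (be n - al n))%:E = ((c n)%:E * mu (I n))%E by rewrite muI.
apply: lee_wpmul2l; first by rewrite lee_fin.
exact: (le_measure mu (mem_set (measurableI _ _ (mI n) mD)) (mem_set (mI n)) (@subIsetl _ (I n) D)).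
Qed.

Variable m : nat.
Implicit Types a b x : 'rV[R]_m.

(** Integrate one coordinate at a time. The coordinates in [s], already integrated, enter through
    the side lengths [V n s], the others through the indicator [F n s x]. For empty [s] this is the
    covering itself, for full [s] the inequality of volumes. *)
Lemma box_cover a b (al be : nat -> 'rV[R]_m) : (forall i, a 0 i <= b 0 i) ->
  (forall n i, al n 0 i <= be n 0 i) -> box a b `<=` \bigcup_n box (al n) (be n) ->
  ((boxvol a b)%:E <= \sum_(0 <= n <oo) (boxvol (al n) (be n))%:E)%E.
Proof.
move=> ab ale cov.
pose F n (s : seq 'I_m) x := [forall j, (j \notin s) ==> (al n 0 j <= x 0 j <= be n 0 j)].
pose V n (s : seq 'I_m) : R := \prod_(i <- s) (be n 0 i - al n 0 i).
have V0 n s : 0 <= V n s by apply: prodr_ge0 => i _; rewrite subr_ge0.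
have claim s x : uniq s -> (forall j, j \notin s -> a 0 j <= x 0 j <= b 0 j) ->
    ((\prod_(i <- s) (b 0 i - a 0 i))%:E <= \sum_(0 <= n <oo) ((F n s x)%:R * V n s)%:E)%E.
  elim: s x => [|i s IH] x.
    move=> _ hx; have /cov[N _ hN] : box a b x by move=> i; exact: hx.
    rewrite big_nil; apply: le_trans (@nneseries_lim_ge R _ xpredT 0 N.+1 _); last first.
      by move=> n _ _; rewrite lee_fin mulr_ge0.
    rewrite big_nat_recr//= (_ : F N [::] x = true); last by apply/forallP => j; exact: hN.
    rewrite mul1r /V big_nil leeDr// sume_ge0// => n _.
    by rewrite lee_fin mulr_ge0// V0.
  move=> /= /andP[iNs us] hx.
  rewrite big_cons mulrC.
  have := @interval_cover (a 0 i) (b 0 i) (\prod_(j <- s) (b 0 j - a 0 j))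
    (fun n => (F n (i :: s) x)%:R * V n s) (fun n => al n 0 i) (fun n => be n 0 i).
  move=> /(_ (ab i)) H; apply: le_trans (H _ _ _ _) _.
  - by apply: prodr_ge0 => j _; rewrite subr_ge0.
  - by move=> n; rewrite mulr_ge0.
  - by move=> n.
  - move=> u hu; apply: le_trans (IH (setcoord x i u) us _) _.
      move=> j js; rewrite mxE; case: eqVneq => [->//|ji].
      by apply: hx; rewrite inE negb_or ji.
    apply: lee_nneseries => [n _ _|n _]; first by rewrite lee_fin mulr_ge0.
    rewrite lee_fin mulrAC ler_wpM2r// -natrM mulnb ler_nat.
    case: (boolP (F n s _)) => // /forallP hF.
    rewrite (_ : F n (i :: s) x = true); last first.
      apply/forallP => j; apply/implyP; rewrite inE negb_or => /andP[ji js].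
      by have := hF j; rewrite js/= mxE (negPf ji).
    by have := hF i; rewrite iNs/= mxE eqxx => ->.
  apply: lee_nneseries => [n _ _|n _]; first by rewrite lee_fin !mulr_ge0// subr_ge0.
  by rewrite /V big_cons lee_fin -mulrA [V n s * _]mulrC.
have := claim (enum 'I_m) 0 (enum_uniq _) _.
rewrite big_enum/= => H; apply: le_trans (H _) _.
  by move=> j; rewrite mem_enum.
apply: lee_nneseries => [n _ _|n _]; first by rewrite lee_fin mulr_ge0.
rewrite lee_fin (_ : F n _ _ = true); first by rewrite mul1r /V big_enum.
by apply/forallP => j; rewrite mem_enum.
Qed.

Lemma leb_outer_gt0 a b (A : set 'rV[R]_m) : (forall i, a 0 i < b 0 i) ->
  box a b `<=` A -> (0 < leb_outer A)%E.
Proof.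
move=> ab bA; apply: (@lt_le_trans _ _ (boxvol a b)%:E).
  by rewrite lte_fin; apply: prodr_gt0 => i _; rewrite subr_gt0.
apply: le_ereal_inf_tmp => _ [al [be [ale [cov ->]]]].
apply: box_cover => //; first by move=> i; exact: ltW.
exact: subset_trans bA cov.
Qed.

End BoxCovering.

(** * Regularity and gradient of a sum over coordinates *)

Section SeparableSum.
Variables (R : realType) (w phi psi : R -> R) (m : nat).
Hypothesis hw : modulus_hyp w.
Hypothesis dphi : forall x : R, is_derive x 1 phi (psi x).

Definition separable (f : R -> R) (t : 'rV[R]_m) : R := \sum_i f (t 0 i).

Lemma separable_periodic : (forall x, phi (x + 2 * pi) = phi x) -> Defs.periodic (separable phi).
Proof.
move=> per t i; apply: eq_bigr => j _; rewrite !mxE eqxx/=.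
by case: (j == i); rewrite ?mulr1 ?mulr0 ?addr0.
Qed.

Let quotient (i : 'I_m) (t : 'rV[R]_m) :
  (fun h : R => h^-1 *: ((separable phi \o shift t) (h *: unitv R i) - separable phi t)) =
  (fun h : R => h^-1 *: ((phi \o shift (t 0 i)) (h *: (1 : R)) - phi (t 0 i))).
Proof.
apply/funext => h; congr (_ *: _).
rewrite /= /separable (bigD1 i)//= [X in _ - X](bigD1 i)//= !mxE !eqxx/=.
rewrite (eq_bigr (fun j => phi (t 0 j))); last first.
  by move=> j ji; rewrite !mxE eqxx (negPf ji) mulr0 add0r.
by rewrite opprD addrACA subrr addr0.
Qed.

Lemma separable_derivable i t : derivable (separable phi) t (unitv R i).
Proof. by rewrite /derivable quotient; have [] := dphi (t 0 i). Qed.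

Lemma separable_partial i t : partial i (separable phi) t = psi (t 0 i).
Proof. by rewrite /partial /derive quotient; have [_ <-] := dphi (t 0 i). Qed.

Lemma edist_coord (s t : 'rV[R]_m) i : `|s 0 i - t 0 i| <= Defs.edist s t.
Proof.
rewrite -sqrtr_sqr /Defs.edist ler_wsqrtr// (bigD1 i)//= lerDl.
by apply: sumr_ge0 => j _; exact: sqr_ge0.
Qed.

Lemma separable_C1omega : (forall x, phi (x + 2 * pi) = phi x) ->
  (exists C d : R, 0 < d /\
    forall x y, `|y - x| <= d -> `|psi y - psi x| <= C * w `|y - x|) ->
  C1omega w (separable phi).
Proof.
move=> per [C [d0 [d00 hC]]]; split; [exact: separable_periodic|split=> [i t|i]].
  exact: separable_derivable.
exists `|C|, d0; split => // d t1 t2 dpos dd0 dist; rewrite !separable_partial.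
have h := le_trans (edist_coord t1 t2 i) dist.
apply: le_trans (hC _ _ (le_trans h dd0)) _.
apply: (@le_trans _ _ (`|C| * w `|t1 0 i - t2 0 i|)).
  by rewrite ler_wpM2r ?ler_norm//; exact: modulus_ge0.
by rewrite ler_wpM2l//; exact: modulus_mono.
Qed.

(** Balls of row vectors are cubes, so the coordinates may be chosen independently; along each of
    them [psi] takes two distinct values and, by continuity, all values between. *)
Lemma separable_nowhere_degenerate : continuous psi ->
  (forall u v : R, u < v -> exists x y, [/\ u < x < v, u < y < v & psi x != psi y]) ->
  grad_nowhere_degenerate (separable phi).
Proof.
move=> cpsi nonconst V oV [x Vx].
have [e /= e0 hV] := (nbhs_ballP x V).1 (open_nbhs_nbhs (conj oV Vx)).
have range p q y0 : y0 - e < p -> p <= q -> q < y0 + e -> psi p != psi q ->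
    exists ab : R * R, ab.1 < ab.2 /\
    forall c, ab.1 <= c <= ab.2 -> exists2 y, `|y0 - y| < e & psi y = c.
  move=> p1 pq q1 ne; exists (Num.min (psi p) (psi q), Num.max (psi p) (psi q)); split => /=.
    by rewrite gt_min !lt_max !ltxx orbF/= -neq_lt.
  move=> c hc; have [|y] := @IVT R psi p q c pq _ hc; first exact: continuous_subspaceT.
  by rewrite in_itv/= => /andP[y1 y2] <-; exists y => //; rewrite ltr_norml; lra.
have H i : exists ab : R * R, ab.1 < ab.2 /\
    forall c, ab.1 <= c <= ab.2 -> exists2 y, `|x 0 i - y| < e & psi y = c.
  have [|p [q [/andP[p1 p2] /andP[q1 q2] ne]]] := nonconst (x 0 i - e) (x 0 i + e); first by lra.
  have [pq|/ltW qp] := leP p q; first exact: (range p q).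
  by apply: (range q p) => //; rewrite eq_sym.
have [ab hab] := choice H.
apply: (@leb_outer_gt0 R m (\row_i (ab i).1) (\row_i (ab i).2)).
  by move=> i; rewrite !mxE; have [] := hab i.
move=> g hg.
have Y i : exists y, `|x 0 i - y| < e /\ psi y = g 0 i.
  have [_ /(_ (g 0 i))] := hab i; have := hg i; rewrite !mxE => h /(_ h)[y y1 y2].
  by exists y.
have [y hy] := choice Y.
exists (\row_i y i).
  apply: hV; split => // i j; rewrite ord1 mxE -ball_normE /=.
  by have [] := hy j.
by apply/rowP => i; rewrite !mxE separable_partial mxE; have [] := hy i.
Qed.

End SeparableSum.

(** * Factorization of Fourier coefficients and power sums *)

Section TorusFactorization.
Variables (R : realType) (m : nat).

Lemma cos_phase_shift (al : R -> R) (P Q d : R) : continuous al ->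
  Rintegral lebesgue_measure `[0, 2 * pi] (fun u => P * cos (al u + d) - Q * sin (al u + d)) =
  (P * intg 0 (2 * pi) (fun u => cos (al u)) - Q * intg 0 (2 * pi) (fun u => sin (al u))) * cos d -
  (P * intg 0 (2 * pi) (fun u => sin (al u)) + Q * intg 0 (2 * pi) (fun u => cos (al u))) * sin d.
Proof.
move=> cal.
have cc := cos_comp_continuous cal.
have cs : continuous (fun u => sin (al u)).
  by move=> u; apply: continuous_comp; [exact: cal|exact: continuous_sin].
have cZ (k : R) (f : R -> R) : continuous f -> continuous (fun u => k * f u).
  by move=> cf u; apply: cvgM; [exact: cvg_cst|exact: cf].
set C := intg _ _ (fun u => cos (al u)); set S := intg _ _ (fun u => sin (al u)).
rewrite -/(intg 0 (2 * pi) _).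
rewrite (@eq_intg R _ (fun u => (P * cos d - Q * sin d) * cos (al u) -
    (P * sin d + Q * cos d) * sin (al u))); last first.
  by move=> u _; rewrite cosD sinD; ring.
rewrite intgB; [|exact: cZ|exact: cZ].
by rewrite !intgZ// -/C -/S; ring.
Qed.

Variable al : 'I_m -> R -> R.
Hypothesis al_cont : forall i, continuous (al i).
Let C i := intg 0 (2 * pi) (fun u => cos (al i u)).
Let S i := intg 0 (2 * pi) (fun u => sin (al i u)).

(** P + iQ is the product of the complex integrals C_i + i S_i over [s], and the iterated integral
    is the real part of (P + iQ) exp(i r), where r is the phase of the remaining coordinates plus
    [c]. The free constant [c] yields the sine as well. *)
Lemma iter_int_phase (s : seq 'I_m) : uniq s -> exists P Q : R,
  P ^+ 2 + Q ^+ 2 = \prod_(i <- s) (C i ^+ 2 + S i ^+ 2) /\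
  forall c x, iter_int s (fun t => cos (\sum_i al i (t 0 i) + c)) x =
    P * cos (\sum_(i | i \notin s) al i (x 0 i) + c) -
    Q * sin (\sum_(i | i \notin s) al i (x 0 i) + c).
Proof.
elim: s => [_|i s IH /= /andP[iNs us]].
  by exists 1, 0; rewrite big_nil expr1n expr0n addr0; split => // c x; rewrite /= mul1r mul0r subr0.
have [P [Q [PQ hPQ]]] := IH us.
exists (P * C i - Q * S i), (P * S i + Q * C i); split.
  by rewrite big_cons -PQ; ring.
move=> c x /=; set r := \sum_(j | j \notin i :: s) _.
rewrite -cos_phase_shift//; apply: eq_Rintegral => u _; rewrite hPQ.
suff -> : \sum_(j | j \notin s) al j (setcoord x i u 0 j) = al i u + r by rewrite addrA.
rewrite (bigD1 i)//= !mxE eqxx; congr (_ + _); apply: eq_big => [j|j /andP[_ ji]].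
  by rewrite inE negb_or andbC.
by rewrite mxE (negPf ji).
Qed.

Lemma torus_int_phase :
  torus_int (fun t => cos (\sum_i al i (t 0 i))) ^+ 2 +
  torus_int (fun t => sin (\sum_i al i (t 0 i))) ^+ 2 = \prod_i (C i ^+ 2 + S i ^+ 2).
Proof.
have [P [Q [PQ hPQ]]] := iter_int_phase (enum_uniq 'I_m).
have r0 x : \sum_(i | i \notin enum 'I_m) al i (x 0 i) = 0 :> R.
  by rewrite big1// => i; rewrite mem_enum.
rewrite big_enum/= in PQ; rewrite -PQ.
have -> : torus_int (fun t => cos (\sum_i al i (t 0 i))) = P.
  rewrite /torus_int (_ : (fun t : 'rV_m => _) = (fun t => cos (\sum_i al i (t 0 i) + 0))).
    by rewrite hPQ r0 addr0 cos0 sin0 mulr1 mulr0 subr0.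
  by apply/funext => t; rewrite addr0.
have -> : torus_int (fun t => sin (\sum_i al i (t 0 i))) = Q.
  rewrite /torus_int (_ : (fun t : 'rV_m => _) = (fun t => cos (\sum_i al i (t 0 i) + - (pi / 2)))).
    by rewrite hPQ r0 add0r cosN sinN cos_pihalf sin_pihalf mulr0 sub0r mulrN1 opprK.
  by apply/funext => t; rewrite sin_cos_shift.
by [].
Qed.

End TorusFactorization.

(** The normalization (2 pi)^-m is at most 1 and is dropped; in each factor the modulus is at most
    the sum of the absolute values of real and imaginary part. *)
Lemma fourier_exp_abs_le (R : realType) (m : nat) (phi : R -> R) (lam : R) (k : 'rV[int]_m) :
  continuous phi ->
  fourier_exp_abs lam (separable phi) k <= \prod_i trig_coef phi lam (k 0 i).
Proof.
move=> cphi.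
pose al (i : 'I_m) (u : R) := lam * phi u - (k 0 i)%:~R * u.
have cal i : continuous (al i).
  move=> u; apply: cvgB; apply: cvgM; try exact: cvg_cst; last exact: cvg_id.
  exact: cphi.
have e (t : 'rV[R]_m) : lam * separable phi t - kdot k t = \sum_i al i (t 0 i).
  by rewrite /separable /kdot mulr_sumr -sumrB.
have := torus_int_phase cal.
rewrite /fourier_exp_abs.
under [fun t => cos (lam * _ - _)]eq_fun do rewrite e.
under [fun t => sin (lam * _ - _)]eq_fun do rewrite e.
move=> ->.
have p1 : 1 <= 2 * pi :> R by have := pi_ge2 R; lra.
have q1 : ((2 * pi) ^- m : R) <= 1 by rewrite invf_le1 ?exprn_ege1// exprn_gt0//; lra.
have T0 i : 0 <= trig_coef phi lam (k 0 i) by rewrite addr_ge0.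
apply: (@le_trans _ _ (Num.sqrt (\prod_i (trig_coef phi lam (k 0 i)) ^+ 2))).
  apply: (@le_trans _ _ (1 * Num.sqrt (\prod_i ((intg 0 (2 * pi) (fun u : R => cos (al i u))) ^+ 2 +
         (intg 0 (2 * pi) (fun u : R => sin (al i u))) ^+ 2)))).
    by apply: ler_wpM2r => //; exact: sqrtr_ge0.
  rewrite mul1r ler_wsqrtr//; apply: ler_prod => i _; rewrite addr_ge0 ?sqr_ge0//=.
  rewrite /trig_coef -[X in X + _ <= _]real_normK ?num_real// -[X in _ + X <= _]real_normK ?num_real//.
  set u := `|_|; set v := `|_|; rewrite sqrrD lerD2r lerDl.
  by apply: mulrn_wge0; apply: mulr_ge0; exact: normr_ge0.
by rewrite prodrXl sqrtr_sqr ger0_norm// prodr_ge0.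
Qed.

Lemma powR_prod (R : realType) (I : finType) (F : I -> R) (p : R) :
  (forall i, 0 <= F i) -> (\prod_i F i) `^ p = \prod_i F i `^ p.
Proof.
move=> F0; suff [] : (\prod_i F i) `^ p = \prod_i F i `^ p /\ 0 <= \prod_i F i by [].
elim/big_rec2: _ => [|i x y _ [IH y0]]; first by rewrite powR1.
by rewrite powRM// IH; split => //; exact: mulr_ge0.
Qed.

(** A finite set of frequencies lies in the grid Y^m, where [Y] lists all coordinates that occur;
    over the grid the sum of products is a product of [m] equal sums. *)
Lemma Ap_sum_le (R : realType) (m : nat) (phi : R -> R) (lam p M : R) :
  continuous phi -> 0 <= p ->
  (forall Y : seq int, uniq Y -> \sum_(k <- Y) trig_coef phi lam k `^ p <= M) ->
  (0 <= Ap_sum p lam (@separable R m phi) <= (M ^+ m)%:E)%E.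
Proof.
move=> cphi p0 hM.
have T0 k : 0 <= trig_coef phi lam k by rewrite addr_ge0.
apply/andP; split; first by apply: esum_ge0 => k _; rewrite lee_fin powR_ge0.
apply: ge_ereal_sup => _ [X [fX _] <-].
rewrite fsbig_finite//= sumEFin lee_fin.
set Xs : seq 'rV[int]_m := finmap.enum_fset (fset_set X).
have uX : uniq Xs by exact: finmap.fset_uniq.
pose Y := undup (flatten [seq [seq k 0 i | i <- enum 'I_m] | k : 'rV[int]_m <- Xs]).
have uY : uniq Y by exact: undup_uniq.
have XY k i : k \in Xs -> k 0 i \in Y.
  move=> kX; rewrite mem_undup; apply/flatten_mapP; exists k => //.
  by apply: map_f; rewrite mem_enum.
pose N := size Y.
(* The points of the grid, indexed by functions so that sum and product can be interchanged. *)
pose z (f : {ffun 'I_m -> 'I_N}) : 'rV[int]_m := \row_i nth 0 Y (f i).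
have zinj : injective z.
  move=> f g /rowP e; apply/ffunP => i; apply/val_inj.
  by have := e i; rewrite !mxE => /eqP; rewrite nth_uniq// => /eqP.
pose Z := map z (enum {ffun 'I_m -> 'I_N}).
have uZ : uniq Z by rewrite map_inj_uniq// enum_uniq.
have XZ : perm_eq Xs [seq k <- Z | k \in Xs].
  apply: uniq_perm => //; first exact: filter_uniq.
  move=> k; rewrite mem_filter; case: (boolP (k \in Xs)) => //= kX; apply/esym/mapP.
  have iN (i : 'I_m) : (index (k 0%R i) Y < N)%N by rewrite index_mem; exact: XY.
  exists [ffun i => Ordinal (iN i)]; first by rewrite mem_enum.
  by apply/rowP => i; rewrite mxE ffunE/= nth_index//; exact: XY.
rewrite (perm_big _ XZ)/= big_filter big_mkcond/=.
apply: (@le_trans _ _ (\sum_(k <- Z) \prod_i trig_coef phi lam (k 0 i) `^ p)).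
  apply: ler_sum => k _; case: ifP => _; last by apply: prodr_ge0 => i _; exact: powR_ge0.
  rewrite -powR_prod//; apply: powR_le => //; last exact: fourier_exp_abs_le.
  by rewrite mulr_ge0 ?sqrtr_ge0// invr_ge0 exprn_ge0// mulr_ge0// pi_ge0.
rewrite big_map big_enum/=.
under eq_bigr do under eq_bigr do rewrite mxE.
rewrite -(bigA_distr_bigA (fun _ (j : 'I_N) => trig_coef phi lam (nth 0 Y j) `^ p)).
rewrite prodr_const card_ord lerXn2r ?nnegrE//.
- by apply: sumr_ge0 => j _; exact: powR_ge0.
- by apply: le_trans (hM [::] isT); rewrite big_nil.
by apply: le_trans (hM Y uY); rewrite (big_nth 0) big_mkord.
Qed.

Theorem theorem2 (R : realType) (m : nat) (w : R -> R) :
  (1 <= m)%N -> modulus_hyp w ->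
  exists phi : 'rV[R]_m -> R,
    C1omega w phi /\ grad_nowhere_degenerate phi /\
    forall p : R, 1 <= p -> p < 2 ->
      exists C L : R, forall lam : R, L <= `|lam| ->
        (Ap_sum p lam phi < +oo)%E /\
        (fine (Ap_sum p lam phi)) `^ p^-1 <= C * (Theta w p `|lam|) ^+ m.
Proof.
move=> _ hw; have [phi [psi [per dphi psi_mod nonconst sums]]] := one_dimensional_profile hw.
exists (separable phi); split; first exact: separable_C1omega.
(* The smallness of [w] near 0 is read off at the points [dl N], where its values are known. *)
have cpsi : continuous psi.
  have [C [d [d0 hC]]] := psi_mod.
  move=> x; apply/(@cvgrPdist_le _ R^o) => e e0.
  have [dl [ka [d1 [[/andP[ka0 ka1] _ dl0 dl2 wdl] _]]]] := modulus_scales hw.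
  have [N hN] := pow2_small (`|C| * ka) e0.
  have r0 : 0 < Num.min d (dl N) by rewrite lt_min d0 dl0.
  near=> y; have xy : `|x - y| <= Num.min d (dl N).
    by near: y; apply: (@cvgrPdist_le _ R^o _ _ _ id x).1 => //; exact: cvg_id.
  move: xy; rewrite le_min => /andP[h1 h2].
  apply: le_trans (hC _ _ h1) _; apply: le_trans (ltW hN).
  have h3 : w `|x - y| <= ka * (2 ^+ N)^-1 by rewrite -wdl; apply: modulus_mono.
  apply: (@le_trans _ _ (`|C| * w `|x - y|)).
    by rewrite ler_wpM2r ?ler_norm// modulus_ge0.
  by rewrite -mulrA ler_wpM2l.
split; first exact: separable_nowhere_degenerate.
move=> p p1 p2; have p0 : 0 < p by lra.
have [C [L [C0 hS]]] := sums p p1 p2.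
(* The 1/p-th power of (C T^p)^m is (C^(1/p) T)^m. *)
exists ((C `^ p^-1) ^+ m), L => lam /hS[T0 hY].
have cphi : continuous phi := is_derive_continuous dphi.
set T := Theta w p `|lam| in T0 hY *.
have /andP[A0 A1] := @Ap_sum_le R m phi lam p _ cphi (ltW p0) hY.
have fin : (Ap_sum p lam (@separable R m phi) < +oo)%E by exact: le_lt_trans A1 (ltry _).
split => //.
have le : fine (Ap_sum p lam (@separable R m phi)) <= (C * T `^ p) ^+ m.
  by rewrite -lee_fin fineK// ge0_fin_numE.
apply: (@le_trans _ _ (((C * T `^ p) ^+ m) `^ p^-1)).
  by apply: powR_le => //; [rewrite invr_ge0 ltW|exact: fine_ge0].
rewrite -exprMn -!powR_mulrn ?mulr_ge0 ?powR_ge0// powRAC powRM ?powR_ge0// -powRrM mulfV ?gt_eqF//.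
by rewrite powRr1.
Unshelve. all: by end_near. Qed.
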